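(* Let $(N,J,\nabla,\xi)$ be a conical special complex manifold and let $(\bar N,\bar J)$ be the associated projective special complex manifold, with principal $\mathbb C^*$-bundle $p_N:N\to\bar N$. Then $(\bar N,\bar J)$ carries a canonical c-projective structure: for every principal connection form $\hat\alpha$ of type $(1,0)$ on $p_N:N\to\bar N$, the formula $$\bar\nabla'^{\alpha}_XY=p_{N*}\big(\nabla'_{X^{h_\alpha}}Y^{h_\alpha}\big),\qquad X,Y\in\Gamma(T\bar N),$$ defines a torsion-free connection on $\bar N$ with $\bar\nabla'^{\alpha}\bar J=0$, and the c-projective structure $[\bar\nabla'^{\alpha}]$ does not depend on the choice of $\hat\alpha$.
   Context: A special complex manifold $(N,J,\nabla)$ is a complex manifold $(N,J)$ with a torsion-free flat connection $\nabla$ such that $\nabla J$ is symmetric, i.e. $(\nabla_XJ)Y=(\nabla_YJ)X$. A conical special complex manifold $(N,J,\nabla,\xi)$ is a special complex manifold with a vector field $\xi$ such that $\nabla\xi=\mathrm{id}$ and $L_\xi J=0$. Put $\nabla'=\nabla-\tfrac12J(\nabla J)$, a torsion-free connection with $\nabla'J=0$. Let $\bar N=N/\langle\xi,J\xi\rangle$ be the quotient, with complex structure $\bar J$ induced by $J$ (one has $L_\xi J=L_{J\xi}J=0$). $(\bar N,\bar J)$ is called a projective special complex manifold if $p_N:N\to\bar N$ is a principal $\mathbb C^*$-bundle whose principal action is generated by the holomorphic vector field $\xi-\sqrt{-1}J\xi$; thus $\xi$ and $J\xi$ are the fundamental vector fields of $1,\sqrt{-1}\in\mathbb C=\mathrm{Lie}\,\mathbb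 C^*$. A principal connection form of type $(1,0)$ is a $\mathbb C$-valued connection form $\hat\alpha=\alpha-\sqrt{-1}(\alpha\circ J)$ with $\alpha$ a real one-form; equivalently its kernel is $J$-invariant. $X^{h_\alpha}$ is the $\hat\alpha$-horizontal lift of $X$. Two torsion-free complex connections $\nabla^1,\nabla^2$ (i.e. preserving the complex structure $J$) on a complex manifold are c-projectively related if there is a one-form $\theta$ with $\nabla^1_XY=\nabla^2_XY+\theta(X)Y+\theta(Y)X-\theta(JX)JY-\theta(JY)JX$. A c-projective structure is an equivalence class of this relation. *)

(* Defs.v *)
From HB Require Import structures.
From mathcomp Require Import all_boot all_order all_algebra.
From mathcomp Require Import all_classical all_reals all_analysis.
From mathcomp Require Import complex.

Set Implicit Arguments.
Unset Strict Implicit.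
Unset Printing Implicit Defensive.

Import Order.TTheory GRing.Theory Num.Theory.
Import numFieldNormedType.Exports.

Local Open Scope classical_set_scope.
Local Open Scope ring_scope.

Section SmoothMaps.
Context {R : realType}.

(* Meaningful for open [U]: [f] is [k] times continuously (Frechet)
   differentiable on [U]. *)
Fixpoint Ck (k : nat) {E F : normedModType R} (U : set E) (f : E -> F) : Prop :=
  match k with
  | 0 => forall x, U x -> {for x, continuous f}
  | k.+1 => (forall x, U x -> differentiable f x) /\
            (forall v : E, Ck k U (fun x => 'D_v f x))
  end.

Definition smooth {E F : normedModType R} (U : set E) (f : E -> F) : Prop :=
  forall k, Ck k U f.

(* [cto] and [cfrom] are total functions; only the values of [cto] on [cdom]
   and of [cfrom] on the image of [cdom] are relevant. *)
Record chart (M : topologicalType) (E : normedModType R) := Chart {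
  cdom : set M;
  cto : M -> E;
  cfrom : E -> M }.

Definition is_chart (M : topologicalType) (E : normedModType R)
    (c : chart M E) : Prop :=
  [/\ open (cdom c),
      open (cto c @` cdom c),
      forall x, cdom c x -> cfrom c (cto c x) = x,
      forall x, cdom c x -> {for x, continuous (cto c)} &
      forall x, cdom c x -> {for cto c x, continuous (cfrom c)}].

Definition is_atlas (M : topologicalType) (E : normedModType R)
    (A : set (chart M E)) : Prop :=
  [/\ forall c, A c -> is_chart c,
      forall x, exists2 c, A c & cdom c x &
      forall c c', A c -> A c' ->
        smooth (cto c @` (cdom c `&` cdom c')) (cto c' \o cfrom c)].

(* Meaningful for open [U]. *)
Definition smooth_map (M M' : topologicalType) (E E' : normedModType R)
    (A : set (chart M E)) (A' : set (chart M' E')) (U : set M) (F : M -> M') :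
    Prop :=
  (forall x, U x -> {for x, continuous F}) /\
  (forall c c', A c -> A' c' ->
     smooth (cto c @` (cdom c `&` U `&` F @^-1` cdom c'))
            (cto c' \o F \o cfrom c)).

Definition prod_chart (M M' : topologicalType) (E E' : normedModType R)
    (c : chart M E) (c' : chart M' E') : chart (M * M')%type (E * E')%type :=
  Chart (cdom c `*` cdom c')
        (fun x => (cto c x.1, cto c' x.2))
        (fun u => (cfrom c u.1, cfrom c' u.2)).

Definition prod_atlas (M M' : topologicalType) (E E' : normedModType R)
    (A : set (chart M E)) (A' : set (chart M' E')) :
    set (chart (M * M')%type (E * E')%type) :=
  [set prod_chart c.1 c.2 | c in A `*` A'].

Definition id_atlas (E : normedModType R) : set (chart E E) :=
  [set Chart setT idfun idfun].

End SmoothMaps.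

Arguments id_atlas {R} E.

Record manifold (R : realType) (d : nat) := Manifold {
  carrier :> topologicalType;
  atlas : set (chart carrier 'rV[R]_d);
  manifold_hausdorff : hausdorff_space carrier;
  manifold_second_countable : @second_countable carrier;
  manifold_atlas : is_atlas atlas }.

Arguments atlas {R d} m : rename.

(* A tangent vector at [x] is the operator "directional derivative at [x]" on
   functions smooth near [x]. It is extended by 0 to all other functions, so
   that tangent vectors are equal as soon as they agree on functions smooth
   near [x]. Vector fields, endomorphism fields, one-forms and connections are
   raw functions subjected to the predicates below. *)
Notation tvec R M := ((carrier M -> R) -> R^o) (only parsing).
Notation vfld R M := (carrier M -> (carrier M -> R) -> R^o) (only parsing).
Notation endo R M := (carrier M -> tvec R M -> tvec R M) (only parsing).
Notation form1 R M := (carrier M -> tvec R M -> R) (only parsing).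
Notation conn R M := (vfld R M -> vfld R M -> vfld R M) (only parsing).

Section Tangent.
Context {R : realType} {d : nat} {M : manifold R d}.
Implicit Types (x : M) (f : M -> R) (v w : tvec R M) (X Y Z : vfld R M).
Implicit Types (U V : set M).

(* Meaningful for open [U]. *)
Definition smooth_on U f : Prop :=
  forall c, atlas M c ->
    smooth (cto c @` (cdom c `&` U)) (f \o cfrom c : 'rV[R]_d -> R^o).

Definition smooth_near x f : Prop := exists2 U, open_nbhs x U & smooth_on U f.

Definition chart_vec (c : chart M 'rV[R]_d) x (u : 'rV[R]_d) : tvec R M :=
  fun f => if `[< smooth_near x f >]
           then 'D_u (f \o cfrom c : 'rV[R]_d -> R^o) (cto c x) else 0.

Definition tangent x v : Prop :=
  exists c u, [/\ atlas M c, cdom c x & v = chart_vec c x u].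

Definition vfield_on U X : Prop :=
  (forall x, U x -> tangent x (X x)) /\
  (forall V f, open V -> V `<=` U -> smooth_on V f ->
     smooth_on V (fun x => X x f)).

Definition vfield X : Prop := vfield_on setT X.

Definition one_form (theta : form1 R M) : Prop :=
  (forall x v w (k : R), tangent x v -> tangent x w ->
     theta x (k *: v + w) = k * theta x v + theta x w) /\
  (forall U X, open U -> vfield_on U X ->
     smooth_on U (fun x => theta x (X x))).

Definition lie X Y : vfld R M := fun x f =>
  if `[< smooth_near x f >]
  then X x (fun y => Y y f) - Y x (fun y => X y f) else 0.

Definition fscale f X : vfld R M := fun x => f x *: X x.

Definition fapp (J : endo R M) X : vfld R M := fun x => J x (X x).

Definition feval (theta : form1 R M) X : M -> R := fun x => theta x (X x).

Definition connection (D : conn R M) : Prop :=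
  [/\ forall X Y, vfield X -> vfield Y -> vfield (D X Y),
      forall X Y Z, vfield X -> vfield Y -> vfield Z ->
        D (X + Y) Z = D X Z + D Y Z,
      forall f X Y, smooth_on setT f -> vfield X -> vfield Y ->
        D (fscale f X) Y = fscale f (D X Y),
      forall X Y Z, vfield X -> vfield Y -> vfield Z ->
        D X (Y + Z) = D X Y + D X Z &
      forall f X Y, smooth_on setT f -> vfield X -> vfield Y ->
        D X (fscale f Y) = fscale (fun x => X x f) Y + fscale f (D X Y)].

Definition torsion_free (D : conn R M) : Prop :=
  forall X Y, vfield X -> vfield Y -> D X Y - D Y X = lie X Y.

Definition flat (D : conn R M) : Prop :=
  forall X Y Z, vfield X -> vfield Y -> vfield Z ->
    D X (D Y Z) - D Y (D X Z) - D (lie X Y) Z = 0.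

(* [nabla_endo D J X Y] is $(\nabla_X J) Y$. *)
Definition nabla_endo (D : conn R M) (J : endo R M) X Y : vfld R M :=
  D X (fapp J Y) - fapp J (D X Y).

Definition torsion_free_complex (J : endo R M) (D : conn R M) : Prop :=
  [/\ connection D, torsion_free D &
      forall X Y, vfield X -> vfield Y -> nabla_endo D J X Y = 0].

Definition cproj_related (J : endo R M) (D1 D2 : conn R M) : Prop :=
  exists2 theta : form1 R M, one_form theta &
    forall X Y, vfield X -> vfield Y ->
      D1 X Y = D2 X Y
               + fscale (feval theta X) Y + fscale (feval theta Y) X
               - fscale (feval theta (fapp J X)) (fapp J Y)
               - fscale (feval theta (fapp J Y)) (fapp J X).

Definition cproj_class (J : endo R M) (D : conn R M) : set (conn R M) :=
  [set D' | torsion_free_complex J D' /\ cproj_related J D' D].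

Definition cproj_structure (J : endo R M) (C : set (conn R M)) : Prop :=
  exists2 D, torsion_free_complex J D & C = cproj_class J D.

End Tangent.

Definition smooth_mfd_map {R : realType} {d e : nat}
    {M : manifold R d} {M' : manifold R e} (F : M -> M') : Prop :=
  smooth_map (atlas M) (atlas M') setT F.

Definition dmap {R : realType} {d e : nat}
    {M : manifold R d} {M' : manifold R e} (F : M -> M') (x : M)
    (v : tvec R M) : tvec R M' :=
  fun g => if `[< smooth_near (F x) g >] then v (g \o F) else 0.

(* Multiplication by $\sqrt{-1}$ on $\mathbb C^n$, whose points $x + iy$ are
   represented by [row_mx x y]. *)
Definition mul_i {R : realType} {n : nat} (u : 'rV[R]_(n + n)) :
    'rV[R]_(n + n) :=
  row_mx (- rsubmx u) (lsubmx u).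

(* The given atlas is a holomorphic atlas inducing [J]: in each of its charts,
   [J] is multiplication by $\sqrt{-1}$. In particular the differentials of the
   transition maps are complex linear. *)
Definition complex_manifold {R : realType} {n : nat} (M : manifold R (n + n))
    (J : endo R M) : Prop :=
  forall c x u, atlas M c -> cdom c x ->
    J x (chart_vec c x u) = chart_vec c x (mul_i u).

Section Special.
Context {R : realType} {n : nat} {N : manifold R (n + n)}.
Implicit Types (J : endo R N) (D : conn R N) (X Y xi : vfld R N).

Definition special_complex J D : Prop :=
  [/\ complex_manifold J, connection D, torsion_free D, flat D &
      forall X Y, vfield X -> vfield Y ->
        nabla_endo D J X Y = nabla_endo D J Y X].

Definition conical_special_complex J D xi : Prop :=
  [/\ special_complex J D, vfield xi,
      forall X, vfield X -> D X xi = X &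
      forall X, vfield X -> lie xi (fapp J X) - fapp J (lie xi X) = 0].

Definition nabla' J D : conn R N :=
  fun X Y => D X Y - (2^-1 : R) *: fapp J (nabla_endo D J X Y).

End Special.

Section PrincipalBundle.
Context {R : realType} {n m : nat}.
Context {N : manifold R (n + n)} {Nb : manifold R (m + m)}.
Implicit Types (J : endo R N) (xi : vfld R N) (Jb : endo R Nb).
Implicit Types (p : N -> Nb) (act : R[i] -> N -> N) (alpha : form1 R N).

Definition toC (z : (R^o * R^o)%type) : R[i] := Complex z.1 z.2.

Definition Cstar : set (R^o * R^o)%type := [set z | toC z != 0].

Definition cexp (z : R[i]) : R[i] :=
  let: Complex a b := z in Complex (expR a * cos b) (expR a * sin b).

(* [act z] is only relevant for [z != 0]. Freeness of the action, surjectivity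
   of [p] and the fact that the fibres of [p] are the orbits follow from the
   equivariant local trivializations [Phi], with inverse [Psi]. *)
Definition principal_Cstar_bundle p act : Prop :=
  [/\ smooth_mfd_map p,
      smooth_map (prod_atlas (id_atlas (R^o * R^o)%type) (atlas N)) (atlas N)
        (Cstar `*` setT) (fun zx => act (toC zx.1) zx.2),
      (forall x, act 1 x = x) /\
      (forall z w x, z != 0 -> w != 0 -> act (z * w) x = act z (act w x)),
      forall z x, z != 0 -> p (act z x) = p x &
      forall b, exists U (Phi : N -> Nb * (R^o * R^o)%type)
                       (Psi : Nb * (R^o * R^o)%type -> N),
        [/\ open_nbhs b U,
            smooth_map (atlas N)
              (prod_atlas (atlas Nb) (id_atlas (R^o * R^o)%type))
              (p @^-1` U) Phi,
            smooth_map (prod_atlas (atlas Nb) (id_atlas (R^o * R^o)%type))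
              (atlas N) (U `*` Cstar) Psi,
            forall x, U (p x) ->
              [/\ (Phi x).1 = p x, Cstar (Phi x).2, Psi (Phi x) = x &
                  forall z, z != 0 ->
                    toC (Phi (act z x)).2 = z * toC (Phi x).2] &
            forall y, U y.1 -> Cstar y.2 ->
              p (Psi y) = y.1 /\ Phi (Psi y) = y]].

Definition fundamental_vfield act (l : R[i]) : vfld R N := fun x f =>
  if `[< smooth_near x f >]
  then derive1 (fun t : R => f (act (cexp (Complex t 0 * l)) x) : R^o) 0
  else 0.

(* [Nb] is the quotient of [N] by the foliation spanned by [xi] and [J xi],
   whose leaves are the orbits of the principal action. *)
Definition projective_special_complex J xi Jb p act : Prop :=
  [/\ complex_manifold Jb,
      forall x v, tangent x v -> dmap p x (J x v) = Jb (p x) (dmap p x v),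
      principal_Cstar_bundle p act,
      fundamental_vfield act 1 = xi &
      fundamental_vfield act (Complex 0 1) = fapp J xi].

(* $\alpha - \sqrt{-1}\,\alpha\circ J$ *)
Definition hat J alpha (x : N) (v : tvec R N) : R[i] :=
  Complex (alpha x v) (- alpha x (J x v)).

(* As $\mathbb C^*$ is abelian, equivariance of a connection form is
   invariance. *)
Definition principal_connection_form10 J act alpha : Prop :=
  [/\ one_form alpha,
      forall l x, hat J alpha x (fundamental_vfield act l x) = l &
      forall z x v, z != 0 -> tangent x v ->
        hat J alpha (act z x) (dmap (act z) x v) = hat J alpha x v].

Definition hlift J p alpha (X : vfld R Nb) : vfld R N := fun x =>
  xget (0 : tvec R N)
    [set v | [/\ tangent x v, hat J alpha x v = 0 &
                 dmap p x v = X (p x)]].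

(* $p_* Z = W$ *)
Definition projects_to p (Z : vfld R N) (W : vfld R Nb) : Prop :=
  forall x, dmap p x (Z x) = W (p x).

End PrincipalBundle.

(* Main.v *)
(* The tensor $\nabla J$ vanishes when contracted with $\xi$ or $\eta = J\xi$,
   because $L_\xi J = 0$ and $\nabla\xi = \mathrm{id}$. Since
   $\nabla'_XY = \frac12(\nabla_XY - J\nabla_XJY)$, flatness of $\nabla$ then shows
   that $\nabla'_XY$ commutes with $\xi$ and $\eta$ as soon as $X$ and $Y$ do.
   Horizontal lifts are invariant under the action, hence commute with $\xi$ and
   $\eta$ (symmetry of second derivatives), so $\nabla'_{X^h}Y^h$ projects.
   Two horizontal lifts differ by $-\theta(X)\xi + \theta(\bar JX)\eta$ for a
   one-form $\theta$ on the base; as $\nabla'_\xi X^h = \nabla'_{X^h}\xi = X^h$ and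
   $\nabla'_\eta X^h = \nabla'_{X^h}\eta = JX^h$, the two projected connections are
   c-projectively related by $-\theta$.
   Uniqueness of the class requires that a connection form of type $(1,0)$ exists:
   in a local trivialization with fibre coordinate $w$ take $d\log|w|$, and glue
   with cut-off functions from the base. *)

Require Import Defs.
From HB Require Import structures.
From mathcomp Require Import all_boot all_order all_algebra.
From mathcomp Require Import all_classical all_reals all_analysis.
From mathcomp Require Import complex ring.

Set Implicit Arguments.
Unset Strict Implicit.
Unset Printing Implicit Defensive.

Import Order.TTheory GRing.Theory Num.Theory.
Import numFieldNormedType.Exports.

Local Open Scope classical_set_scope.
Local Open Scope ring_scope.

(** * Calculus in normed spaces *)

(** Three obstacles shape the proof. Along the fibres the hypotheses are infinitesimal: brackets
    with $\xi$ and $J\xi$ vanish, while projecting to the base requires invariance under the whole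
    action. The passage is always the same: a smooth function on a saturated open set that both
    fundamental fields kill is constant on orbits, since every nonzero complex number is
    $e^{ib}e^{a}$. This serves for $\nabla'_{X^h}Y^h$ and also for the invariance of $\gamma\circ
    J$, which a connection form of type $(1,0)$ demands and which is not among the axioms of the
    bundle. Next, a global smooth section need not exist. Objects on the base are therefore defined
    by evaluation along an arbitrary set-theoretic section, and their smoothness is checked by
    replacing it with local sections, which invariance allows. The kernel of $p_*$ is likewise
    computed in a trivialization. Finally, connections are raw functions, and the projection formula
    determines them on smooth fields only. Two admissible choices of the projected connection can
    differ elsewhere; what is unique is the class. *)

Section NearEq.
Context {R : realType} {E F : normedModType R}.
Implicit Types f g : E -> F.

Lemma near_eq_differentiable f g x :
  {near x, f =1 g} -> differentiable f x -> differentiable g x.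
Proof.
move=> fg df; have fgx := nbhs_singleton fg.
have nfg : \forall h \near (0 : E), f (h + x) = g (h + x).
  rewrite [\forall h \near _, _ = _](near_shift x) sub0r.
  by near=> y; rewrite /= subrK; near: y.
have eqg : g \o shift x = cst (g x) + 'd f x +o_ 0 id.
  apply/eqaddoP => _/posnumP[e]; near=> h.
  have -> : (g \o shift x - (cst (g x) + 'd f x)) h =
      (f \o shift x - (cst (f x) + 'd f x)) h.
    rewrite /= !fctE /= -fgx; congr (_ - _).
    by apply/esym; near: h.
  near: h; move: e; have /diff_locally/eqaddoP fo := df => e; exact: fo.
have dE : 'd g x = 'd f x :> (E -> F).
  by apply: diff_unique eqg; exact: diff_continuous.
by apply/diff_locallyP; split; rewrite dE//; exact: diff_continuous.
Unshelve. all: by end_near. Qed.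

Lemma open_near_eq (U : set E) f g x : open U -> U x ->
  (forall y, U y -> f y = g y) -> {near x, f =1 g}.
Proof.
by move=> oU Ux fg; near=> y; apply: fg; near: y; exact: open_nbhs_nbhs.
Unshelve. all: by end_near. Qed.

End NearEq.

Section CkTheory.
Context {R : realType}.
Implicit Types E F G : normedModType R.

Lemma eq_in_derive E F (U : set E) (f g : E -> F) v x : open U -> U x ->
  (forall y, U y -> f y = g y) -> 'D_v f x = 'D_v g x.
Proof. by move=> oU Ux fg; apply/near_eq_derive/(open_near_eq oU). Qed.

Lemma Ck_eq k E F (U : set E) (f g : E -> F) : open U ->
  (forall x, U x -> f x = g x) -> Ck k U f -> Ck k U g.
Proof.
move=> oU; elim: k f g => [|k IH] f g fg /=.
  move=> cf x Ux; apply: cvg_trans; last first.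
    by rewrite -(fg _ Ux); exact: cf.
  by apply: near_eq_cvg; apply: open_near_eq oU Ux _ => y /fg ->.
case=> df Df; split=> [x Ux|v].
  exact: near_eq_differentiable (open_near_eq oU Ux fg) (df x Ux).
by apply: IH (Df v) => x Ux; exact: eq_in_derive oU Ux fg.
Qed.

Lemma Ck_sub k E F (U V : set E) (f : E -> F) :
  V `<=` U -> Ck k U f -> Ck k V f.
Proof.
move=> VU; elim: k f => [|k IH] f /=; first by move=> cf x /VU; exact: cf.
by case=> df Df; split=> [x /VU|v]; [exact: df|exact: IH].
Qed.

Lemma Ck_local k E F (U : set E) (f : E -> F) :
  (forall x, U x -> exists2 V, V x & Ck k V f) -> Ck k U f.
Proof.
elim: k f => [|k IH] f H; first by move=> x /H[V Vx]; apply.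
split=> [x /H[V Vx [df _]]|v]; first exact: df.
by apply: IH => x /H[V Vx [_ Df]]; exists V => //; exact: Df.
Qed.

Lemma CkS k E F (U : set E) (f : E -> F) : Ck k.+1 U f -> Ck k U f.
Proof.
elim: k f => [|k IH] f [df Df].
  by move=> x /df; exact: differentiable_continuous.
by split=> // v; exact: IH (Df v).
Qed.

Lemma Ck_cst k E F (U : set E) (a : F) : Ck k U (fun=> a).
Proof.
elim: k a => [|k IH] a; first by move=> x _; exact: cvg_cst.
split=> [x _|v]; first exact: differentiable_cst.
have -> : 'D_v (fun=> a) = (fun=> 0) :> (E -> F).
  by apply/funext => x; exact: derive_cst.
exact: IH.
Qed.

Lemma Ck_lin k E F G (U : set E) (L : {linear F -> G}) (f : E -> F) :
  open U -> continuous L -> Ck k U f -> Ck k U (fun x => L (f x)).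
Proof.
move=> oU cL; elim: k f => [|k IH] f.
  by move=> cf x Ux; apply: continuous_comp; [exact: cf|exact: cL].
case=> df Df; have dL x : differentiable L x by exact: linear_differentiable.
split=> [x Ux|v]; first exact: differentiable_comp (df x Ux) (dL _).
apply: Ck_eq (IH _ (Df v)) => // x Ux.
rewrite !deriveE//; try exact: df; last exact: differentiable_comp (df x Ux) _.
by rewrite (diff_comp (df x Ux) (dL _))/= diff_lin.
Qed.

Lemma Ck_linear k E F (U : set E) (L : {linear E -> F}) :
  continuous L -> Ck k U L.
Proof.
move=> cL; case: k => [|k]; first by move=> x _; exact: cL.
have dL x : differentiable L x by exact: linear_differentiable.
split=> // v; rewrite (_ : 'D_v L = fun=> L v); first exact: Ck_cst.
by apply/funext => x; rewrite deriveE// diff_lin.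
Qed.

Lemma Ck_add k E F (U : set E) (f g : E -> F) :
  open U -> Ck k U f -> Ck k U g -> Ck k U (fun x => f x + g x).
Proof.
move=> oU; elim: k f g => [|k IH] f g.
  by move=> cf cg x Ux; apply: cvgD; [exact: cf|exact: cg].
case=> df Df [dg Dg]; split=> [x Ux|v].
  by apply: differentiableD; [exact: df|exact: dg].
apply: Ck_eq (IH _ _ (Df v) (Dg v)) => // x Ux.
by rewrite deriveD//; apply: diff_derivable; [exact: df|exact: dg].
Qed.

Lemma Ck_sum k E F (U : set E) (I : Type) (r : seq I) (P : pred I)
    (f : I -> E -> F) : open U -> (forall i, P i -> Ck k U (f i)) ->
  Ck k U (fun x => \sum_(i <- r | P i) f i x).
Proof.
move=> oU cf; elim: r => [|i r IH].
  rewrite (_ : (fun _ => _) = fun=> 0); first exact: Ck_cst.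
  by apply/funext => x; rewrite big_nil.
rewrite (_ : (fun _ => _) = fun x => (if P i then f i x else 0) +
    \sum_(j <- r | P j) f j x); last first.
  by apply/funext => x; rewrite big_cons; case: ifP; rewrite ?add0r.
apply: Ck_add => //; case: (boolP (P i)) => [/cf //|_]; exact: Ck_cst.
Qed.

End CkTheory.

Section FinDim.
Context {R : realType}.
Implicit Types E F G : normedModType R.

(** A finite frame with continuous coordinate functionals. It makes every linear map out of [F]
    continuous and turns the chain rule into a finite sum of products, which is what induction on
    the order of differentiability needs. *)
Definition fin_dim F := exists n (e : 'I_n -> F) (l : 'I_n -> {linear F -> R^o}),
  (forall i, continuous (l i)) /\ forall x, x = \sum_i l i x *: e i.

Lemma linear_fin_dim_continuous F G (L : F -> G) :
  fin_dim F -> linear L -> continuous L.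
Proof.
move=> [n [e [l [cl eF]]]] lL.
pose LM := GRing.isLinear.Build _ _ _ _ _ lL.
pose LL : {linear F -> G} := HB.pack L LM.
have -> : L = fun x => \sum_i l i x *: L (e i).
  apply/funext => x; rewrite {1}(eF x) -[L]/(LL : _ -> _) linear_sum.
  by apply: eq_bigr => i _; rewrite linearZ.
apply: continuous_big => [|i _ x]; first exact: add_continuous.
by apply: cvgZr_tmp; exact: cl.
Qed.

Lemma Ck_lin_comp k E F G (U : set E) (L : F -> G) (f : E -> F) :
  fin_dim F -> linear L -> open U -> Ck k U f -> Ck k U (fun x => L (f x)).
Proof.
move=> fF lL oU cf; have cL := linear_fin_dim_continuous fF lL.
pose LM := GRing.isLinear.Build _ _ _ _ _ lL.
pose LL : {linear F -> G} := HB.pack L LM.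
exact: (@Ck_lin _ _ _ _ _ _ LL).
Qed.

Lemma Ck_lin_map k E F (U : set E) (L : E -> F) :
  fin_dim E -> linear L -> Ck k U L.
Proof.
move=> fE lL; have cL := linear_fin_dim_continuous fE lL.
pose LM := GRing.isLinear.Build _ _ _ _ _ lL.
pose LL : {linear E -> F} := HB.pack L LM.
exact: (@Ck_linear _ _ _ _ _ LL).
Qed.

Lemma fin_dim_R : fin_dim R^o.
Proof.
exists 1%N, (fun=> 1), (fun=> idfun : {linear R^o -> R^o}); split.
  by move=> i x; exact: cvg_id.
by move=> x; rewrite big_ord1 /= [x *: _]mulr1.
Qed.

Lemma fin_dim_rV d : fin_dim 'rV[R]_d.
Proof.
have lL (i : 'I_d) : linear (fun u : 'rV[R]_d => u 0 i : R^o).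
  by move=> a u v; rewrite !mxE.
pose l i : {linear 'rV[R]_d -> R^o} :=
  HB.pack (fun u : 'rV[R]_d => u 0 i : R^o)
    (GRing.isLinear.Build _ _ _ _ _ (lL i)).
exists d, (fun i => delta_mx 0 i), l.
split; last by move=> u; exact: row_sum_delta.
move=> i x; exact: (@coord_continuous R 1 d 0 i).
Qed.

Lemma fin_dim_prod F G : fin_dim F -> fin_dim G -> fin_dim (F * G)%type.
Proof.
move=> [n [e [l [cl eF]]]] [m [e' [l' [cl' eG]]]].
pose ee (i : 'I_(n + m)) : (F * G)%type :=
  match fintype.split i with inl i => (e i, 0) | inr j => (0, e' j) end.
pose ll (i : 'I_(n + m)) (x : (F * G)%type) : R^o :=
  match fintype.split i with inl i => l i x.1 | inr j => l' j x.2 end.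
have lL i : linear (ll i).
  by move=> a x y; rewrite /ll; case: (fintype.split i) => j; rewrite linearP.
pose l2 i : {linear (F * G)%type -> R^o} :=
  HB.pack (ll i) (GRing.isLinear.Build _ _ _ _ _ (lL i)).
exists (n + m)%N, ee, l2.
split.
  move=> i x /=; rewrite /ll; case: (fintype.split i) => j.
    by apply: (@continuous_comp _ _ _ fst (l j)); [exact: cvg_fst|exact: cl].
  by apply: (@continuous_comp _ _ _ snd (l' j)); [exact: cvg_snd|exact: cl'].
have inl_sum (I : finType) (h : I -> F) :
    \sum_i ((h i, 0) : (F * G)%type) = (\sum_i h i, 0).
  by apply: (big_ind2 (fun x y => x = (y, 0))) => // x1 x2 y1 y2 -> ->;
    congr (_, _); rewrite addr0.
have inr_sum (I : finType) (h : I -> G) :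
    \sum_i ((0, h i) : (F * G)%type) = (0, \sum_i h i).
  by apply: (big_ind2 (fun x y => x = (0, y))) => // x1 x2 y1 y2 -> ->;
    congr (_, _); rewrite addr0.
move=> [x y] /=; rewrite big_split_ord /=.
rewrite (eq_bigr (fun i => (l i x *: e i, 0))); last first.
  move=> i _; rewrite /ll /ee /= (unsplitK (inl i)) /=.
  by congr (_, _); rewrite scaler0.
rewrite [X in _ + X](eq_bigr (fun i => (0, l' i y *: e' i))); last first.
  move=> i _; rewrite /ll /ee /= (unsplitK (inr i)) /=.
  by congr (_, _); rewrite scaler0.
rewrite inl_sum inr_sum; congr (_, _); first by rewrite addr0 -eF.
by rewrite add0r -eG.
Qed.

Lemma Ck_coords k E F (U : set E) (f : E -> F) : open U -> fin_dim F ->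
  (forall l : {linear F -> R^o}, continuous l -> Ck k U (fun x => l (f x))) ->
  Ck k U f.
Proof.
move=> oU [n [e [l [cl eF]]]] cf.
rewrite (_ : f = fun x => \sum_i l i (f x) *: e i); last first.
  by apply/funext => x; exact: eF.
apply: Ck_sum => // i _.
apply: (@Ck_lin_comp _ _ R^o _ _ (fun t => t *: e i)) => //.
- exact: fin_dim_R.
- by move=> a x y; rewrite scalerDl scalerA.
- exact/cf/cl.
Qed.

Lemma Ck_mul k E (U : set E) (f g : E -> R^o) : open U ->
  Ck k U f -> Ck k U g -> Ck k U (fun x => f x * g x : R^o).
Proof.
move=> oU; elim: k f g => [|k IH] f g cf cg.
  by move=> x Ux; apply: cvgM; [exact: cf|exact: cg].
have [[df Df] [dg Dg]] := (cf, cg); split=> [x Ux|v].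
  by apply: differentiableM; [exact: df|exact: dg].
have /(Ck_eq oU) : forall x, U x ->
    f x * 'D_v g x + g x * 'D_v f x = 'D_v (fun x => f x * g x : R^o) x.
  move=> x Ux; rewrite [RHS]deriveM//; apply: diff_derivable.
    exact: df.
  exact: dg.
apply; have [cf' cg'] := (CkS cf, CkS cg).
by apply: Ck_add => //; apply: IH => //; [exact: Dg|exact: Df].
Qed.

(** The derivative of $g\circ f$ along $v$ is expanded in the frame of [F] as a sum of products of
    [l i ('D_v f x)] and ['D_(e i) g (f x)]. The second factor is again a real function composed
    with [f], so the induction closes; vector-valued targets are recovered coordinatewise in
    [Ck_comp]. *)
Lemma Ck_comp_real k E F (U : set E) (V : set F) (f : E -> F) (g : F -> R^o) :
  fin_dim F -> open U -> open V -> (forall x, U x -> V (f x)) ->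
  Ck k U f -> Ck k V g -> Ck k U (g \o f).
Proof.
move=> [n [e [l [cl eF]]]] oU oV UV; elim: k f g UV => [|k IH] f g UV cf cg.
  move=> x Ux; apply: continuous_comp; first exact: cf.
  exact/cg/UV.
have [[df Df] [dg Dg]] := (cf, cg); split=> [x Ux|v].
  by apply: differentiable_comp; [exact: df|exact/dg/UV].
have /(Ck_eq oU) : forall x, U x ->
    \sum_i (l i ('D_v f x) * 'D_(e i) g (f x) : R^o) = 'D_v (g \o f) x.
  move=> x Ux; have dfx := df _ Ux; have dgx := dg _ (UV _ Ux).
  rewrite !deriveE//; last exact: differentiable_comp.
  rewrite (diff_comp dfx dgx) /=; set w := ('d f x v : F).
  rewrite [in RHS](eF w) linear_sum.
  by apply: eq_bigr => i _; rewrite linearZ [in LHS]deriveE.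
apply; apply: Ck_sum => // i _; apply: Ck_mul => //.
  by apply: Ck_lin => //; exact: Df.
by apply: (IH f ('D_(e i) g)) => //; [exact: CkS|exact: Dg].
Qed.

Lemma Ck_comp k E F G (U : set E) (V : set F) (f : E -> F) (g : F -> G) :
  fin_dim F -> fin_dim G -> open U -> open V -> (forall x, U x -> V (f x)) ->
  Ck k U f -> Ck k V g -> Ck k U (g \o f).
Proof.
move=> fF fG oU oV UV cf cg; apply: Ck_coords => // l cl.
apply: (@Ck_comp_real _ _ _ _ V f (fun y => l (g y))) => //.
exact: Ck_lin.
Qed.

Lemma Ck_pair k E F G (U : set E) (f : E -> F) (g : E -> G) : open U ->
  fin_dim F -> fin_dim G -> Ck k U f -> Ck k U g ->
  Ck k U (fun x => (f x, g x)).
Proof.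
move=> oU fF fG cf cg.
have /(Ck_eq oU) : forall x, U x -> (f x, 0) + (0, g x) = (f x, g x).
  by move=> x _; congr (_, _); rewrite ?addr0 ?add0r.
apply; apply: Ck_add => //.
  apply: (@Ck_lin_comp _ _ _ (F * G)%type _ (fun y => (y, 0))) => //.
  by move=> a x y; congr (_, _); rewrite /= scaler0 addr0.
apply: (@Ck_lin_comp _ _ _ (F * G)%type _ (fun y => (0, y))) => //.
by move=> a x y; congr (_, _); rewrite /= scaler0 addr0.
Qed.

(** On the line every directional derivative of $h$ is a multiple of $h'$, so an explicit formula
    for $h'$ gains one order. The inverse, the logarithm and [flat_fun] are handled this way. *)
Lemma Ck_real k (U : set R^o) (h h' : R^o -> R^o) : open U ->
  (forall x, U x -> is_derive x 1 h (h' x)) -> Ck k U h' -> Ck k.+1 U h.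
Proof.
move=> oU dh ch'.
have df x : U x -> differentiable h x.
  by move=> /dh[+ _] => /derivable1_diffP.
split=> // v; have /(Ck_eq oU) : forall x, U x -> v * h' x = 'D_v h x.
  move=> x Ux; rewrite deriveE; last exact: df.
  have {2}-> : v = v *: (1 : R^o) by rewrite [RHS]mulr1.
  by rewrite linearZ -deriveE; [rewrite (@derive_val _ _ _ _ _ _ _ (dh _ Ux))|exact: df].
by apply; apply: Ck_mul => //; exact: Ck_cst.
Qed.

End FinDim.

(** * Symmetry of second derivatives *)

Section Schwarz.
Context {R : realType} {E : normedModType R}.

Lemma is_derive_line (F : E -> R^o) (y a : E) (t : R) :
  differentiable F (y + t *: a) ->
  is_derive t (1 : R) (fun t : R => F (y + t *: a) : R) ('D_a F (y + t *: a)).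
Proof.
move=> dF; have := @diff_derivable _ _ _ F _ a dF.
have eq_quot : (fun h : R => h^-1 *: ((F \o shift (y + t *: a)) (h *: a) -
    F (y + t *: a))) = (fun h : R => h^-1 *: (((fun t : R => F (y + t *: a)) \o
    shift t) (h *: 1) - F (y + t *: a)) : R).
  apply/funext => h /=; congr (_ *: (F _ - _)).
  by rewrite -[h *: 1]/(h * 1) mulr1 scalerDl addrCA.
rewrite /derivable /derive eq_quot => cv; exact: DeriveDef.
Qed.

(** The mean value theorem is applied twice: to $\varphi(t)=F(x+sb+ta)-F(x+ta)$, which yields [t],
    and then, with this [t] fixed, to $\psi(r)=D_aF(x+ta+rb)$. *)
Lemma second_difference (F : E -> R^o) (x a b : E) (s : R) : 0 < s ->
  (forall t r : R, 0 <= t <= s -> 0 <= r <= s ->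
     differentiable F (x + t *: a + r *: b) /\
     differentiable ('D_a F) (x + t *: a + r *: b)) ->
  exists t r : R, [/\ 0 <= t <= s, 0 <= r <= s &
    F (x + s *: a + s *: b) - F (x + s *: a) - F (x + s *: b) + F x =
    'D_b ('D_a F) (x + t *: a + r *: b) * s * s].
Proof.
move=> s0 dF.
have I0 : 0 <= (0 : R) <= s by rewrite lexx ltW.
have Is : 0 <= s <= s by rewrite lexx ltW.
pose phi (t : R) : R := F (x + s *: b + t *: a) - F (x + t *: a).
have dphi t : 0 <= t <= s -> is_derive t (1 : R) phi
    ('D_a F (x + t *: a + s *: b) - 'D_a F (x + t *: a)).
  move=> It; have [h1 _] := dF _ _ It Is; have [h2 _] := dF _ _ It I0.
  apply: is_deriveB; last by apply: is_derive_line; rewrite scale0r addr0 in h2.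
  by rewrite addrAC in h1 *; exact: is_derive_line.
have cphi : {within `[0, s], continuous phi}.
  apply: derivable_within_continuous => t; rewrite in_itv /= => /dphi [dt _].
  exact: dt.
have dphi' t : t \in `]0, s[%R -> is_derive t (1 : R) phi
    ('D_a F (x + t *: a + s *: b) - 'D_a F (x + t *: a)).
  by rewrite in_itv /= => /andP[t0 ts]; apply: dphi; rewrite !ltW.
have [t ts et] := MVT s0 dphi' cphi.
have {}ts : 0 <= t <= s by move: ts; rewrite in_itv /= => /andP[? ?]; rewrite !ltW.
pose psi (r : R) : R := 'D_a F (x + t *: a + r *: b).
have dpsi r : 0 <= r <= s -> is_derive r (1 : R) psi
    ('D_b ('D_a F) (x + t *: a + r *: b)).
  by move=> Ir; apply: is_derive_line; have [] := dF _ _ ts Ir.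
have cpsi : {within `[0, s], continuous psi}.
  apply: derivable_within_continuous => r; rewrite in_itv /= => /dpsi [dr _].
  exact: dr.
have dpsi' r : r \in `]0, s[%R -> is_derive r (1 : R) psi
    ('D_b ('D_a F) (x + t *: a + r *: b)).
  by rewrite in_itv /= => /andP[r0 rs]; apply: dpsi; rewrite !ltW.
have [r rs er] := MVT s0 dpsi' cpsi.
have {}rs : 0 <= r <= s by move: rs; rewrite in_itv /= => /andP[? ?]; rewrite !ltW.
exists t, r; split => //.
move: er; rewrite /psi subr0 scale0r addr0 => <-.
move: et; rewrite /phi !subr0 scale0r !addr0 => <-.
by rewrite [x + s *: b + _]addrAC; ring.
Qed.

Lemma dist_halves (A B C C' e : R) : `|A - C| < e / 2 -> `|B - C'| < e / 2 ->
  C' = C -> `|A - B| <= e.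
Proof.
move=> hA hB ec; apply: le_trans (ler_distD C _ _) _.
by rewrite (splitr e) lerD//; [exact: ltW|rewrite -ec distrC ltW].
Qed.

(** The second difference is symmetric in $a$ and $b$, so the two mixed derivatives agree at two
    possibly different points of a small parallelogram at [x]; continuity of both at [x] lets the
    parallelogram shrink. *)
Lemma schwarz (U : set E) (F : E -> R^o) (a b x : E) : open U -> U x ->
  Ck 2 U F -> 'D_a ('D_b F) x = 'D_b ('D_a F) x.
Proof.
move=> oU Ux [dF DF].
have [[dDa DDa] [dDb DDb]] := (DF a, DF b).
apply/eqP; rewrite -subr_eq0 -normr_eq0 eq_le normr_ge0 andbT.
apply/ler_addgt0Pr => _/posnumP[e]; rewrite add0r.
have e2 : 0 < e%:num / 2 by [].
pose P y := U y /\ (`|'D_a ('D_b F) x - 'D_a ('D_b F) y| < e%:num / 2 /\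
  `|'D_b ('D_a F) x - 'D_b ('D_a F) y| < e%:num / 2).
have nP : nbhs x P.
  apply: filterI; first exact: open_nbhs_nbhs.
  apply: filterI.
    by have /cvgrPdist_lt/(_ _ e2) := DDb a x Ux.
  by have /cvgrPdist_lt/(_ _ e2) := DDa b x Ux.
have /nbhs_normP[d /= d0 Bd] := nP.
(* With side parameter $s=d/c$ the parallelogram stays in the ball of radius $d$, because
   $s(|a|+|b|)<d$. The summand 1 keeps [c] positive when $a=b=0$. *)
pose c := `|a| + `|b| + 1.
have c0 : 0 < c by rewrite ltr_wpDl// addr_ge0.
pose s := d / c.
have s0 : 0 < s by rewrite divr_gt0.
have Pl t r : 0 <= t <= s -> 0 <= r <= s -> P (x + t *: a + r *: b).
  move=> /andP[t0 ts] /andP[r0 rs]; apply: Bd => /=.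
  rewrite -addrA opprD addrA subrr sub0r normrN.
  rewrite (le_lt_trans (ler_normD _ _))// !normrZ !ger0_norm//.
  rewrite (@le_lt_trans _ _ (s * (`|a| + `|b|)))//.
    by rewrite mulrDr lerD// ler_wpM2r.
  by rewrite /s mulrAC ltr_pdivrMr// ltr_pM2l// ltrDl.
have [t [r [tI rI e1]]] : exists t r : R, [/\ 0 <= t <= s, 0 <= r <= s &
    F (x + s *: a + s *: b) - F (x + s *: a) - F (x + s *: b) + F x =
    'D_b ('D_a F) (x + t *: a + r *: b) * s * s].
  apply: second_difference => // t r tI rI; have [Ul _] := Pl _ _ tI rI.
  by split; [exact: dF|exact: dDa].
have [t' [r' [tI' rI' e2']]] : exists t r : R, [/\ 0 <= t <= s, 0 <= r <= s &
    F (x + s *: b + s *: a) - F (x + s *: b) - F (x + s *: a) + F x =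
    'D_a ('D_b F) (x + t *: b + r *: a) * s * s].
  apply: second_difference => // t' r' tI' rI'; have [] := Pl _ _ rI' tI'.
  by rewrite addrAC => Ul _; split; [exact: dF|exact: dDb].
have [_ [_ h1]] := Pl _ _ tI rI; have [_ []] := Pl _ _ rI' tI'.
rewrite [x + r' *: a + _]addrAC => h2 _.
have eqD : 'D_b ('D_a F) (x + t *: a + r *: b) =
    'D_a ('D_b F) (x + t' *: b + r' *: a).
  apply: (mulIf (lt0r_neq0 s0)); apply: (mulIf (lt0r_neq0 s0)).
  refine (etrans (esym e1) (etrans _ e2')).
  by rewrite [x + s *: b + s *: a]addrAC -!addrA; congr (_ + _); rewrite addrCA.
exact: dist_halves h2 h1 eqD.
Qed.

End Schwarz.

(** * Special functions and smooth cut-off functions *)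

Section SpecialFunctions.
Context {R : realType}.

Lemma Ck_inv k : Ck k [set t : R^o | t != 0] (fun t => t^-1 : R^o).
Proof.
have oU : open [set t : R^o | t != 0].
  exact: (@open_neq R 0).
elim: k => [|k IH]; first by move=> t t0; exact: inv_continuous.
apply: (@Ck_real _ _ _ _ (fun t => - (t^-1 * t^-1))) => //.
  move=> t t0; apply: is_derive_eq; first exact: is_deriveV.
  by rewrite /= -exprVn -[_ *: _]/(_ * _) mulr1 expr2.
apply: (@Ck_lin_comp _ _ _ R^o _ _ (fun t => - t)) => //.
- exact: fin_dim_R.
- by move=> a x y; rewrite opprD scalerN.
- exact: Ck_mul.
Qed.

Lemma Ck_ln k : Ck k [set t : R^o | 0 < t] (@ln R : R^o -> R^o).
Proof.
apply: CkS; apply: (@Ck_real _ _ _ _ (fun t => t^-1)) => //.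

by apply: Ck_sub (Ck_inv k) => t /=; exact: lt0r_neq0.
Qed.

(* The derivatives of $t \mapsto e^{-1/t}$ stay in this family. *)
Definition flat_fun (p : {poly R}) (t : R^o) : R^o :=
  if 0 < t then p.[t^-1] * expR (- t^-1) else 0.

Lemma flat_fun_le0 p (t : R) : t <= 0 -> flat_fun p t = 0.
Proof. by move=> t0; rewrite /flat_fun ltNge t0. Qed.

Lemma expR_dominates n (s : R) : 0 < s -> s ^+ n.+1 * expR (- s) <= n.+1`!%:R.
Proof.
move=> s0; rewrite expRN ler_pdivrMr ?expR_gt0//.
have f0 : 0 < n.+1`!%:R :> R by rewrite ltr0n fact_gt0.
rewrite -ler_pdivrMl// mulrC; apply: le_trans (expR_ge1Dxn n (ltW s0)).
by rewrite lerDr.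
Qed.

(** A quadratic bound forces the difference quotients at 0 to tend to 0. With $s=t^{-1}$ the $i$-th
    coefficient meets $s^{i+2}e^{-s}\le (i+2)!$; the two extra powers of $s$ pay for $t^2$. *)
Lemma flat_fun_bound p :
  exists2 C : R, 0 <= C & forall t, `|flat_fun p t| <= C * t ^+ 2.
Proof.
exists (\sum_(i < size p) `|p`_i| * i.+2`!%:R).
  by apply: sumr_ge0 => i _; rewrite mulr_ge0.
move=> t; rewrite /flat_fun; case: ifPn => t0; last first.
  rewrite normr0 mulr_ge0 ?sqr_ge0//.
  by apply: sumr_ge0 => i _; rewrite mulr_ge0.
rewrite horner_coef mulr_suml (le_trans (ler_norm_sum _ _ _))// mulr_suml.
apply: ler_sum => i _; rewrite !normrM -!mulrA ler_wpM2l//.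
have V0 : 0 < t^-1 by rewrite invr_gt0.
rewrite ger0_norm ?exprn_ge0 ?(ltW V0)// ger0_norm ?expR_ge0//.
rewrite -ler_pdivrMr ?exprn_gt0// mulrAC.
rewrite (_ : _ / _ * _ = t^-1 ^+ i.+2 * expR (- t^-1)); first exact: expR_dominates.
by rewrite -exprVn -exprD addn2.
Qed.

(** For $t>0$ both the factor $p(1/t)$ and the exponential contribute $t^{-2}$, with opposite signs:
    the derivative is $t^{-2}(p-p')(1/t)e^{-1/t}$. At 0 the quadratic bound decides. *)
Lemma is_derive_flat_fun p (t : R) :
  is_derive t 1 (flat_fun p) (flat_fun ('X^2 * (p - p^`())) t).
Proof.
have [t0|t0|->] := ltgtP t 0.
- rewrite [X in is_derive _ _ _ X]flat_fun_le0 ?ltW//.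
  apply: near_eq_is_derive (is_derive_cst (0 : R^o) t 1).
  near=> s; rewrite flat_fun_le0// ltW//; near: s; exact: lt_nbhsl.
- apply: (@near_eq_is_derive _ _ _ (fun t : R => p.[t^-1] * expR (- t^-1) : R)).
    by near=> s; rewrite /flat_fun ifT//; near: s; exact: lt_nbhsr.
  rewrite /flat_fun t0.
  have dV : is_derive t (1 : R) (fun t : R => t^-1 : R) (- (t^-1 * t^-1)).
    apply: is_derive_eq; first by apply: is_deriveV; exact: lt0r_neq0.
    by rewrite /= -exprVn -[_ *: _]/(_ * _) mulr1 expr2.
  have d1 : is_derive t (1 : R) (horner p \o (fun t : R => t^-1 : R))
      ((p^`()).[t^-1] * - (t^-1 * t^-1)).
    exact: (is_derive1_comp (is_derive_poly p _) dV).
  have d2 : is_derive t (1 : R) (expR \o (fun t : R => - t^-1 : R))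
      (expR (- t^-1) * - - (t^-1 * t^-1)).
    exact: (is_derive1_comp (is_derive_expR _) (is_deriveN dV)).
  refine (is_derive_eq (is_deriveM d1 d2) _).
  rewrite hornerM hornerXn hornerD hornerN /=.
  by rewrite -![_ *: _]/(_ * _) expr2 /=; ring.
- rewrite [X in is_derive _ _ _ X]flat_fun_le0//.
  have [C C0 bC] := flat_fun_bound p.
  have f0 : flat_fun p 0 = 0 by exact: flat_fun_le0.
  suff cv : h^-1 *: ((flat_fun p \o shift 0) (h *: 1) - flat_fun p 0) @[h --> (0 : R)^'] --> (0 : R).
    by apply: DeriveDef; [exact: cvgP cv|exact: cvg_lim cv].
  apply: norm_cvg0.
  apply: (@squeeze_cvgr _ _ _ _ (fun=> 0) (fun h => C * `|h|)).
  + near=> h; rewrite normr_ge0 /= f0 subr0 addr0 -[h *: 1]/(h * 1) mulr1.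
    have h0 : h != 0 by near: h; exact: nbhs_dnbhs_neq.
    rewrite normrZ normfV ler_pdivrMl ?normr_gt0//.
    apply: le_trans (bC h) _.
    by rewrite [leRHS]mulrCA -expr2 real_normK// num_real.
  + exact: cvg_cst.
  + rewrite -[X in _ --> X](mulr0 C) -{2}(normr0 R).
    apply: cvgMl_tmp; apply: cvg_norm; exact: cvg_within.
Unshelve. all: by end_near. Qed.

Lemma Ck_flat_fun k p : Ck k setT (flat_fun p).
Proof.
elim: k p => [|k IH] p.
  by move=> t _; have [/derivable1_diffP/differentiable_continuous] :=
    is_derive_flat_fun p t.
apply: Ck_real (IH _) => // [|t _]; first exact: openT.
exact: is_derive_flat_fun.
Qed.

End SpecialFunctions.

Section Bump.
Context {R : realType}.

(** The usual quotient $g(2-s)/(g(2-s)+g(s-1))$ with $g(t)=e^{-1/t}$ for $t>0$ and 0 otherwise. The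
    denominator is positive because $2-s$ or $s-1$ is. *)
Lemma smooth_step : exists psi : R^o -> R^o,
  [/\ smooth setT psi, forall s, s <= 1 -> psi s = 1 &
      forall s, 2 <= s -> psi s = 0].
Proof.
pose g : R^o -> R^o := flat_fun 1.
have g0 s : s <= 0 -> g s = 0 by exact: flat_fun_le0.
have gp s : 0 < s -> 0 < g s.
  by move=> s0; rewrite /g /flat_fun s0 hornerC mul1r expR_gt0.
have gge s : 0 <= g s.
  by case: (leP s 0) => [/g0 ->//|/gp/ltW].
have den s : 0 < g (2 - s) + g (s - 1).
  have [s1|s1] := leP s 1.
    by rewrite ltr_pwDl// gp// subr_gt0 (le_lt_trans s1)// ltr1n.
  by rewrite ltr_wpDl// gp// subr_gt0.
exists (fun s => g (2 - s) * (g (2 - s) + g (s - 1))^-1); split.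
- move=> k; have c1 : Ck k setT (fun s : R^o => g (2 - s)).
    apply: (@Ck_comp_real _ _ _ _ _ setT (fun s : R^o => 2 - s : R^o)) => //.
    + exact: fin_dim_R.
    + exact: openT.
    + exact: openT.
    + apply: Ck_add; [exact: openT|exact: Ck_cst|].
      apply: Ck_lin_map; first exact: fin_dim_R.
      by move=> a x y; rewrite opprD scalerN.
    + exact: Ck_flat_fun.
  have c2 : Ck k setT (fun s : R^o => g (s - 1)).
    apply: (@Ck_comp_real _ _ _ _ _ setT (fun s : R^o => s - 1 : R^o)) => //.
    + exact: fin_dim_R.
    + exact: openT.
    + exact: openT.
    + apply: Ck_add; [exact: openT| |exact: Ck_cst].
      exact: (@Ck_lin_map _ _ _ _ _ idfun fin_dim_R).
    + exact: Ck_flat_fun.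
  apply: Ck_mul => //; first exact: openT.
  apply: (@Ck_comp_real _ _ _ _ _ [set t | t != 0]
    (fun s : R^o => g (2 - s) + g (s - 1) : R^o) _ fin_dim_R).
  + exact: openT.
  + exact: (@open_neq R 0).
  + by move=> s _ /=; exact: lt0r_neq0.
  + apply: Ck_add => //; exact: openT.
  + exact: Ck_inv.
- move=> s s1; rewrite (g0 (s - 1)) ?subr_le0// addr0 mulfV//.
  by rewrite lt0r_neq0// gp// subr_gt0 (le_lt_trans s1)// ltr1n.
- by move=> s s2; rewrite (g0 (2 - s)) ?subr_le0// mul0r.
Qed.

Lemma smooth_bump d (u0 : 'rV[R]_d) (O : set 'rV[R]_d) : open_nbhs u0 O ->
  exists (psi : 'rV[R]_d -> R^o) (W K : set 'rV[R]_d),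
    [/\ smooth setT psi, open_nbhs u0 W & forall u, W u -> psi u = 1] /\
    [/\ compact K, K `<=` O & forall u, ~ K u -> psi u = 0].
Proof.
move=> /open_nbhs_nbhs/nbhs_ballP[e /= e0 Be].
(* The norm on row vectors is the sup norm, so smoothness is taken from the squared Euclidean
   distance [q]. The constant in [r] is chosen so that the support $q\le 2r=e^2/2$ bounds each
   squared coordinate strictly below $e^2$ and hence lies in the ball of radius [e]. *)
pose q (u : 'rV[R]_d) : R^o := \sum_i (u 0 i - u0 0 i) * (u 0 i - u0 0 i).
pose r := e ^+ 2 / 4.
have r0 : 0 < r by rewrite divr_gt0// exprn_gt0.
have [psi [cpsi psi1 psi0]] := smooth_step.
have cq k : Ck k setT q.
  apply: Ck_sum; first exact: openT.
  move=> i _; have ci : Ck k setT (fun u : 'rV[R]_d => u 0 i - u0 0 i : R^o).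
    apply: Ck_add; [exact: openT| |exact: Ck_cst].
    apply: Ck_lin_map; first exact: fin_dim_rV.
    by move=> a u v; rewrite !mxE.
  by apply: Ck_mul => //; exact: openT.
have qcont : continuous q by move=> u; exact: (cq 0%N).
have coordq u i : ((u : 'rV[R]_d) 0 i - u0 0 i) ^+ 2 <= q u.
  rewrite /q (bigD1 i)//= -expr2 lerDl; apply: sumr_ge0 => j _.
  by rewrite -expr2 sqr_ge0.
have KB u : q u <= 2 * r -> ball u0 e u.
  move=> qu; split => // i j; rewrite ord1 /ball /= distrC.
  rewrite -ltr_sqr ?nnegrE ?(ltW e0)// real_normK ?num_real//.
  rewrite (le_lt_trans (coordq u j))// (le_lt_trans qu)//.
  by rewrite /r mulrA ltr_pdivrMr// mulrC ltr_pM2l ?exprn_gt0// ltr_nat.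
exists (fun u => psi (q u / r)), [set u | q u < r], [set u | q u <= 2 * r].
split; split => //.
- move=> k; have cr : Ck k setT (fun u => q u / r : R^o).
    by apply: Ck_mul => //; [exact: openT|exact: Ck_cst].
  exact: (Ck_comp_real fin_dim_R openT openT _ cr (cpsi k)).
- split; last first.
    by rewrite /= /q big1// => i _; rewrite subrr mulr0.
  rewrite (_ : mkset _ = q @^-1` [set x | x < r])//.
  by apply: open_comp => [u _|]; [exact: qcont|exact: open_lt].
- by move=> u /= /ltW qr; rewrite psi1// ler_pdivrMr// mul1r.
- apply: bounded_closed_compact.
    exists (`|u0| + e); split; first exact: num_real.
    move=> x xe u /= qu; apply: le_trans (ltW xe).
    rewrite -[u](subrK u0) addrC (le_trans (ler_normD _ _))// lerD2l.
    by have := KB _ qu; rewrite -ball_normE /= distrC => /ltW.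
  rewrite (_ : mkset _ = q @^-1` [set x | x <= 2 * r])//.
  by apply: preimage_closed => [u _|]; [exact: qcont|exact: closed_le].
- by move=> u /KB; exact: Be.
- by move=> u /= /negP; rewrite -ltNge => /ltW qr; rewrite psi0// ler_pdivlMr.
Qed.

End Bump.

(** * The exponential onto the nonzero complex numbers *)

Section ComplexExp.
Context {R : realType}.

Lemma cexpD (z w : R[i]) : cexp (z + w) = cexp z * cexp w.
Proof.
case: z => a b; case: w => c e; rewrite /cexp /=.
rewrite expRD cosD sinD; apply/eqP; rewrite eq_complex /=.
by apply/andP; split; apply/eqP; ring.
Qed.

Lemma cexp0 : cexp (0 : R[i]) = 1.
Proof. by rewrite /cexp /= expR0 cos0 sin0 mul1r mulr0. Qed.

Lemma cexp_neq0 (z : R[i]) : cexp z != 0.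
Proof.
apply/eqP => z0; have := cexpD z (- z); rewrite subrr cexp0 z0 mul0r.
by move/eqP; rewrite oner_eq0.
Qed.

(** Polar coordinates, kept as a rotation times a dilation so that an orbit is traversed by the flow
    of 1 followed by the flow of $\sqrt{-1}$. The angle is [acos] of the normalized real part, with
    its sign corrected by the imaginary part. *)
Lemma cexp_surj (z : R[i]) : z != 0 ->
  exists a b : R, z = cexp (Complex 0 b) * cexp (Complex a 0).
Proof.
case: z => x y z0.
pose r := Num.sqrt (x ^+ 2 + y ^+ 2).
have n0 : 0 < x ^+ 2 + y ^+ 2.
  rewrite lt0r addr_ge0 ?sqr_ge0// andbT paddr_eq0 ?sqr_ge0// !sqrf_eq0.
  by move: z0; rewrite eq_complex.
have r0 : 0 < r by rewrite sqrtr_gt0.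
have r2 : r ^+ 2 = x ^+ 2 + y ^+ 2 by rewrite sqr_sqrtr// ltW.
have e1 : (x / r) ^+ 2 + (y / r) ^+ 2 = 1.
  by rewrite !expr_div_n -mulrDl -r2 mulfV// expf_neq0// lt0r_neq0.
have xr : -1 <= x / r <= 1.
  rewrite -ler_norml -(@ler_pXn2r _ 2%N)// ?nnegrE// expr1n.
  by rewrite real_normK ?num_real// -e1 lerDl sqr_ge0.
have [b [cb sb]] : exists b, cos b = x / r /\ sin b = y / r.
  have sa : sin (acos (x / r)) = `|y / r|.
    by rewrite sin_acos// -e1 addrAC subrr add0r sqrtr_sqr.
  have [y0|y0] := leP 0 (y / r).
    by exists (acos (x / r)); split; [exact: acosK|rewrite sa ger0_norm].
  exists (- acos (x / r)); rewrite cosN sinN sa ltr0_norm// opprK.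
  by split=> //; exact: acosK.
exists (ln r), b; rewrite /cexp expR0 cos0 sin0 lnK ?posrE// cb sb.
have rn0 : r != 0 by rewrite lt0r_neq0.
by apply/eqP; rewrite eq_complex /=; apply/andP; split; apply/eqP; field.
Qed.

End ComplexExp.

(** * Smooth maps and tangent vectors *)

Section SmoothFunctions.
Context {R : realType}.
Implicit Types (M : topologicalType) (E G H : normedModType R).

(** [smooth_on] with an arbitrary normed target and an arbitrary family of charts, so that products
    of a manifold with the plane are covered too; for [G] equal to [R^o] and the atlas of a manifold
    the two coincide by unfolding. *)
Definition fsmooth {M E G} (A : set (chart M E)) (U : set M) (f : M -> G) :
    Prop :=
  forall c, A c -> smooth (cto c @` (cdom c `&` U)) (f \o cfrom c).

(** The part of [is_atlas] that passes to products without computing transition maps; compatibility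
    of charts enters through [smooth_map_id]. *)
Definition covering {M E} (A : set (chart M E)) : Prop :=
  (forall c, A c -> is_chart c) /\ (forall x, exists2 c, A c & cdom c x).

Lemma covering_atlas d (M : manifold R d) : covering (atlas M).
Proof. by have [] := manifold_atlas M. Qed.

Lemma covering_id E : covering (id_atlas E).
Proof.
split=> [c ->|x]; last by eexists; first reflexivity.
split => //=; first exact: openT.
- by rewrite image_id; exact: openT.
- by move=> x _; exact: cvg_id.
- by move=> x _; exact: cvg_id.
Qed.

Lemma open_preimage_in (T T' : topologicalType) (U : set T) (W : set T')
    (F : T -> T') : open U -> open W ->
  (forall x, U x -> {for x, continuous F}) -> open (U `&` F @^-1` W).
Proof.
move=> oU oW cF; rewrite openE => x [Ux WFx]; apply: filterI.
  exact: open_nbhs_nbhs.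
by apply: (cF x Ux); exact: open_nbhs_nbhs.
Qed.

Lemma open_setX (T T' : topologicalType) (U : set T) (V : set T') :
  open U -> open V -> open (U `*` V).
Proof.
move=> oU oV.
rewrite (_ : U `*` V = (fst @^-1` U) `&` (snd @^-1` V))//.
apply: openI; apply: open_comp => // x _; [exact: cvg_fst|exact: cvg_snd].
Qed.

Lemma chart_image_open M E (c : chart M E) (V : set M) :
  is_chart c -> open V -> open (cto c @` (cdom c `&` V)).
Proof.
move=> [oD oI ctoK cc cf] oV.
rewrite openE => _ [x [Dx Vx] <-].
have n1 : nbhs (cto c x) (cto c @` cdom c).
  by apply: open_nbhs_nbhs; split => //; exists x.
have n2 : nbhs (cto c x) (cfrom c @^-1` V).
  by apply: (cf x Dx); rewrite /= ctoK//; exact: open_nbhs_nbhs.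
apply: filterS (filterI n1 n2) => _ [[y Dy <-] /=]; rewrite ctoK// => Vy.
by exists y.
Qed.

Lemma covering_prod M M' E E' (A : set (chart M E)) (A' : set (chart M' E')) :
  covering A -> covering A' -> covering (prod_atlas A A').
Proof.
move=> [cA coA] [cA' coA']; split; last first.
  move=> [x x']; have [c Ac cx] := coA x; have [c' Ac' cx'] := coA' x'.
  by exists (prod_chart c c') => //; exists (c, c').
move=> _ [[c c'] [Ac Ac'] <-]; rewrite /= in Ac Ac'.
have [[ op1 op2 k1 h1 h2] [ op1' op2' k1' h1' h2']] := (cA _ Ac, cA' _ Ac').
split => /=.
- exact: open_setX.
- rewrite (_ : image _ _ = (cto c @` cdom c) `*` (cto c' @` cdom c')).
    exact: open_setX.
  apply/seteqP; split => [_ [[x x'] [Dx Dx'] <-]|[u u'] []].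
    by split; [exists x|exists x'].
  by rewrite /= => -[x Dx <-] [x' Dx' <-]; exists (x, x').
- by move=> [x x'] [Dx Dx']; rewrite k1// k1'.
- move=> [x x'] [Dx Dx']; apply: cvg_pair => /=.
    by apply: (@continuous_comp _ _ _ fst (cto c) (x, x')); [exact: cvg_fst|exact: h1].
  by apply: (@continuous_comp _ _ _ snd (cto c') (x, x')); [exact: cvg_snd|exact: h1'].
- move=> [x x'] [Dx Dx']; apply: cvg_pair => /=.
    by apply: (@continuous_comp _ _ _ fst (cfrom c) (cto c x, cto c' x')); [exact: cvg_fst|exact: h2].
  by apply: (@continuous_comp _ _ _ snd (cfrom c') (cto c x, cto c' x')); [exact: cvg_snd|exact: h2'].
Qed.

Section OneAtlas.
Context {M : topologicalType} {E : normedModType R} {A : set (chart M E)}.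
Hypothesis cA : covering A.
Implicit Types (U V : set M).

Lemma fsmooth_eq G U (f g : M -> G) : open U -> (forall x, U x -> f x = g x) ->
  fsmooth A U f -> fsmooth A U g.
Proof.
move=> oU fg sf c Ac k; have cc := cA.1 c Ac.
apply: Ck_eq (sf c Ac k); first exact: chart_image_open.
by move=> _ [x [Dx Ux] <-] /=; case: cc => _ _ -> // _ _; exact: fg.
Qed.

Lemma fsmooth_sub G U V (f : M -> G) : V `<=` U ->
  fsmooth A U f -> fsmooth A V f.
Proof.
move=> VU sf c Ac k; apply: Ck_sub (sf c Ac k).
by apply: image_subset; exact: setIS.
Qed.

Lemma fsmooth_local G U (f : M -> G) :
  (forall x, U x -> exists2 V, V x & fsmooth A V f) -> fsmooth A U f.
Proof.
move=> H c Ac k; apply: Ck_local => _ [x [Dx Ux] <-].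
have [V Vx sf] := H x Ux; exists (cto c @` (cdom c `&` V)); last exact: sf.
by exists x.
Qed.

Lemma fsmooth_cst G U (a : G) : fsmooth A U (fun=> a).
Proof. by move=> c Ac k; exact: Ck_cst. Qed.

Lemma fsmooth_add G U (f g : M -> G) : open U ->
  fsmooth A U f -> fsmooth A U g -> fsmooth A U (fun x => f x + g x).
Proof.
move=> oU sf sg c Ac k; apply: Ck_add; last exact: sg.
  exact/chart_image_open/oU/cA.1.
exact: sf.
Qed.

Lemma fsmooth_mul U (f g : M -> R^o) : open U ->
  fsmooth A U f -> fsmooth A U g -> fsmooth A U (fun x => f x * g x : R^o).
Proof.
move=> oU sf sg c Ac k; apply: Ck_mul; last exact: sg.
  exact/chart_image_open/oU/cA.1.
exact: sf.
Qed.

Lemma fsmooth_sum G U (I : Type) (r : seq I) (P : pred I) (f : I -> M -> G) :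
  open U -> (forall i, P i -> fsmooth A U (f i)) ->
  fsmooth A U (fun x => \sum_(i <- r | P i) f i x).
Proof.
move=> oU sf c Ac k; apply: (@Ck_sum _ k _ _ _ _ _ _ (fun i x => f i (cfrom c x))).
  exact/chart_image_open/oU/cA.1.
by move=> i Pi; exact: sf.
Qed.

Lemma fsmooth_post G H U (W : set G) (f : M -> G) (g : G -> H) :
  fin_dim G -> fin_dim H -> open U -> open W -> (forall x, U x -> W (f x)) ->
  fsmooth A U f -> smooth W g -> fsmooth A U (fun x => g (f x)).
Proof.
move=> fG fH oU oW UW sf sg c Ac k; have cc := cA.1 c Ac.
apply: (Ck_comp fG fH (chart_image_open cc oU) oW _ (sf c Ac k) (sg k)).
by move=> _ [x [Dx Ux] <-] /=; case: cc => _ _ -> // _ _; exact: UW.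
Qed.

Lemma fsmooth_lin G H U (f : M -> G) (L : G -> H) :
  fin_dim G -> open U -> linear L ->
  fsmooth A U f -> fsmooth A U (fun x => L (f x)).
Proof.
move=> fG oU lL sf c Ac k; apply: (@Ck_lin_comp _ k _ _ _ _ L) => //.
  exact/chart_image_open/oU/cA.1.
exact: sf.
Qed.

Lemma fsmooth_pair G H U (f : M -> G) (g : M -> H) :
  fin_dim G -> fin_dim H -> open U ->
  fsmooth A U f -> fsmooth A U g -> fsmooth A U (fun x => (f x, g x)).
Proof.
move=> fG fH oU sf sg c Ac k; apply: Ck_pair => //; last exact: sg.
  exact/chart_image_open/oU/cA.1.
exact: sf.
Qed.

Lemma fsmooth_continuous G U (f : M -> G) x : open U -> fsmooth A U f -> U x ->
  {for x, continuous f}.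
Proof.
move=> oU sf Ux; have [c Ac Dx] := cA.2 x; have [oD _ ctoK cto_c cfrom_c] := cA.1 c Ac.
have cf : {for x, continuous (fun y => f (cfrom c (cto c y)))}.
  apply: (@continuous_comp _ _ _ (cto c) (f \o cfrom c)); first exact: cto_c.
  by apply: (sf c Ac 0%N); exists x.
rewrite /prop_for /continuous_at /= in cf *.
rewrite ctoK// in cf; apply: cvg_trans cf; apply: near_eq_cvg.
have : nbhs x (cdom c) by exact: open_nbhs_nbhs.
by apply: filterS => y Dy; rewrite ctoK.
Qed.

End OneAtlas.

Lemma smooth_mapP M M' E E' (A : set (chart M E)) (A' : set (chart M' E'))
    (U : set M) (F : M -> M') :
  smooth_map A A' U F <-> (forall x, U x -> {for x, continuous F}) /\
    forall c', A' c' -> fsmooth A (U `&` F @^-1` cdom c') (fun x => cto c' (F x)).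
Proof.
split=> -[cF H]; split=> //.
  by move=> c' Ac' c Ac; rewrite setIA; exact: H.
by move=> c c' Ac Ac'; rewrite -setIA; exact: H.
Qed.

Lemma fsmooth_comp M M' E E' G (A : set (chart M E)) (A' : set (chart M' E'))
    (U : set M) (U' : set M') (F : M -> M') (f : M' -> G) :
  covering A -> covering A' -> fin_dim E' -> fin_dim G -> open U -> open U' ->
  smooth_map A A' U F -> fsmooth A' U' f ->
  fsmooth A (U `&` F @^-1` U') (fun x => f (F x)).
Proof.
move=> cA cA' fE' fG oU oU' [cF sF] sf.
apply: fsmooth_local => x [Ux U'Fx].
have [c' Ac' Dc'] := cA'.2 (F x); have [oD' _ ctoK' _ _] := cA'.1 c' Ac'.
exists (U `&` F @^-1` (cdom c' `&` U')) => //.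
have oV : open (U `&` F @^-1` (cdom c' `&` U')).
  by apply: open_preimage_in => //; exact: openI.
move=> c Ac k; have cc := cA.1 c Ac.
have [_ _ ctoK _ _] := cc.
apply: (@Ck_eq _ k _ _ _ ((f \o cfrom c') \o (cto c' \o F \o cfrom c))).
- exact: chart_image_open.
- move=> _ [y [Dy [Uy [Dy' Uy']]] <-] /=.
  by rewrite ctoK// ctoK'.
- apply: (@Ck_comp _ k _ _ _ _ (cto c' @` (cdom c' `&` U'))) => //.
  + exact: chart_image_open.
  + exact/chart_image_open/oU'/cA'.1.
  + move=> _ [y [Dy [Uy [Dy' Uy']]] <-] /=; rewrite ctoK//.
    by exists (F y).
  + apply: Ck_sub (sF c c' Ac Ac' k).
    by move=> _ [y [Dy [Uy [Dy' Uy']]] <-]; exists y.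
  + exact: sf.
Qed.

Lemma fsmooth_id_atlas E G (U : set E) (f : E -> G) :
  fsmooth (id_atlas E) U f <-> smooth U f.
Proof.
split=> [H|H c ->] /=; last by rewrite setTI image_id.
by have := H (Chart setT idfun idfun) (erefl _); rewrite /= setTI image_id.
Qed.

Lemma smooth_map_comp M1 M2 M3 E1 E2 E3 (A1 : set (chart M1 E1))
    (A2 : set (chart M2 E2)) (A3 : set (chart M3 E3)) (U : set M1) (V : set M2)
    (F : M1 -> M2) (H : M2 -> M3) :
  covering A1 -> covering A2 -> covering A3 -> fin_dim E2 -> fin_dim E3 ->
  open U -> open V -> smooth_map A1 A2 U F -> smooth_map A2 A3 V H ->
  (forall x, U x -> V (F x)) -> smooth_map A1 A3 U (fun x => H (F x)).
Proof.
move=> c1 c2 c3 f2 f3 oU oV sF /smooth_mapP[cH sH] UV.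
have cF := sF.1; apply/smooth_mapP; split=> [x Ux|c Ac].
  by apply: (@continuous_comp _ _ _ F H); [exact: cF|exact/cH/UV].
have oW : open (V `&` H @^-1` cdom c).
  by apply: open_preimage_in => //; have [] := c3.1 c Ac.
apply: fsmooth_sub (fsmooth_comp c1 c2 f2 f3 oU oW sF (sH c Ac)).
by move=> x [Ux Dx]; split => //; split => //; exact: UV.
Qed.

Lemma smooth_map_id_atlas M E G (A : set (chart M E)) (U : set M) (F : M -> G) :
  covering A -> open U -> fsmooth A U F -> smooth_map A (id_atlas G) U F.
Proof.
move=> cA oU sF; apply/smooth_mapP; split=> [x Ux|c ->].
  exact: fsmooth_continuous sF Ux.
by apply: fsmooth_sub sF => x [].
Qed.

Lemma smooth_map_pair M M1 M2 E E1 E2 (A : set (chart M E))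
    (A1 : set (chart M1 E1)) (A2 : set (chart M2 E2)) (U : set M)
    (F1 : M -> M1) (F2 : M -> M2) :
  covering A -> covering A1 -> covering A2 -> fin_dim E1 -> fin_dim E2 ->
  open U -> smooth_map A A1 U F1 -> smooth_map A A2 U F2 ->
  smooth_map A (prod_atlas A1 A2) U (fun x => (F1 x, F2 x)).
Proof.
move=> cA cA1 cA2 f1 f2 oU /smooth_mapP[c1 s1] /smooth_mapP[c2 s2].
apply/smooth_mapP; split=> [x Ux|_ [[c c'] [Ac Ac'] <-] /=].
  by apply: cvg_pair; [exact: c1|exact: c2].
have -> : U `&` (fun x => (F1 x, F2 x)) @^-1` (cdom c `*` cdom c') =
    (U `&` F1 @^-1` cdom c) `&` (U `&` F2 @^-1` cdom c').
  by apply/seteqP; split=> [x [Ux []]|x [[Ux ?] [_ ?]]].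
have oD1 : open (U `&` F1 @^-1` cdom c).
  by apply: open_preimage_in => //; have [] := cA1.1 c Ac.
have oD2 : open (U `&` F2 @^-1` cdom c').
  by apply: open_preimage_in => //; have [] := cA2.1 c' Ac'.
apply: fsmooth_pair => //; first exact: openI.
  by apply: fsmooth_sub (s1 c Ac) => x [].
by apply: fsmooth_sub (s2 c' Ac') => x [].
Qed.

Lemma smooth_map_cst M M' E E' (A : set (chart M E)) (A' : set (chart M' E'))
    (U : set M) (y : M') : smooth_map A A' U (fun=> y).
Proof.
apply/smooth_mapP; split=> [x _|c' _]; first exact: cvg_cst.
exact: fsmooth_cst.
Qed.

Lemma smooth_map_sub M M' E E' (A : set (chart M E)) (A' : set (chart M' E'))
    (U V : set M) (F : M -> M') : V `<=` U ->
  smooth_map A A' U F -> smooth_map A A' V F.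
Proof.
move=> VU /smooth_mapP[cF sF]; apply/smooth_mapP; split=> [x /VU|c' Ac'].
  exact: cF.
by apply: fsmooth_sub (sF c' Ac') => x [/VU].
Qed.

(** Compatibility of charts is exactly smoothness of the identity map. Changes of coordinates are
    later obtained as push-forwards by the identity. *)
Lemma smooth_map_id d (M : manifold R d) :
  smooth_map (atlas M) (atlas M) setT (fun x => x).
Proof.
have [_ _ H] := manifold_atlas M; apply/smooth_mapP; split=> [x _|c' Ac' c Ac].
  exact: cvg_id.
by rewrite setTI; exact: H.
Qed.

Lemma fsmooth_cto d (M : manifold R d) c : atlas M c ->
  fsmooth (atlas M) (cdom c) (cto c).
Proof.
move=> Ac; have /smooth_mapP[_ /(_ c Ac)] := smooth_map_id M.
by rewrite setTI.
Qed.

End SmoothFunctions.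

(** * Derivatives along moving directions, tangent vectors and push-forward *)

Section DerivativeAlong.
Context {R : realType}.

Lemma derive_lin (E F : normedModType R) (f : E -> F) x k u v :
  differentiable f x -> 'D_(k *: u + v) f x = k *: 'D_u f x + 'D_v f x.
Proof. by move=> df; rewrite !deriveE// linearP. Qed.

Lemma derive_comp (E F G : normedModType R) (f : E -> F) (g : F -> G) x u :
  differentiable f x -> differentiable g (f x) ->
  'D_u (g \o f) x = 'D_('D_u f x) g (f x).
Proof.
move=> df dg; rewrite !deriveE//; last exact: differentiable_comp.
by rewrite diff_comp.
Qed.

Context {M : topologicalType} {E : normedModType R} {A : set (chart M E)}.
Hypothesis cA : covering A.

(** The direction [a y] moves with the point; expanding it in a frame leaves derivatives in the
    fixed directions [e i], which are smooth by the recursive form of [Ck], with smooth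
    coefficients. *)
Lemma fsmooth_derive (c : chart M E) (V : set M) (f : M -> R^o) (a : M -> E) :
  fin_dim E -> A c -> fsmooth A (cdom c) (cto c) -> open V -> V `<=` cdom c ->
  fsmooth A V f -> fsmooth A V a ->
  fsmooth A V (fun y => 'D_(a y) (f \o cfrom c) (cto c y)).
Proof.
move=> fE Ac sc oV Vc sf sa.
have [n [e [l [cl eE]]]] := fE.
have oI : open (cto c @` (cdom c `&` V)) by exact/chart_image_open/oV/cA.1.
have Icto y : V y -> (cto c @` (cdom c `&` V)) (cto c y).
  by move=> Vy; exists y => //; split=> //; exact: Vc.
apply: (@fsmooth_eq _ _ _ _ cA _ _
  (fun y => \sum_i (l i (a y) * 'D_(e i) (f \o cfrom c) (cto c y) : R^o))) => //.
  move=> y Vy; have df : differentiable (f \o cfrom c) (cto c y).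
    by have [+ _] := sf c Ac 1%N; apply; exact: Icto.
  rewrite [in RHS](eE (a y)) deriveE// linear_sum.
  by apply: eq_bigr => i _; rewrite linearZ deriveE.
apply: fsmooth_sum => // i _; apply: fsmooth_mul => //.
  by apply: fsmooth_lin => // k x y; rewrite linearP.
apply: (@fsmooth_post _ _ _ _ cA E R^o V _ (cto c) ('D_(e i) (f \o cfrom c))
  fE fin_dim_R oV oI Icto (fsmooth_sub Vc sc)).
by move=> k; have [_] := sf c Ac k.+1; apply.
Qed.

End DerivativeAlong.

Section TangentVectors.
Context {R : realType} {d : nat} {M : manifold R d}.
Local Notation A := (atlas M).
Let cA : covering A := covering_atlas M.
Let fE : fin_dim 'rV[R]_d := fin_dim_rV d.
Implicit Types (x : M) (U V : set M) (f g : M -> R).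

Lemma smooth_near_differentiable c x f : A c -> cdom c x -> smooth_near x f ->
  differentiable (f \o cfrom c : 'rV[R]_d -> R^o) (cto c x).
Proof.
by move=> Ac Dx [U [oU Ux] sf]; have [+ _] := sf c Ac 1%N; apply; exists x.
Qed.

Lemma smooth_on_near U x f : open U -> U x -> smooth_on U f -> smooth_near x f.
Proof. by move=> oU Ux sf; exists U. Qed.

Lemma smooth_near_eq U x f g : open U -> U x -> (forall y, U y -> f y = g y) ->
  smooth_near x f -> smooth_near x g.
Proof.
move=> oU Ux fg [V [oV Vx] sf]; exists (U `&` V).
  by split=> //; exact: openI.
apply: (@fsmooth_eq _ _ _ _ cA R^o _ f g); first exact: openI.
  by move=> y [/fg].
by apply: fsmooth_sub sf => y [].
Qed.

Lemma chart_vecE c x u f : smooth_near x f ->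
  chart_vec c x u f = 'D_u (f \o cfrom c : 'rV[R]_d -> R^o) (cto c x).
Proof. by move=> sf; rewrite /chart_vec asboolT. Qed.

Lemma chart_vec_out c x u f : ~ smooth_near x f -> chart_vec c x u f = 0.
Proof. by move=> sf; rewrite /chart_vec asboolF. Qed.

Lemma smooth_near_cst x (a : R) : smooth_near x (fun=> a : R).
Proof.
by exists setT; [split=> //; exact: openT|exact: (@fsmooth_cst _ _ _ _ R^o)].
Qed.

Lemma smooth_near_add x f g : smooth_near x f -> smooth_near x g ->
  smooth_near x (fun y => f y + g y).
Proof.
move=> [U [oU Ux] sf] [V [oV Vx] sg]; have oUV := openI oU oV.
exists (U `&` V) => //; apply: (@fsmooth_add _ _ _ _ cA R^o) => //.
  by apply: fsmooth_sub sf => y [].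
by apply: fsmooth_sub sg => y [].
Qed.

Lemma chart_vec_lin c x k u v : A c -> cdom c x ->
  chart_vec c x (k *: u + v) = k *: chart_vec c x u + chart_vec c x v.
Proof.
move=> Ac Dx; apply/funext => f; rewrite !fctE.
have [sf|nf] := pselect (smooth_near x f).
  by rewrite !chart_vecE// derive_lin//; exact: smooth_near_differentiable.
by rewrite !chart_vec_out// scaler0 addr0.
Qed.

Lemma tangent_chart_vec c x u : A c -> cdom c x -> tangent x (chart_vec c x u).
Proof. by move=> Ac Dx; exists c, u. Qed.

Lemma tangent_out x v f : tangent x v -> ~ smooth_near x f -> v f = 0.
Proof. by move=> [c [u [_ _ ->]]]; exact: chart_vec_out. Qed.

(** Locality has to hold for every raw function: if [f] is not smooth near [x], neither is [g], and
    both values are 0 by the convention in [chart_vec]. *)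
Lemma tangent_eq U x v f g : open U -> U x -> (forall y, U y -> f y = g y) ->
  tangent x v -> v f = v g.
Proof.
move=> oU Ux fg [c [u [Ac Dx ->]]].
have gf y : U y -> g y = f y by move/fg.
have [sf|nf] := pselect (smooth_near x f); last first.
  by rewrite !chart_vec_out// => /(smooth_near_eq oU Ux gf).
rewrite !chart_vecE//; last exact: smooth_near_eq fg sf.
apply: (@eq_in_derive _ _ _ (cto c @` (cdom c `&` U))).
- exact/chart_image_open/oU/cA.1.
- by exists x.
- move=> _ [y [Dy Uy] <-] /=; have [_ _ ctoK _ _] := cA.1 c Ac.
  by rewrite ctoK//; exact: fg.
Qed.

Lemma tangent_add x v f g : tangent x v -> smooth_near x f -> smooth_near x g ->
  v (fun y => f y + g y) = v f + v g.
Proof.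
move=> [c [u [Ac Dx ->]]] sf sg; rewrite !chart_vecE//; last first.
  exact: smooth_near_add.
by rewrite -deriveD//; apply: diff_derivable; exact: smooth_near_differentiable.
Qed.

Lemma tangent_cst x v (a : R) : tangent x v -> v (fun=> a) = 0.
Proof.
move=> [c [u [Ac Dx ->]]]; rewrite chart_vecE; last exact: smooth_near_cst.
exact: (derive_cst (a : R^o)).
Qed.

Lemma chart_coord_smooth c (i : 'I_d) : A c ->
  smooth_on (cdom c) (fun y => cto c y 0 i).
Proof.
move=> Ac; apply: (@fsmooth_lin _ _ _ _ cA 'rV[R]_d R^o _ (cto c)
  (fun u => u 0 i)) => //.
- by have [] := cA.1 c Ac.
- by move=> k u v; rewrite !mxE.
- exact: fsmooth_cto.
Qed.

Lemma chart_vec_coord c x u i : A c -> cdom c x ->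
  chart_vec c x u (fun y => cto c y 0 i) = u 0 i.
Proof.
move=> Ac Dx; have cc := cA.1 c Ac; have [oD _ ctoK _ _] := cc.
rewrite chart_vecE; last exact: smooth_on_near oD Dx (chart_coord_smooth i Ac).
have li : linear (fun w : 'rV[R]_d => w 0 i : R^o) by move=> k v w; rewrite !mxE.
pose L : {linear 'rV[R]_d -> R^o} :=
  HB.pack (fun w : 'rV[R]_d => w 0 i : R^o) (GRing.isLinear.Build _ _ _ _ _ li).
have cL : continuous L by exact: linear_fin_dim_continuous.
rewrite (@eq_in_derive _ _ _ (cto c @` (cdom c `&` setT)) _ L).
- by rewrite deriveE ?diff_lin//; exact: linear_differentiable.
- exact/chart_image_open/openT.
- by exists x.
- by move=> _ [y [Dy _] <-] /=; rewrite ctoK.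
Qed.

End TangentVectors.

Section Pushforward.
Context {R : realType} {d d' : nat} {M : manifold R d} {M' : manifold R d'}.
Local Notation A := (atlas M).
Local Notation A' := (atlas M').
Variables (U : set M) (F : M -> M').
Hypotheses (oU : open U) (sF : smooth_map A A' U F).

Lemma smooth_on_comp (U' : set M') (g : M' -> R) : open U' -> smooth_on U' g ->
  smooth_on (U `&` F @^-1` U') (g \o F).
Proof.
move=> oU' sg; apply: (@fsmooth_comp _ _ _ _ _ R^o _ _ _ _ _ g) sF sg => //.
- exact: covering_atlas.
- exact: covering_atlas.
- exact: fin_dim_rV.
- exact: fin_dim_R.
Qed.

Lemma smooth_near_comp x (g : M' -> R) : U x -> smooth_near (F x) g ->
  smooth_near x (g \o F).
Proof.
move=> Ux [V [oV Vx] sg]; exists (U `&` F @^-1` V); last exact: smooth_on_comp.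
by split=> //; apply: open_preimage_in => //; have [] := sF.
Qed.

Lemma dmap_chart_vec c c' x u : A c -> A' c' -> U x -> cdom c x ->
  cdom c' (F x) ->
  dmap F x (chart_vec c x u) =
  chart_vec c' (F x) ('D_u (cto c' \o F \o cfrom c) (cto c x)).
Proof.
move=> Ac Ac' Ux Dx Dx'; apply/funext => g; rewrite /dmap.
case: asboolP => sg; last by rewrite chart_vec_out.
have cc := (covering_atlas M).1 c Ac; have [_ _ ctoK _ _] := cc.
have cc' := (covering_atlas M').1 c' Ac'; have [oD' _ ctoK' _ _] := cc'.
rewrite chart_vecE; last exact: smooth_near_comp.
rewrite chart_vecE//.
have oW : open (U `&` F @^-1` cdom c').
  by apply: open_preimage_in => //; have [] := sF.
rewrite (@eq_in_derive _ _ _ (cto c @` (cdom c `&` (U `&` F @^-1` cdom c'))) _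
    ((g \o cfrom c' : 'rV[R]_d' -> R^o) \o (cto c' \o F \o cfrom c))); last first.
- by move=> _ [y [Dy [Uy Dy']] <-] /=; rewrite ctoK// ctoK'.
- by exists x.
- exact: chart_image_open.
have e : (cto c' \o F \o cfrom c) (cto c x) = cto c' (F x) by rewrite /= ctoK.
rewrite derive_comp ?e//; last exact: smooth_near_differentiable.
have [_ sFc] := sF; have [+ _] := sFc c c' Ac Ac' 1%N; apply.
by exists x.
Qed.

Lemma dmap_tangent x v : U x -> tangent x v -> tangent (F x) (dmap F x v).
Proof.
move=> Ux [c [u [Ac Dx ->]]].
have [c' Ac' Dx'] := (covering_atlas M').2 (F x).
by rewrite (dmap_chart_vec _ Ac Ac')//; exact: tangent_chart_vec.
Qed.

End Pushforward.

Lemma dmap_lin (R : realType) d d' (M : manifold R d) (M' : manifold R d')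
    (F : M -> M') x k (v w : tvec R M) :
  dmap F x (k *: v + w) = k *: dmap F x v + dmap F x w.
Proof.
by apply/funext => g; rewrite !fctE /dmap; case: asboolP; rewrite ?scaler0 ?addr0.
Qed.

Lemma dmap_id (R : realType) d (M : manifold R d) (F : M -> M) (x : M) v :
  (forall y, F y = y) -> tangent x v -> dmap F x v = v.
Proof.
move=> Fid tv; have -> : F = id by apply/funext.
apply/funext => g; rewrite /dmap; case: asboolP => [_ //|ns].
by rewrite (tangent_out tv ns).
Qed.

Lemma dmap_comp (R : realType) d1 d2 d3 (M1 : manifold R d1)
    (M2 : manifold R d2) (M3 : manifold R d3) (V : set M2)
    (F : M1 -> M2) (H : M2 -> M3) x v :
  open V -> V (F x) -> smooth_map (atlas M2) (atlas M3) V H ->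
  dmap H (F x) (dmap F x v) = dmap (H \o F) x v.
Proof.
move=> oV VFx sH; apply/funext => g; rewrite /dmap /=.
case: asboolP => // sg; rewrite asboolT//; exact: (smooth_near_comp oV sH VFx sg).
Qed.

Section TangentSpace.
Context {R : realType} {d : nat} {M : manifold R d}.
Local Notation A := (atlas M).
Implicit Types (x : M) (U V : set M) (f g : M -> R).

(** A change of chart is the push-forward by the identity, so the components in the new chart come
    out of [dmap_chart_vec]. *)
Lemma tangent_chartP c x v : A c -> cdom c x -> tangent x v ->
  exists u, v = chart_vec c x u.
Proof.
move=> Ac Dx tv; have [c' [u [Ac' Dx' e]]] := tv.
rewrite -(@dmap_id _ _ _ id x v)// e.
rewrite (dmap_chart_vec openT (smooth_map_id M) _ Ac' Ac)//.
by eexists; reflexivity.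
Qed.

Lemma tangent_lin x k v w : tangent x v -> tangent x w ->
  tangent x (k *: v + w).
Proof.
move=> [c [u [Ac Dx ->]]] /(tangent_chartP Ac Dx)[u' ->].
by rewrite -chart_vec_lin//; exact: tangent_chart_vec.
Qed.

Lemma tangent0 x : tangent x 0.
Proof.
have [c Ac Dx] := (covering_atlas M).2 x.
have t := @tangent_chart_vec _ _ M c x 0 Ac Dx.
have := tangent_lin (-1) t t; rewrite scaleN1r addNr; exact.
Qed.

Lemma tangentD x v w : tangent x v -> tangent x w -> tangent x (v + w).
Proof. by move=> tv tw; rewrite -[v]scale1r; exact: tangent_lin. Qed.

Lemma tangentZ x k v : tangent x v -> tangent x (k *: v).
Proof.
by move=> tv; rewrite -[k *: v]addr0; apply: tangent_lin => //; exact: tangent0.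
Qed.

End TangentSpace.

(** * Smooth vector fields *)

Section VectorFields.
Context {R : realType} {d : nat} {M : manifold R d}.
Local Notation A := (atlas M).
Let cA : covering A := covering_atlas M.
Let fE : fin_dim 'rV[R]_d := fin_dim_rV d.
Implicit Types (x : M) (U V : set M) (f g : M -> R) (X Y : vfld R M).

(** The components are obtained by letting the field act on the coordinate functions, which makes
    their smoothness an instance of the definition of [vfield_on]. *)
Definition vcomp (c : chart M 'rV[R]_d) X : M -> 'rV[R]_d :=
  fun x => \row_i X x (fun y => cto c y 0 i).

Lemma vcompE c X x : A c -> cdom c x -> tangent x (X x) ->
  X x = chart_vec c x (vcomp c X x).
Proof.
move=> Ac Dx /(tangent_chartP Ac Dx)[u e]; rewrite [LHS]e.
congr chart_vec; apply/rowP => i.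
by rewrite mxE e chart_vec_coord.
Qed.

Lemma fsmooth_row n (E : normedModType R) (T : topologicalType)
    (B : set (chart T E)) (U : set T) (f : T -> 'rV[R]_n) : covering B ->
  open U -> (forall i, fsmooth B U (fun t => f t 0 i : R^o)) -> fsmooth B U f.
Proof.
move=> cB oU sf; apply: (@fsmooth_eq _ _ _ _ cB _ _
  (fun t => \sum_i (f t 0 i : R^o) *: delta_mx 0 i)) => //.
  by move=> x _; rewrite -row_sum_delta.
apply: fsmooth_sum => // i _.
apply: (@fsmooth_lin _ _ _ _ cB R^o _ _ _ (fun t => t *: delta_mx 0 i)) => //.
- exact: fin_dim_R.
- by move=> k a b; rewrite scalerDl scalerA.
Qed.

Lemma fsmooth_vcomp c U X : A c -> open U -> vfield_on U X ->
  fsmooth A (cdom c `&` U) (vcomp c X).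
Proof.
move=> Ac oU [tX sX]; have [oD _ _ _ _] := cA.1 c Ac.
have oDU : open (cdom c `&` U) by exact: openI.
apply: fsmooth_row => // i.
apply: (@fsmooth_eq _ _ _ _ cA _ _ (fun x => X x (fun y => cto c y 0 i))) => //.
  by move=> x _; rewrite mxE.
apply: sX => //.
by apply: fsmooth_sub (chart_coord_smooth i Ac) => x [].
Qed.

Lemma smooth_on_chart_vec c V f (a : M -> 'rV[R]_d) : A c -> open V ->
  V `<=` cdom c -> smooth_on V f -> fsmooth A V a ->
  smooth_on V (fun x => chart_vec c x (a x) f).
Proof.
move=> Ac oV Vc sf sa.
apply: (@fsmooth_eq _ _ _ _ cA R^o _
  (fun x => 'D_(a x) (f \o cfrom c : _ -> R^o) (cto c x))) => //.
  by move=> x Vx; rewrite chart_vecE//; exists V.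
by apply: fsmooth_derive => //; exact: fsmooth_cto.
Qed.

Lemma smooth_on_local U f :
  (forall x, U x -> exists2 V, V x & smooth_on V f) -> smooth_on U f.
Proof. exact: (@fsmooth_local _ _ _ _ R^o). Qed.

Lemma smooth_on_sub U V f : V `<=` U -> smooth_on U f -> smooth_on V f.
Proof. exact: (@fsmooth_sub _ _ _ _ R^o). Qed.

Lemma smooth_on_eq U f g : open U -> (forall x, U x -> f x = g x) ->
  smooth_on U f -> smooth_on U g.
Proof. exact: (@fsmooth_eq _ _ _ _ cA R^o). Qed.

Lemma smooth_on_add U f g : open U -> smooth_on U f -> smooth_on U g ->
  smooth_on U (fun x => f x + g x).
Proof. exact: (@fsmooth_add _ _ _ _ cA R^o). Qed.

Lemma smooth_on_mul U f g : open U -> smooth_on U f -> smooth_on U g ->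
  smooth_on U (fun x => f x * g x).
Proof. exact: (@fsmooth_mul _ _ _ _ cA). Qed.

Lemma smooth_on_cst U (a : R) : smooth_on U (fun=> a : R).
Proof. exact: (@fsmooth_cst _ _ _ _ R^o). Qed.

Lemma vfield_on_sub U V X : V `<=` U -> vfield_on U X -> vfield_on V X.
Proof.
move=> VU [tX sX]; split=> [x /VU|W f oW WV]; first exact: tX.
by apply: sX => //; exact: subset_trans VU.
Qed.

Lemma vfield_on_local U X :
  (forall x, U x -> exists2 V, open V /\ V x & vfield_on V X) -> vfield_on U X.
Proof.
move=> H; split=> [x /H[V [_ Vx] [tX _]]|W f oW WU sf]; first exact: tX.
apply: smooth_on_local => x Wx; have [V [oV Vx] [_ sX]] := H x (WU x Wx).
exists (W `&` V) => //; apply: sX => //; first exact: openI.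
by apply: smooth_on_sub sf => y [].
Qed.

Lemma vfield_on_eq U X Y : open U -> (forall x, U x -> X x = Y x) ->
  vfield_on U X -> vfield_on U Y.
Proof.
move=> oU XY [tX sX]; split=> [x Ux|W f oW WU sf]; first by rewrite -XY//; exact: tX.
by apply: smooth_on_eq (sX W f oW WU sf) => // x /WU Ux; rewrite XY.
Qed.

Lemma vfield_on_chart c V X (a : M -> 'rV[R]_d) : A c -> open V ->
  V `<=` cdom c -> fsmooth A V a ->
  (forall x, V x -> X x = chart_vec c x (a x)) -> vfield_on V X.
Proof.
move=> Ac oV Vc sa eX; split=> [x Vx|W f oW WV sf].
  by rewrite eX//; apply: tangent_chart_vec => //; exact: Vc.
apply: (@smooth_on_eq _ (fun x => chart_vec c x (a x) f)) => //.
  by move=> x /WV Vx; rewrite eX.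
apply: smooth_on_chart_vec => //; first exact: subset_trans Vc.
exact: fsmooth_sub sa.
Qed.

Lemma vfield_on_add U X Y : vfield_on U X -> vfield_on U Y ->
  vfield_on U (fun x => X x + Y x).
Proof.
move=> [tX sX] [tY sY]; split=> [x Ux|W f oW WU sf].
  by apply: tangentD; [exact: tX|exact: tY].
by apply: smooth_on_add => //; [exact: sX|exact: sY].
Qed.

Lemma vfield_on_fscale U g X : smooth_on U g -> vfield_on U X ->
  vfield_on U (fscale g X).
Proof.
move=> sg [tX sX]; split=> [x Ux|W f oW WU sf].
  by apply: tangentZ; exact: tX.
by apply: smooth_on_mul => //; [exact: smooth_on_sub sg|exact: sX].
Qed.

Lemma vfield_on0 U : vfield_on U (fun=> 0).
Proof. by split=> [x _|W f _ _ _]; [exact: tangent0|exact: smooth_on_cst]. Qed.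

Lemma vfieldD X Y : vfield X -> vfield Y -> vfield (X + Y).
Proof. exact: vfield_on_add. Qed.

Lemma vfieldZ (k : R) X : vfield X -> vfield (k *: X).
Proof. by apply: vfield_on_fscale; exact: smooth_on_cst. Qed.

Lemma vfieldN X : vfield X -> vfield (- X).
Proof. by rewrite -scaleN1r; exact: vfieldZ. Qed.

Lemma vfieldB X Y : vfield X -> vfield Y -> vfield (X - Y).
Proof. by move=> vX vY; apply: vfieldD => //; exact: vfieldN. Qed.

Lemma lieE X Y x f : smooth_near x f ->
  lie X Y x f = X x (fun y => Y y f) - Y x (fun y => X y f).
Proof. by move=> sf; rewrite /lie asboolT. Qed.

End VectorFields.

(** * The complex structure acting on tangent vectors and fields *)

Section ComplexStructure.
Context {R : realType} {n : nat} {M : manifold R (n + n)} {J : endo R M}.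
Hypothesis JM : complex_manifold J.
Local Notation A := (atlas M).
Implicit Types (x : M) (X Y : vfld R M).

Lemma mul_i_linear : linear (@mul_i R n).
Proof.
by move=> k u v; rewrite /mul_i !linearP /= scale_row_mx add_row_mx.
Qed.

Lemma mul_iK (u : 'rV[R]_(n + n)) : mul_i (mul_i u) = - u.
Proof. by rewrite /mul_i row_mxKl row_mxKr -opp_row_mx hsubmxK. Qed.

Lemma J_tangent x v : tangent x v -> tangent x (J x v).
Proof. by move=> [c [u [Ac Dx ->]]]; rewrite JM//; exact: tangent_chart_vec. Qed.

Lemma J_lin x k v w : tangent x v -> tangent x w ->
  J x (k *: v + w) = k *: J x v + J x w.
Proof.
move=> [c [u [Ac Dx ->]]] /(tangent_chartP Ac Dx)[u' ->].
by rewrite -chart_vec_lin// !JM// mul_i_linear chart_vec_lin.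
Qed.

Lemma J_J x v : tangent x v -> J x (J x v) = - v.
Proof.
move=> [c [u [Ac Dx ->]]]; rewrite !JM// mul_iK.
rewrite -[- u]addr0 -scaleN1r chart_vec_lin// scaleN1r -[RHS]addr0; congr (_ + _).
have := chart_vec_lin (-1) u u Ac Dx; rewrite !scaleN1r !addNr; exact.
Qed.

Lemma J0 x : J x 0 = 0.
Proof.
have t0 := @tangent0 _ _ M x.
by have := J_lin (-1) t0 t0; rewrite scaleN1r !addr0 oppr0 scaleN1r addNr.
Qed.

Lemma J_D x v w : tangent x v -> tangent x w -> J x (v + w) = J x v + J x w.
Proof. by move=> tv tw; rewrite -[v]scale1r J_lin// !scale1r. Qed.

Lemma J_Z x k v : tangent x v -> J x (k *: v) = k *: J x v.
Proof.
move=> tv; have t0 := @tangent0 _ _ M x.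
by rewrite -[k *: v]addr0 J_lin// J0 addr0.
Qed.

Lemma J_B x v w : tangent x v -> tangent x w -> J x (v - w) = J x v - J x w.
Proof.
move=> tv tw; rewrite J_D//; last by rewrite -scaleN1r; exact: tangentZ.
by rewrite -scaleN1r J_Z// scaleN1r.
Qed.

Lemma vfield_on_fapp U X : open U -> vfield_on U X -> vfield_on U (fapp J X).
Proof.
move=> oU vX; apply: vfield_on_local => x Ux.
have [c Ac Dx] := (covering_atlas M).2 x; have [oD _ _ _ _] := (covering_atlas M).1 c Ac.
have oDU : open (cdom c `&` U) by exact: openI.
exists (cdom c `&` U) => //.
apply: (@vfield_on_chart _ _ _ c _ _ (fun x => mul_i (vcomp c X x))) => //.
- apply: fsmooth_lin => //; [exact: covering_atlas|exact: fin_dim_rV| |].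
    exact: mul_i_linear.
  exact: fsmooth_vcomp.
- move=> y [Dy Uy]; rewrite /fapp {1}(vcompE Ac Dy); last exact: vX.1.
  exact: JM.
Qed.

Lemma vfield_fapp X : vfield X -> vfield (fapp J X).
Proof. by apply: vfield_on_fapp; exact: openT. Qed.

Lemma fappJJ X : vfield X -> fapp J (fapp J X) = - X.
Proof. by move=> [tX _]; apply/funext => x; exact/J_J/tX. Qed.

Lemma fappD X Y : vfield X -> vfield Y -> fapp J (X + Y) = fapp J X + fapp J Y.
Proof. by move=> [tX _] [tY _]; apply/funext => x; apply: J_D; [exact: tX|exact: tY]. Qed.

Lemma fappZ (k : R) X : vfield X -> fapp J (k *: X) = k *: fapp J X.
Proof. by move=> [tX _]; apply/funext => x; apply: J_Z; exact: tX. Qed.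

Lemma fappB X Y : vfield X -> vfield Y -> fapp J (X - Y) = fapp J X - fapp J Y.
Proof. by move=> [tX _] [tY _]; apply/funext => x; apply: J_B; [exact: tX|exact: tY]. Qed.

Lemma fappN X : vfield X -> fapp J (- X) = - fapp J X.
Proof. by move=> vX; rewrite -scaleN1r fappZ// scaleN1r. Qed.

End ComplexStructure.

(** * The connection of a conical special complex manifold *)

Section Connections.
Context {R : realType} {d : nat} {M : manifold R d} {D : conn R M}.
Hypothesis cD : connection D.
Implicit Types (X Y Z : vfld R M).

Lemma conn_vfield X Y : vfield X -> vfield Y -> vfield (D X Y).
Proof. by case: cD => + _ _ _ _; apply. Qed.

Lemma connDl X Y Z : vfield X -> vfield Y -> vfield Z ->
  D (X + Y) Z = D X Z + D Y Z.
Proof. by case: cD => _ + _ _ _; apply. Qed.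

Lemma connDr X Y Z : vfield X -> vfield Y -> vfield Z ->
  D X (Y + Z) = D X Y + D X Z.
Proof. by case: cD => _ _ _ + _; apply. Qed.

Lemma connZl (k : R) X Y : vfield X -> vfield Y -> D (k *: X) Y = k *: D X Y.
Proof.
by move=> vX vY; case: cD => _ _ /(_ (fun=> k) X Y (smooth_on_cst _ k) vX vY) + _ _.
Qed.

Lemma connZr (k : R) X Y : vfield X -> vfield Y -> D X (k *: Y) = k *: D X Y.
Proof.
move=> vX vY; case: cD => _ _ _ _ /(_ (fun=> k) X Y (smooth_on_cst _ k) vX vY).
rewrite -/(k *: Y) => ->; rewrite (_ : fscale _ Y = 0) ?add0r//.
by apply/funext => x; rewrite /fscale (tangent_cst k (vX.1 x I)) scale0r.
Qed.

Lemma connNl X Y : vfield X -> vfield Y -> D (- X) Y = - D X Y.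
Proof. by move=> vX vY; rewrite -scaleN1r connZl// scaleN1r. Qed.

Lemma connNr X Y : vfield X -> vfield Y -> D X (- Y) = - D X Y.
Proof. by move=> vX vY; rewrite -scaleN1r connZr// scaleN1r. Qed.

Lemma connBr X Y Z : vfield X -> vfield Y -> vfield Z ->
  D X (Y - Z) = D X Y - D X Z.
Proof. by move=> vX vY vZ; rewrite connDr ?connNr//; exact: vfieldN. Qed.

End Connections.

Section Fscale.
Context {R : realType} {d : nat} {M : manifold R d}.
Implicit Types (X Y : vfld R M) (f g : M -> R).

Lemma fscaleDr f X Y : fscale f (X + Y) = fscale f X + fscale f Y.
Proof. by apply/funext => x; exact: scalerDr. Qed.

Lemma fscaleNr f X : fscale f (- X) = - fscale f X.
Proof. by apply/funext => x; exact: scalerN. Qed.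

Lemma fscaleZr f (k : R) X : fscale f (k *: X) = k *: fscale f X.
Proof. by apply/funext => x; apply: etrans (scalerA _ _ _) _; rewrite mulrC -scalerA. Qed.

End Fscale.

Section Conical.
Context {R : realType} {n : nat} {N : manifold R (n + n)}.
Context {J : endo R N} {D : conn R N} {xi : vfld R N}.
Hypothesis H : conical_special_complex J D xi.
Implicit Types (X Y Z : vfld R N).
Local Notation JF := (fapp J).
Local Notation eta := (JF xi).

Let JN : complex_manifold J. Proof. by case: H => -[]. Qed.
Let cD : connection D. Proof. by case: H => -[]. Qed.
Let tD : torsion_free D. Proof. by case: H => -[]. Qed.
Let flD : flat D. Proof. by case: H => -[]. Qed.
Let symD X Y : vfield X -> vfield Y -> nabla_endo D J X Y = nabla_endo D J Y X.
Proof. by case: H => -[_ _ _ _ + _ _ _]; apply. Qed.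

Lemma vfield_xi : vfield xi. Proof. by case: H. Qed.
Let vxi := vfield_xi.
Lemma vfield_eta : vfield eta. Proof. exact: vfield_fapp. Qed.
Let veta := vfield_eta.

Let D_xi X : vfield X -> D X xi = X.
Proof. by case: H => _ _ + _; apply. Qed.

Let xi_D X : vfield X -> D xi X = lie xi X + X.
Proof. by move=> vX; rewrite -tD// D_xi// subrK. Qed.

(** Since $\nabla_X\xi=X$ and the torsion vanishes, $\nabla_\xi X=[\xi,X]+X$. The hypothesis $L_\xi
    J=0$ thus becomes $\nabla_\xi J=0$. *)
Let xi_J X : vfield X -> D xi (JF X) = JF (D xi X).
Proof.
move=> vX; have vJX := vfield_fapp JN vX.
have vlie : vfield (lie xi X).
  by rewrite -tD//; apply: vfieldB; apply: conn_vfield.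
case: H => _ _ _ /(_ X vX)/subr0_eq e.
by rewrite xi_D// e xi_D// fappD.
Qed.

(** Symmetry of $\nabla J$ turns $\nabla_\xi J=0$ into $(\nabla_XJ)\xi=0$, and $\nabla_X\xi=X$ does
    the rest. *)
Lemma D_eta X : vfield X -> D X eta = JF X.
Proof.
move=> vX; have := symD vX vxi.
rewrite /nabla_endo xi_J// subrr D_xi// => /subr0_eq; exact.
Qed.

(** Symmetry once more: $(\nabla_\eta J)X=(\nabla_XJ)\eta=\nabla_X(-\xi)-J(JX)=-X+X$. *)
Let eta_J X : vfield X -> D eta (JF X) = JF (D eta X).
Proof.
move=> vX; have := symD veta vX; rewrite /nabla_endo D_eta//.
rewrite (fappJJ JN vxi) (fappJJ JN vX) (connNr cD)// D_xi// subrr.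
by move=> /subr0_eq.
Qed.

Lemma nabla'E X Y : vfield X -> vfield Y ->
  nabla' J D X Y = (2^-1 : R) *: (D X Y - JF (D X (JF Y))).
Proof.
move=> vX vY; have vJY := vfield_fapp JN vY.
have v1 := conn_vfield cD vX vY; have v2 := conn_vfield cD vX vJY.
rewrite /nabla' /nabla_endo fappB//; last exact: vfield_fapp.
rewrite fappJJ// opprK; apply/funext => x; apply/funext => f.
by rewrite !fctE; set a := D X Y x f; set b := JF _ x f;
  rewrite -![_ *: _]/(_ * _); field.
Qed.

Lemma nabla'_vfield X Y : vfield X -> vfield Y -> vfield (nabla' J D X Y).
Proof.
move=> vX vY; rewrite nabla'E//; apply/vfieldZ/vfieldB; first exact: conn_vfield.
exact/vfield_fapp/conn_vfield/vfield_fapp.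
Qed.

Lemma fapp_fscale f X : vfield X -> JF (fscale f X) = fscale f (JF X).
Proof. by move=> vX; apply/funext => x; apply: J_Z => //; exact: vX.1. Qed.

Lemma nabla'_connection : connection (nabla' J D).
Proof.
have vJ := vfield_fapp JN; have vD := conn_vfield cD.
split.
- exact: nabla'_vfield.
- move=> X Y Z vX vY vZ; rewrite !nabla'E//; last exact: vfieldD.
  rewrite !(connDl cD) ?fappD//; try by [apply: vD => //; exact: vJ|exact: vJ].
  by rewrite -scalerDr opprD addrACA.
- move=> f X Y sf vX vY.
  have vfX : vfield (fscale f X) by exact: vfield_on_fscale.
  rewrite !nabla'E//; have [_ _ + _ _] := cD => /[dup] h -> //.
  rewrite h ?fapp_fscale//; [|exact/vD/vJ|exact: vJ].
  by rewrite fscaleZr fscaleDr fscaleNr.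
- move=> X Y Z vX vY vZ; rewrite !nabla'E//; last exact: vfieldD.
  rewrite fappD// !(connDr cD) ?fappD//; try by [apply: vD => //; exact: vJ|exact: vJ].
  by rewrite -scalerDr opprD addrACA.
- move=> f X Y sf vX vY.
  have vfY : vfield (fscale f Y) by exact: vfield_on_fscale.
  have sXf : smooth_on setT (fun x => X x f).
    by have [_ +] := vX; apply => //; exact: openT.
  rewrite !nabla'E//; have [_ _ _ _ h] := cD; rewrite fapp_fscale// !h//; last exact: vJ.
  have [vJY vDJ] : vfield (JF Y) /\ vfield (D X (JF Y)).
    by split; [exact: vJ|exact/vD/vJ].
  rewrite fappD ?fapp_fscale//; try exact: vfield_on_fscale.
  rewrite fappJJ// fscaleNr fscaleZr fscaleDr fscaleNr.
  apply/funext => x; apply/funext => g; rewrite /fscale !fctE.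
  by rewrite -![_ *: _]/(_ * _); field.
Qed.

Lemma nabla'_torsion_free : torsion_free (nabla' J D).
Proof.
move=> X Y vX vY; rewrite /nabla' symD// opprD opprK addrACA addNr addr0.
exact: tD.
Qed.

Lemma nabla'_complex X Y : vfield X -> vfield Y ->
  nabla_endo (nabla' J D) J X Y = 0.
Proof.
move=> vX vY; have vJ := vfield_fapp JN; have vD := conn_vfield cD.
have [vJY vXY] := (vJ _ vY, vD _ _ vX vY).
have vXJY := vD _ _ vX vJY.
rewrite /nabla_endo !nabla'E// fappJJ// (connNr cD)// fappN// opprK.
rewrite fappZ//; last by apply: vfieldB => //; exact: vJ.
rewrite fappB//; last exact: vJ.
by rewrite fappJJ// opprK [in X in _ - X]addrC subrr.
Qed.

Lemma nabla'_xi X : vfield X -> nabla' J D X xi = X.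
Proof.
move=> vX; rewrite nabla'E// D_xi// D_eta// fappJJ// opprK.
by apply/funext => x; apply/funext => g; rewrite !fctE -![_ *: _]/(_ * _); field.
Qed.

Lemma nabla'_eta X : vfield X -> nabla' J D X eta = JF X.
Proof.
move=> vX; have := nabla'_complex vX vxi.
by rewrite /nabla_endo nabla'_xi// => /subr0_eq.
Qed.

Lemma xi_nabla' X : vfield X -> lie xi X = 0 -> nabla' J D xi X = X.
Proof.
move=> vX l0; apply/eqP; rewrite -subr_eq0 -{2}(nabla'_xi vX).
by rewrite nabla'_torsion_free// l0.
Qed.

Lemma eta_nabla' X : vfield X -> lie eta X = 0 -> nabla' J D eta X = JF X.
Proof.
move=> vX l0; apply/eqP; rewrite -subr_eq0 -(nabla'_eta vX).
by rewrite nabla'_torsion_free// l0.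
Qed.

Lemma lie_xi_J X : vfield X -> lie xi X = 0 -> lie xi (JF X) = 0.
Proof.
move=> vX l0; case: H => _ _ _ /(_ X vX); rewrite l0 => /subr0_eq ->.
by apply/funext => x; exact: J0.
Qed.

(** With $\nabla_\eta J=0$ and $\nabla_{JX}\eta=J(JX)$ the bracket $[\eta,JX]$ equals $J(\nabla_\eta
    X-JX)=J[\eta,X]$. *)
Lemma lie_eta_J X : vfield X -> lie eta X = 0 -> lie eta (JF X) = 0.
Proof.
move=> vX l0; have vJX := vfield_fapp JN vX; rewrite -tD// D_eta// eta_J//.
have : D eta X - JF X = 0 by rewrite -(D_eta vX) tD.
by move=> /subr0_eq ->; rewrite subrr.
Qed.

Let D_commute X Y Z : vfield X -> vfield Y -> vfield Z -> lie X Y = 0 ->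
  D X (D Y Z) = D Y (D X Z).
Proof.
move=> vX vY vZ l0; have := flD vX vY vZ; rewrite l0.
have -> : D 0 Z = 0 by rewrite -(scale0r xi) (connZl cD)// !scale0r.
by rewrite subr0 => /subr0_eq.
Qed.

(** The bracket is $\nabla_\xi(\nabla'_XY)-\nabla'_XY$. The operator $\nabla_\xi$ passes through
    $J$, passes through $\nabla_X$ by flatness, and fixes $Y$ and $JY$ because they commute with
    $\xi$. *)
Lemma lie_xi_nabla' X Y : vfield X -> vfield Y -> lie xi X = 0 ->
  lie xi Y = 0 -> lie xi (nabla' J D X Y) = 0.
Proof.
move=> vX vY lX lY; have vJ := vfield_fapp JN; have vD := conn_vfield cD.
have [vJY vXY] := (vJ _ vY, vD _ _ vX vY).
have vXJY := vD _ _ vX vJY; have vJXJY := vJ _ vXJY.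
have e Z : vfield Z -> lie xi Z = 0 -> D xi Z = Z.
  by move=> vZ lZ; rewrite xi_D// lZ add0r.
have vnab := nabla'_vfield vX vY.
rewrite -tD// D_xi// nabla'E// (connZr cD)//; last exact: vfieldB.
rewrite (connBr cD)// xi_J// (D_commute vxi vX vY lX).
by rewrite (D_commute vxi vX vJY lX) e// e ?subrr//; exact: lie_xi_J.
Qed.

(** As for $\xi$, except that $\nabla_\eta$ acts as $J$ on fields commuting with $\eta$. Hence
    $\nabla_\eta(\nabla'_XY)$ becomes $\frac12(\nabla_XJY+J\nabla_XY)=J\nabla'_XY$, which is
    $\nabla_Z\eta$ for $Z=\nabla'_XY$. *)
Lemma lie_eta_nabla' X Y : vfield X -> vfield Y -> lie eta X = 0 ->
  lie eta Y = 0 -> lie eta (nabla' J D X Y) = 0.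
Proof.
move=> vX vY lX lY; have vJ := vfield_fapp JN; have vD := conn_vfield cD.
have [vJY vXY] := (vJ _ vY, vD _ _ vX vY).
have vXJY := vD _ _ vX vJY; have vJXJY := vJ _ vXJY.
have e Z : vfield Z -> lie eta Z = 0 -> D eta Z = JF Z.
  by move=> vZ lZ; apply/subr0_eq; rewrite -(D_eta vZ) tD.
have vnab := nabla'_vfield vX vY.
rewrite -tD// D_eta// nabla'E// (connZr cD)//; last exact: vfieldB.
rewrite (connBr cD)// eta_J// (D_commute veta vX vY lX).
rewrite (D_commute veta vX vJY lX) (e Y)// (e (JF Y))//; last exact: lie_eta_J.
rewrite fappJJ// (connNr cD)// fappN// opprK.
rewrite fappZ//; last exact: vfieldB.
rewrite fappB// fappJJ// opprK.
by rewrite [in X in _ - X]addrC subrr.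
Qed.

End Conical.

(** * Calculus on products *)

Section Slices.
Context {R : realType} {E F G : normedModType R}.

Lemma derive_slice_l (K : (E * F)%type -> G) a b u :
  'D_u (fun e => K (e, b)) a = 'D_((u, 0)) K (a, b).
Proof.
have e : (fun h : R => h^-1 *: (((fun e => K (e, b)) \o shift a) (h *: u) -
    K (a, b))) = (fun h : R => h^-1 *: ((K \o shift (a, b)) (h *: (u, 0)) -
    K (a, b))).
  apply/funext => h /=; congr (_ *: (K _ - _)).
  by congr (_, _); rewrite /= scaler0 add0r.
by rewrite /derive e.
Qed.

Lemma derive_slice_r (K : (E * F)%type -> G) a b v :
  'D_v (fun e => K (a, e)) b = 'D_((0, v)) K (a, b).
Proof.
have e : (fun h : R => h^-1 *: (((fun e => K (a, e)) \o shift b) (h *: v) -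
    K (a, b))) = (fun h : R => h^-1 *: ((K \o shift (a, b)) (h *: (0, v)) -
    K (a, b))).
  apply/funext => h /=; congr (_ *: (K _ - _)).
  by congr (_, _); rewrite /= scaler0 add0r.
by rewrite /derive e.
Qed.

End Slices.

Section ProductAtlases.
Context {R : realType} {M1 M2 : topologicalType} {E1 E2 : normedModType R}.
Context {A1 : set (chart M1 E1)} {A2 : set (chart M2 E2)}.
Hypotheses (c1 : covering A1) (c2 : covering A2).
Hypotheses (f1 : fin_dim E1) (f2 : fin_dim E2).
Implicit Types G : normedModType R.

Lemma fsmooth_fst G U (f : M1 -> G) : fin_dim G -> open U -> fsmooth A1 U f ->
  fsmooth (prod_atlas A1 A2) (U `*` setT) (fun z => f z.1).
Proof.
move=> fG oU sf _ [[c c'] [Ac Ac'] <-] k; rewrite /= in Ac Ac' *.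
have cc := c1.1 c Ac; have cc' := c2.1 c' Ac'.
apply: (@Ck_comp _ k _ _ _ _ (cto c @` (cdom c `&` U)) fst (f \o cfrom c)) => //.
- have [oD _ _ _ _] := cc; have [oD' _ _ _ _] := cc'.
  apply: (@chart_image_open _ _ _ (prod_chart c c')).
    by apply: (covering_prod c1 c2).1; exists (c, c').
  by apply: open_setX => //; exact: openT.
- exact: chart_image_open.
- by move=> _ [[x x'] [[Dx Dx'] [Ux _]] <-] /=; exists x.
- by apply: Ck_lin_map; [exact: fin_dim_prod|move=> a x y].
- exact: sf.
Qed.

Lemma fsmooth_snd G U (f : M2 -> G) : fin_dim G -> open U -> fsmooth A2 U f ->
  fsmooth (prod_atlas A1 A2) (setT `*` U) (fun z => f z.2).
Proof.
move=> fG oU sf _ [[c c'] [Ac Ac'] <-] k; rewrite /= in Ac Ac' *.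
have cc := c1.1 c Ac; have cc' := c2.1 c' Ac'.
apply: (@Ck_comp _ k _ _ _ _ (cto c' @` (cdom c' `&` U)) snd (f \o cfrom c')) => //.
- have [oD _ _ _ _] := cc; have [oD' _ _ _ _] := cc'.
  apply: (@chart_image_open _ _ _ (prod_chart c c')).
    by apply: (covering_prod c1 c2).1; exists (c, c').
  by apply: open_setX => //; exact: openT.
- exact: chart_image_open.
- by move=> _ [[x x'] [[Dx Dx'] [_ Ux]] <-] /=; exists x'.
- by apply: Ck_lin_map; [exact: fin_dim_prod|move=> a x y].
- exact: sf.
Qed.

Lemma fsmooth_prod_cto c c' : A1 c -> A2 c' ->
  fsmooth A1 (cdom c) (cto c) -> fsmooth A2 (cdom c') (cto c') ->
  fsmooth (prod_atlas A1 A2) (cdom (prod_chart c c')) (cto (prod_chart c c')).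
Proof.
move=> Ac Ac' sc sc'; have [oD _ _ _ _] := c1.1 c Ac.
have [oD' _ _ _ _] := c2.1 c' Ac'.
apply: (fsmooth_pair (covering_prod c1 c2)) => //; first exact: open_setX.
  by apply: fsmooth_sub (fsmooth_fst f1 oD sc) => z [].
by apply: fsmooth_sub (fsmooth_snd f2 oD' sc') => z [].
Qed.

End ProductAtlases.

Section PartialDerivatives.
Context {R : realType} {d : nat} {M : manifold R d}.
Context {M1 M2 : topologicalType} {E1 E2 : normedModType R}.
Context {A1 : set (chart M1 E1)} {A2 : set (chart M2 E2)}.
Hypotheses (c1 : covering A1) (c2 : covering A2).
Hypotheses (f1 : fin_dim E1) (f2 : fin_dim E2).
Local Notation A := (atlas M).
Variables (U : set M) (F1 : M -> M1) (F2 : M -> M2).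
Variables (W : set (M1 * M2)%type) (G : (M1 * M2)%type -> R).
Hypotheses (oU : open U) (oW : open W).
Hypotheses (s1 : smooth_map A A1 U F1) (s2 : smooth_map A A2 U F2).
Hypothesis sG : fsmooth (prod_atlas A1 A2) W (G : _ -> R^o).

Lemma smooth_on_pair :
  smooth_on (U `&` (fun y => (F1 y, F2 y)) @^-1` W) (fun y => G (F1 y, F2 y)).
Proof.
have cA := covering_atlas M; have cP := covering_prod c1 c2.
have sp := smooth_map_pair cA c1 c2 f1 f2 oU s1 s2.
exact: (@fsmooth_comp _ _ _ _ _ R^o _ _ _ _ _ (G : _ -> R^o) cA cP
  (fin_dim_prod f1 f2) fin_dim_R oU oW sp sG).
Qed.

Lemma chart_vec_pair c k1 k2 x u : A c -> A1 k1 -> A2 k2 -> cdom c x -> U x ->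
  cdom k1 (F1 x) -> cdom k2 (F2 x) -> W (F1 x, F2 x) ->
  chart_vec c x u (fun y => G (F1 y, F2 y)) =
  'D_(('D_u (cto k1 \o F1 \o cfrom c) (cto c x),
       'D_u (cto k2 \o F2 \o cfrom c) (cto c x)))
    (G \o cfrom (prod_chart k1 k2) : _ -> R^o) (cto k1 (F1 x), cto k2 (F2 x)).
Proof.
move=> Ac Ak1 Ak2 Dx Ux Dx1 Dx2 Wx; have cA := covering_atlas M.
have cc := cA.1 c Ac; have [_ _ ctoK _ _] := cc.
have cc1 := c1.1 k1 Ak1; have [oD1 _ ctoK1 _ _] := cc1.
have cc2 := c2.1 k2 Ak2; have [oD2 _ ctoK2 _ _] := cc2.
have sp := smooth_map_pair cA c1 c2 f1 f2 oU s1 s2.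
have oV : open (U `&` (fun y => (F1 y, F2 y)) @^-1` W).
  by apply: open_preimage_in => //; have [] := sp.
have sn : smooth_near x (fun y => G (F1 y, F2 y)).
  by eexists; [split; [exact: oV|]|exact: smooth_on_pair].
rewrite chart_vecE//.
pose h := fun z => ((cto k1 \o F1 \o cfrom c) z, (cto k2 \o F2 \o cfrom c) z).
have oV' : open (U `&` (fun y => (F1 y, F2 y)) @^-1` (cdom k1 `*` cdom k2)).
  by apply: open_preimage_in => //; [exact: open_setX|have [] := sp].
rewrite (@eq_in_derive _ _ _ (cto c @` (cdom c `&`
    (U `&` (fun y => (F1 y, F2 y)) @^-1` (cdom k1 `*` cdom k2)))) _
    ((G \o cfrom (prod_chart k1 k2) : _ -> R^o) \o h)); last first.
- by move=> _ [y [Dy [Uy [Dy1 Dy2]]] <-] /=; rewrite ctoK// ctoK1// ctoK2.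
- by exists x.
- exact: chart_image_open.
have hx : h (cto c x) = (cto k1 (F1 x), cto k2 (F2 x)) by rewrite /h /= ctoK.
have d1 : differentiable (cto k1 \o F1 \o cfrom c) (cto c x).
  have [_ sc1] := s1; have [+ _] := sc1 c k1 Ac Ak1 1%N; apply.
  by exists x.
have d2 : differentiable (cto k2 \o F2 \o cfrom c) (cto c x).
  have [_ sc2] := s2; have [+ _] := sc2 c k2 Ac Ak2 1%N; apply.
  by exists x.
rewrite derive_comp.
- rewrite hx; congr ('D_ _ _ _).
  rewrite deriveE; last exact: differentiable_pair.
  by rewrite diff_pair// !deriveE.
- exact: differentiable_pair.
- rewrite hx; have Ap : prod_atlas A1 A2 (prod_chart k1 k2) by exists (k1, k2).
  by have [+ _] := sG Ap 1%N; apply; exists (F1 x, F2 x).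
Qed.

End PartialDerivatives.

Lemma tangent_pair (R : realType) d (M : manifold R d)
    (M1 M2 : topologicalType) (E1 E2 : normedModType R)
    (A1 : set (chart M1 E1)) (A2 : set (chart M2 E2)) (U : set M)
    (F1 : M -> M1) (F2 : M -> M2) (W : set (M1 * M2)%type)
    (G : (M1 * M2)%type -> R) x v :
  covering A1 -> covering A2 -> fin_dim E1 -> fin_dim E2 -> open U -> open W ->
  smooth_map (atlas M) A1 U F1 -> smooth_map (atlas M) A2 U F2 ->
  fsmooth (prod_atlas A1 A2) W (G : _ -> R^o) ->
  U x -> W (F1 x, F2 x) -> tangent x v ->
  v (fun y => G (F1 y, F2 y)) =
  v (fun y => G (F1 y, F2 x)) + v (fun y => G (F1 x, F2 y)).
Proof.
move=> c1 c2 f1 f2 oU oW s1 s2 sG Ux Wx [c [u [Ac Dx ->]]].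
have [k1 Ak1 Dx1] := c1.2 (F1 x); have [k2 Ak2 Dx2] := c2.2 (F2 x).
have t1 := @smooth_map_cst _ _ _ _ _ (atlas M) A1 U (F1 x).
have t2 := @smooth_map_cst _ _ _ _ _ (atlas M) A2 U (F2 x).
rewrite (chart_vec_pair c1 c2 f1 f2 oU oW s1 s2 sG u Ac Ak1 Ak2)//.
rewrite (chart_vec_pair c1 c2 f1 f2 oU oW s1 t2 sG u Ac Ak1 Ak2)//.
rewrite (chart_vec_pair c1 c2 f1 f2 oU oW t1 s2 sG u Ac Ak1 Ak2)//.
have z1 : 'D_u (cto k1 \o (fun=> F1 x) \o cfrom c) (cto c x) = 0.
  exact: (derive_cst (cto k1 (F1 x))).
have z2 : 'D_u (cto k2 \o (fun=> F2 x) \o cfrom c) (cto c x) = 0.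
  exact: (derive_cst (cto k2 (F2 x))).
rewrite z1 z2; set a := 'D_u _ _; set b := 'D_u _ _.
have Ap : prod_atlas A1 A2 (prod_chart k1 k2) by exists (k1, k2).
have dG : differentiable (G \o cfrom (prod_chart k1 k2) : _ -> R^o)
    (cto k1 (F1 x), cto k2 (F2 x)).
  by have [+ _] := sG _ Ap 1%N; apply; exists (F1 x, F2 x).
have := derive_lin 1 (a, 0) (0, b) dG; rewrite !scale1r => <-.
by congr ('D_ _ _ _); congr (_, _); rewrite /= ?addr0 ?add0r.
Qed.

(** * The principal action *)

Section PuncturedPlane.
Context {R : realType}.
Local Notation C2 := (R^o * R^o)%type.

Lemma fin_dim_C2 : fin_dim C2.
Proof. exact: (fin_dim_prod fin_dim_R fin_dim_R). Qed.

Definition ofC (z : R[i]) : C2 := let: Complex a b := z in (a, b).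

Lemma toCK : cancel (@toC R) ofC. Proof. by case. Qed.
Lemma ofCK : cancel ofC (@toC R). Proof. by case. Qed.

Lemma Cstar_ofC z : Cstar (ofC z) <-> z != 0.
Proof. by rewrite /Cstar /= ofCK. Qed.

Lemma open_Cstar : open (@Cstar R).
Proof.
rewrite (_ : @Cstar R = (fst @^-1` [set t : R^o | t != 0]) `|`
    (snd @^-1` [set t : R^o | t != 0])); last first.
  apply/seteqP; split => -[a b]; rewrite /Cstar /= /toC eq_complex /= negb_and.
    by move=> /orP.
  by move=> ?; exact/orP.
apply: openU; apply: open_comp; try exact: (@open_neq R 0).
  by move=> x _; exact: cvg_fst.
by move=> x _; exact: cvg_snd.
Qed.

Lemma smooth_map_id_C2 (U : set C2) :
  smooth_map (id_atlas C2) (id_atlas C2) U (fun z => z).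
Proof.
apply/smooth_mapP; split=> [x _|c ->]; first exact: cvg_id.
by apply/fsmooth_id_atlas => k; exact: (@Ck_lin_map _ _ _ _ _ idfun fin_dim_C2).
Qed.

Definition cexp_curve (l : C2) (t : R^o) : C2 :=
  (expR (t * l.1) * cos (t * l.2), expR (t * l.1) * sin (t * l.2)).

Lemma toC_cexp_curve l t :
  toC (cexp_curve l t) = cexp (Complex t 0 * toC l).
Proof. by case: l => a b; rewrite /cexp /toC /= !mul0r subr0 addr0. Qed.

Lemma cexp_curve0 l : cexp_curve l 0 = (1, 0).
Proof. by rewrite /cexp_curve !mul0r expR0 cos0 sin0 mul1r mulr0. Qed.

Lemma cexp_curve_derive l :
  differentiable (cexp_curve l) 0 /\ 'D_1 (cexp_curve l) 0 = l.
Proof.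
case: l => a b.
have dm (c : R) : is_derive (0 : R) (1 : R) (fun t : R => t * c : R) c.
  have := @is_deriveM R R^o id (cst c) 0 1 1 0 _ _.
  move=> /(_ _ _)/is_derive_eq; apply.
  by rewrite scaler0 add0r -[_ *: _]/(_ * _) mulr1.
have de : is_derive (0 : R) (1 : R) (expR \o (fun t : R => t * a : R)) a.
  have := @is_derive1_comp R expR (fun t : R => t * a) 0 _ _ (is_derive_expR (0 * a)) (dm a).
  by rewrite mul0r expR0 mul1r.
have dc : is_derive (0 : R) (1 : R) (@cos R \o (fun t : R => t * b : R)) 0.
  have := @is_derive1_comp R cos (fun t : R => t * b) 0 _ _ (is_derive_cos (0 * b)) (dm b).
  by rewrite mul0r sin0 oppr0 mul0r.
have ds : is_derive (0 : R) (1 : R) (@sin R \o (fun t : R => t * b : R)) b.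
  have := @is_derive1_comp R sin (fun t : R => t * b) 0 _ _ (is_derive_sin (0 * b)) (dm b).
  by rewrite mul0r cos0 mul1r.
have d1 : is_derive (0 : R^o) (1 : R)
    (fun t : R^o => expR (t * a) * cos (t * b) : R^o) a.
  have := is_deriveM de dc; rewrite /= !mul0r expR0 cos0 !scale1r add0r; exact.
have d2 : is_derive (0 : R^o) (1 : R)
    (fun t : R^o => expR (t * a) * sin (t * b) : R^o) b.
  have := is_deriveM de ds.
  rewrite /= !mul0r expR0 sin0 scale1r scale0r addr0; exact.
have D1 : differentiable (fun t : R^o => expR (t * a) * cos (t * b) : R^o) 0.
  by apply/derivable1_diffP; case: d1.
have D2 : differentiable (fun t : R^o => expR (t * a) * sin (t * b) : R^o) 0.
  by apply/derivable1_diffP; case: d2.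
split; first exact: differentiable_pair.
rewrite deriveE; last exact: differentiable_pair.
rewrite (diff_pair D1 D2) /= -(deriveE _ D1) -(deriveE _ D2).
by case: d1 => _ ->; case: d2 => _ ->.
Qed.

End PuncturedPlane.

Section Action.
Context {R : realType} {n m : nat}.
Context {N : manifold R (n + n)} {Nb : manifold R (m + m)}.
Context {p : N -> Nb} {act : R[i] -> N -> N}.
Hypothesis bundle : principal_Cstar_bundle p act.
Local Notation C2 := (R^o * R^o)%type.
Local Notation one2 := ((1, 0) : C2).
Local Notation B := (id_atlas C2).
Local Notation A := (atlas N).
Implicit Types (x : N) (z : R[i]) (X : vfld R N).

Let cN : covering A := covering_atlas N.
Let cB : covering B := @covering_id R C2.
Let fC : fin_dim C2 := @fin_dim_C2 R.
Let fN : fin_dim 'rV[R]_(n + n) := fin_dim_rV (n + n).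

Lemma act_map_smooth :
  smooth_map (prod_atlas B A) A (@Cstar R `*` setT) (fun zx => act (toC zx.1) zx.2).
Proof. by case: bundle. Qed.

Lemma act1 x : act 1 x = x.
Proof. by case: bundle => _ _ [+ _] _ _. Qed.

Lemma actM z w x : z != 0 -> w != 0 -> act (z * w) x = act z (act w x).
Proof. by case: bundle => _ _ [_ +] _ _; apply. Qed.

Lemma actC z w x : z != 0 -> w != 0 -> act z (act w x) = act w (act z x).
Proof. by move=> z0 w0; rewrite -!actM// mulrC. Qed.

Lemma p_act z x : z != 0 -> p (act z x) = p x.
Proof. by case: bundle => _ _ _ + _; apply. Qed.

Let open_dom : open (@Cstar R `*` [set: N]).
Proof. by apply: open_setX; [exact: open_Cstar|exact: openT]. Qed.

Lemma act_smooth z : z != 0 -> smooth_map A A setT (act z).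
Proof.
move=> z0; have cBA := covering_prod cB cN.
have s := smooth_map_pair cN cB cN fC fN openT
  (@smooth_map_cst _ _ _ _ _ A B setT (ofC z)) (smooth_map_id N).
have := smooth_map_comp cN cBA cN (fin_dim_prod fC fN) fN openT open_dom
  s act_map_smooth _.
rewrite /= ofCK; apply => x _; split=> //=; exact/Cstar_ofC.
Qed.

Lemma orbit_smooth x : smooth_map B A Cstar (fun w => act (toC w) x).
Proof.
have cBA := covering_prod cB cN.
have s := smooth_map_pair cB cB cN fC fN open_Cstar
  (@smooth_map_id_C2 R Cstar) (@smooth_map_cst _ _ _ _ _ B A Cstar x).
exact: (smooth_map_comp cB cBA cN (fin_dim_prod fC fN) fN open_Cstar
  open_dom s act_map_smooth).
Qed.

Lemma orbit_fun_smooth x (V : set N) (h : N -> R) : open V -> smooth_on V h ->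
  open (Cstar `&` (fun w => act (toC w) x) @^-1` V) /\
  smooth (Cstar `&` (fun w => act (toC w) x) @^-1` V)
    (fun w : C2 => h (act (toC w) x) : R^o).
Proof.
move=> oV sh; split.
  by apply: open_preimage_in => //; [exact: open_Cstar|have [] := orbit_smooth x].
apply/fsmooth_id_atlas.
exact: (@fsmooth_comp _ _ _ _ _ R^o _ _ _ _ _ (h : _ -> R^o) cB cN fN fin_dim_R
  open_Cstar oV (orbit_smooth x) sh).
Qed.

Lemma Cstar10 : Cstar one2.
Proof. by rewrite /Cstar /= /toC eq_complex /= negb_and oner_eq0. Qed.

Lemma toC10 : toC one2 = 1.
Proof. by []. Qed.

Lemma orbit_fun_differentiable x (h : N -> R) : smooth_near x h ->
  differentiable (fun w : C2 => h (act (toC w) x) : R^o) one2.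
Proof.
move=> [V [oV Vx] sh]; have [oO sO] := orbit_fun_smooth x oV sh.
have [+ _] := sO 1%N; apply; split; first exact: Cstar10.
by rewrite /= toC10 act1.
Qed.

(** The orbit curve is the orbit map $w\mapsto w\cdot x$ after a curve leaving 1 with velocity [l].
    A fundamental field is thereby a directional derivative on the plane, hence real linear in [l]
    and open to partial differentiation. *)
Lemma fund_is_derive (l : R[i]) x (h : N -> R) : smooth_near x h ->
  is_derive (0 : R) (1 : R) (fun t : R => h (act (cexp (Complex t 0 * l)) x) : R)
    ('D_(ofC l) (fun w : C2 => h (act (toC w) x) : R^o) one2).
Proof.
move=> sh; have dh := orbit_fun_differentiable sh.
have [dg Dg] := cexp_curve_derive (ofC l).
have e : (fun t : R => h (act (cexp (Complex t 0 * l)) x) : R^o) =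
    (fun w : C2 => h (act (toC w) x) : R^o) \o cexp_curve (ofC l).
  by apply/funext => t /=; rewrite toC_cexp_curve ofCK.
rewrite e; have dc : differentiable ((fun w : C2 => h (act (toC w) x) : R^o) \o
    cexp_curve (ofC l)) 0.
  by apply: differentiable_comp => //; rewrite cexp_curve0.
apply: DeriveDef; first exact/diff_derivable.
have dh' : differentiable (fun w : C2 => h (act (toC w) x) : R^o)
    (cexp_curve (ofC l) 0) by rewrite cexp_curve0.
by rewrite (derive_comp _ dg dh') Dg cexp_curve0.
Qed.

Lemma fundE (l : R[i]) x (h : N -> R) : smooth_near x h ->
  fundamental_vfield act l x h =
  'D_(ofC l) (fun w : C2 => h (act (toC w) x) : R^o) one2.
Proof.
move=> sh; rewrite /fundamental_vfield asboolT// derive1E.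
by have [_ ->] := fund_is_derive l sh.
Qed.

Lemma fund_out (l : R[i]) x (h : N -> R) : ~ smooth_near x h ->
  fundamental_vfield act l x h = 0.
Proof. by move=> nh; rewrite /fundamental_vfield asboolF. Qed.

Lemma fund_lin (a b : R) :
  fundamental_vfield act (Complex a b) = (fun x =>
    a *: fundamental_vfield act 1 x + b *: fundamental_vfield act (Complex 0 1) x).
Proof.
apply/funext => x; apply/funext => h; rewrite !fctE.
have [sh|nh] := pselect (smooth_near x h); last first.
  by rewrite !fund_out// !scaler0 addr0.
have dh := orbit_fun_differentiable sh; rewrite !(fundE _ sh).
have -> : ofC (Complex a b) = a *: ofC 1 + b *: ofC (Complex 0 1).
  by congr (_, _); rewrite /= -![_ *: _]/(_ * _); ring.
rewrite (derive_lin _ _ _ dh) -[b *: ofC _]addr0 (derive_lin _ _ _ dh).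
by rewrite derive0 addr0.
Qed.

(** The curve is the orbit of a one-parameter group, so the derivative at time [t] is the derivative
    at time 0 from the displaced starting point. *)
Lemma orbit_is_derive (l : R[i]) x (h : N -> R) (t : R) :
  smooth_near (act (cexp (Complex t 0 * l)) x) h ->
  is_derive t (1 : R) (fun t : R => h (act (cexp (Complex t 0 * l)) x) : R)
    (fundamental_vfield act l (act (cexp (Complex t 0 * l)) x) h).
Proof.
move=> sh; set y := act _ x in sh *.
have d0 := fund_is_derive l sh; rewrite -fundE// in d0.
have e : (fun t : R => h (act (cexp (Complex t 0 * l)) x) : R) =
    (fun s : R => h (act (cexp (Complex s 0 * l)) y) : R) \o (fun s : R => s - t : R).
  apply/funext => s /=; rewrite /y -actM ?cexp_neq0// -cexpD -mulrDl.
  by congr (h (act (cexp (_ * _)) _)); congr Complex; rewrite /= ?subrK// addr0.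
have ds : is_derive t (1 : R) (fun s : R => s - t : R) 1.
  by have := is_derive_shift t 1 (- t).
rewrite e -[X in is_derive _ _ _ X]mulr1; apply: is_derive1_comp ds.
by rewrite subrr.
Qed.

(** Saturation of [W] keeps the two flows inside the set where [h] is controlled; along each of them
    [h] has zero derivative, and the polar form of [z] reaches the whole orbit. *)
Lemma orbit_const (W : set N) (h : N -> R) x z :
  open W -> (forall y w, w != 0 -> W y -> W (act w y)) -> smooth_on W h ->
  (forall y, W y -> fundamental_vfield act 1 y h = 0) ->
  (forall y, W y -> fundamental_vfield act (Complex 0 1) y h = 0) ->
  W x -> z != 0 -> h (act z x) = h x.
Proof.
move=> oW iW sh h1 hi Wx z0.
have step l y : (forall y, W y -> fundamental_vfield act l y h = 0) -> W y ->
    forall t, h (act (cexp (Complex t 0 * l)) y) = h y.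
  move=> hl Wy t.
  have e0 : act (cexp (Complex 0 0 * l)) y = y.
    by rewrite (_ : Complex 0 0 = 0)// mul0r cexp0 act1.
  rewrite -[in RHS]e0; apply: (@is_derive_0_is_cst _
    (fun t : R => h (act (cexp (Complex t 0 * l)) y) : R)) => s.
  have Ws : W (act (cexp (Complex s 0 * l)) y) by apply: iW => //; exact: cexp_neq0.
  by have := orbit_is_derive (smooth_on_near oW Ws sh); rewrite (hl _ Ws).
have [a [b ->]] := cexp_surj z0.
have ea : Complex a 0 = Complex a 0 * 1 by rewrite mulr1.
have eb : Complex 0 b = Complex b 0 * Complex 0 1.
  by apply/eqP; rewrite eq_complex /= !mulr0 !mul0r !mulr1 subr0 addr0 !eqxx.
rewrite actM ?cexp_neq0// {1}eb step//; last by apply: iW => //; exact: cexp_neq0.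
by rewrite ea step.
Qed.

Lemma dmap_act_fund (l : R[i]) z x : z != 0 ->
  dmap (act z) x (fundamental_vfield act l x) =
  fundamental_vfield act l (act z x).
Proof.
move=> z0; apply/funext => g; rewrite /dmap.
case: asboolP => sg; last by rewrite fund_out.
have sgz := smooth_near_comp openT (act_smooth z0) (x := x) I sg.
rewrite /fundamental_vfield !asboolT//; congr (derive1 _ 0).
by apply/funext => t /=; rewrite actC// cexp_neq0.
Qed.

(** Both terms of the bracket are mixed second derivatives at $(1,x)$ of $G(w,y)=f(w\cdot y)$: the
    fundamental field differentiates in $w$, and [X] in $y$. Invariance is what rewrites $X_{w\cdot
    x}f$ as $X_x(f\circ w)$, the partial derivative of $G$ in $y$ at $(w,x)$. *)
Lemma invariant_lie (l : R[i]) X : vfield X -> vfield (fundamental_vfield act l) ->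
  (forall z x, z != 0 -> X (act z x) = dmap (act z) x (X x)) ->
  lie (fundamental_vfield act l) X = 0.
Proof.
move=> vX vl iX; apply/funext => x; apply/funext => f.
have [sf|nf] := pselect (smooth_near x f); last by rewrite /lie asboolF.
rewrite lieE//; have [V [oV Vx] sV] := sf.
have [c Ac Dx] := cN.2 x; have cc := cN.1 c Ac; have [oD _ ctoK _ _] := cc.
have [u eX] := tangent_chartP Ac Dx (vX.1 x I).
pose G (wy : (C2 * N)%type) : R := f (act (toC wy.1) wy.2).
pose O := (@Cstar R `*` [set: N]) `&` (fun wy => act (toC wy.1) wy.2) @^-1` V.
have oO : open O.
  by apply: open_preimage_in => //; have [] := act_map_smooth.
have cBA := covering_prod cB cN.
have fBA := fin_dim_prod fC fN.
have sG : fsmooth (prod_atlas B A) O (G : _ -> R^o).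
  exact: (@fsmooth_comp _ _ _ _ _ R^o _ _ _ _ _ (f : _ -> R^o) cBA cN fN
    fin_dim_R open_dom oV act_map_smooth sV).
pose c2 : chart (C2 * N)%type _ := prod_chart (Chart setT idfun idfun) c.
have Ac2 : prod_atlas B A c2 by exists (Chart setT idfun idfun, c).
pose Gc : (C2 * 'rV[R]_(n + n))%type -> R^o := (G : _ -> R^o) \o cfrom c2.
pose O2 := cto c2 @` (cdom c2 `&` O).
have sGc : smooth O2 Gc := sG _ Ac2.
have cc2 := cBA.1 c2 Ac2; have oO2 : open O2 by exact: chart_image_open.
have O2x : O2 (one2, cto c x).
  exists (one2, x) => //; split; split=> //=; [split=> //; exact: Cstar10|].
  by rewrite toC10 act1.
have Vact w : Cstar w -> V (act (toC w) x) -> O (w, x) by [].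
have e1 : fundamental_vfield act l x (fun y => X y f) =
    'D_((ofC l, 0)) ('D_((0, u)) Gc) (one2, cto c x).
  have sXf : smooth_near x (fun y => X y f).
    by exists V => //; apply: vX.2.
  rewrite (fundE _ sXf) -(derive_slice_l ('D_((0, u)) Gc)).
  have [oS _] := orbit_fun_smooth x oV sV.
  apply: (@eq_in_derive _ _ _ (Cstar `&` (fun w => act (toC w) x) @^-1` V)) => //.
    by split; [exact: Cstar10|rewrite /= toC10 act1].
  move=> w [w0 Vw]; rewrite iX// /dmap.
  have sfw : smooth_near (act (toC w) x) f by exists V.
  have sfa := smooth_near_comp openT (act_smooth w0) (x := x) I sfw.
  rewrite asboolT// eX (chart_vecE _ _ sfa).
  exact: (derive_slice_r Gc).
have e2 : X x (fun y => fundamental_vfield act l y f) =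
    'D_((0, u)) ('D_((ofC l, 0)) Gc) (one2, cto c x).
  have slf : smooth_near x (fun y => fundamental_vfield act l y f).
    by exists V => //; apply: vl.2.
  rewrite eX (chart_vecE _ _ slf) -(derive_slice_r ('D_((ofC l, 0)) Gc)).
  apply: (@eq_in_derive _ _ _ (cto c @` (cdom c `&` V))).
  - exact: chart_image_open.
  - by exists x.
  - move=> _ [y [Dy Vy] <-] /=; rewrite (ctoK _ Dy).
    have sfy : smooth_near y f by exists V.
    rewrite (fundE _ sfy) -(derive_slice_l Gc); congr ('D_ _ _ _).
    by apply/funext => w; rewrite /Gc /G /= ctoK.
by rewrite e1 e2 (schwarz _ _ oO2 O2x (sGc 2%N)) subrr.
Qed.

End Action.

Lemma dmap_eq (R : realType) d d' (M : manifold R d) (M' : manifold R d')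
    (V : set M) (F G : M -> M') x v : open V -> V x ->
  (forall y, V y -> F y = G y) -> tangent x v -> dmap F x v = dmap G x v.
Proof.
move=> oV Vx FG tv; apply/funext => g; rewrite /dmap FG//.
by case: asboolP => // _; apply: tangent_eq oV Vx _ tv => y Vy /=; rewrite FG.
Qed.

(** * Local trivializations and the splitting of tangent vectors *)

Section Trivialization.
Context {R : realType} {n m : nat}.
Context {N : manifold R (n + n)} {Nb : manifold R (m + m)}.
Context {p : N -> Nb} {act : R[i] -> N -> N}.
Hypothesis bundle : principal_Cstar_bundle p act.
Local Notation C2 := (R^o * R^o)%type.
Local Notation B := (id_atlas C2).
Local Notation A := (atlas N).
Local Notation Ab := (atlas Nb).
Implicit Types (x : N) (z : R[i]).

Let cN : covering A := covering_atlas N.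
Let cNb : covering Ab := covering_atlas Nb.
Let cB : covering B := @covering_id R C2.
Let cP : covering (prod_atlas Ab B) := covering_prod cNb cB.
Let fC : fin_dim C2 := @fin_dim_C2 R.
Let fN : fin_dim 'rV[R]_(n + n) := fin_dim_rV (n + n).
Let fNb : fin_dim 'rV[R]_(m + m) := fin_dim_rV (m + m).
Let fP := fin_dim_prod fNb fC.

Lemma p_smooth : smooth_map A Ab setT p.
Proof. by case: bundle. Qed.

Lemma open_preimage_p (V : set Nb) : open V -> open (p @^-1` V).
Proof.
move=> oV; rewrite -[_ @^-1` _]setTI; apply: open_preimage_in => //.
  exact: openT.
by have [] := p_smooth.
Qed.

Lemma p_tangent x v : tangent x v -> tangent (p x) (dmap p x v).
Proof. exact: (dmap_tangent openT p_smooth). Qed.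

Lemma smooth_on_p (V : set Nb) (g : Nb -> R) : open V -> smooth_on V g ->
  smooth_on (p @^-1` V) (g \o p).
Proof.
by move=> oV sg; have := smooth_on_comp openT p_smooth oV sg; rewrite setTI.
Qed.

Lemma smooth_near_p x (g : Nb -> R) : smooth_near (p x) g ->
  smooth_near x (g \o p).
Proof. exact: (smooth_near_comp openT p_smooth). Qed.

Lemma dmap_p_fund l x : dmap p x (fundamental_vfield act l x) = 0.
Proof.
apply/funext => g; rewrite /dmap; case: asboolP => // sg.
rewrite /fundamental_vfield asboolT; last exact: smooth_near_p.
rewrite (_ : (fun t => _) = cst (g (p x))); first exact: derive1_cst.
by apply/funext => t /=; rewrite (p_act bundle)// cexp_neq0.
Qed.

Lemma dmap_p_act z x v : z != 0 ->
  dmap p (act z x) (dmap (act z) x v) = dmap p x v.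
Proof.
move=> z0; rewrite (dmap_comp _ openT I p_smooth).
by apply/funext => g; rewrite /dmap /= (p_act bundle)//;
  congr (if _ then v _ else _); apply/funext => y /=; rewrite (p_act bundle).
Qed.

Variables (U : set Nb) (Phi : N -> Nb * C2) (Psi : Nb * C2 -> N).
Hypothesis oU : open U.
Hypothesis sPhi : smooth_map A (prod_atlas Ab B) (p @^-1` U) Phi.
Hypothesis sPsi : smooth_map (prod_atlas Ab B) A (U `*` @Cstar R) Psi.
Hypothesis hPhi : forall x, U (p x) ->
  [/\ (Phi x).1 = p x, Cstar (Phi x).2, Psi (Phi x) = x &
      forall z, z != 0 -> toC (Phi (act z x)).2 = z * toC (Phi x).2].
Hypothesis hPsi : forall y, U y.1 -> Cstar y.2 ->
  p (Psi y) = y.1 /\ Phi (Psi y) = y.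

Let oUN : open (p @^-1` U) := open_preimage_p oU.
Let oUC : open (U `*` @Cstar R) := open_setX oU (@open_Cstar R).

Definition fibre_coord x : C2 := (Phi x).2.
Local Notation phi := fibre_coord.

Lemma PhiE x : U (p x) -> Phi x = (p x, phi x).
Proof. by move=> /hPhi[<- _ _ _]; rewrite /fibre_coord -surjective_pairing. Qed.

Lemma PsiE x : U (p x) -> Psi (p x, phi x) = x.
Proof. by move=> Ux; rewrite -PhiE//; have [] := hPhi Ux. Qed.

Lemma fibre_coord_Cstar x : U (p x) -> Cstar (phi x).
Proof. by move=> /hPhi[]. Qed.

Lemma fibre_coord_act x z : U (p x) -> z != 0 ->
  phi (act z x) = ofC (z * toC (phi x)).
Proof. by move=> /hPhi[_ _ _ h] z0; rewrite -h// toCK. Qed.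

Lemma fibre_coord_smooth : fsmooth A (p @^-1` U) phi.
Proof.
have sid : fsmooth B setT (fun w : C2 => w).
  by apply/fsmooth_id_atlas => k; exact: (@Ck_lin_map _ _ _ _ _ idfun fC).
have s2 := fsmooth_snd cNb cB fNb fC fC openT sid.
have := fsmooth_comp cN cP fP fC oUN (open_setX openT openT) sPhi s2.
by apply: fsmooth_sub => x Ux; split.
Qed.

Lemma fibre_coord_map : smooth_map A B (p @^-1` U) phi.
Proof. exact: (smooth_map_id_atlas cN oUN fibre_coord_smooth). Qed.

Lemma act_Psi b w z : U b -> Cstar w -> z != 0 ->
  act z (Psi (b, w)) = Psi (b, ofC (z * toC w)).
Proof.
move=> Ub Cw z0; have [pPsi PhiPsi] := hPsi (y := (b, w)) Ub Cw.
have Ua : U (p (act z (Psi (b, w)))) by rewrite (p_act bundle)// pPsi.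
rewrite -[LHS](PsiE Ua) (p_act bundle)// pPsi fibre_coord_act ?pPsi//.
by rewrite /fibre_coord PhiPsi.
Qed.

Lemma section_smooth w : Cstar w -> smooth_map Ab A U (fun b => Psi (b, w)).
Proof.
move=> Cw; have s := smooth_map_pair cNb cNb cB fNb fC oU
  (smooth_map_sub (@subsetT _ U) (smooth_map_id Nb))
  (@smooth_map_cst _ _ _ _ _ Ab B U w).
by apply: (smooth_map_comp cNb cP cN fP fN oU oUC s sPsi).
Qed.

Lemma p_section w b : Cstar w -> U b -> p (Psi (b, w)) = b.
Proof. by move=> Cw Ub; have [] := hPsi (y := (b, w)) Ub Cw. Qed.

(** The horizontal lift for the flat connection of the trivialization: the vector is pushed along
    the local section of constant fibre coordinate through [x]. By [act_Psi] the action permutes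
    these sections, which makes the lift equivariant. *)
Definition local_lift x (v : tvec R Nb) : tvec R N :=
  dmap (fun b => Psi (b, phi x)) (p x) v.

Lemma local_lift_tangent x v : U (p x) -> tangent (p x) v ->
  tangent x (local_lift x v).
Proof.
move=> Ux tv; rewrite -{1}(PsiE Ux).
exact: (dmap_tangent oU (section_smooth (fibre_coord_Cstar Ux)) Ux tv).
Qed.

Lemma dmap_p_local_lift x v : U (p x) -> tangent (p x) v ->
  dmap p x (local_lift x v) = v.
Proof.
move=> Ux tv; rewrite -{1}(PsiE Ux) /local_lift.
rewrite (@dmap_comp _ _ _ _ _ _ _ setT (fun b => Psi (b, phi x)) p (p x) v
  openT I p_smooth).
rewrite (dmap_eq (G := fun b => b) oU Ux _ tv); first exact: dmap_id.
by move=> b Ub /=; exact: (p_section (fibre_coord_Cstar Ux) Ub).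
Qed.

Lemma local_lift_act x v z : U (p x) -> tangent (p x) v -> z != 0 ->
  local_lift (act z x) v = dmap (act z) x (local_lift x v).
Proof.
move=> Ux tv z0; rewrite -{2}(PsiE Ux) /local_lift.
rewrite (@dmap_comp _ _ _ _ _ _ _ setT (fun b => Psi (b, phi x)) (act z) (p x) v
  openT I (act_smooth bundle z0)).
rewrite (p_act bundle)// fibre_coord_act//.
apply: (dmap_eq oU Ux) => // b Ub /=.
by rewrite act_Psi//; exact: fibre_coord_Cstar.
Qed.

Lemma local_liftE x v (f : N -> R) : U (p x) -> smooth_near x f ->
  local_lift x v f = v (fun b => f (Psi (b, phi x))).
Proof. by move=> Ux sf; rewrite /local_lift /dmap PsiE// asboolT. Qed.

Lemma Psi_fun_smooth (V : set N) (f : N -> R) : open V -> smooth_on V f ->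
  open (U `*` @Cstar R `&` Psi @^-1` V) /\
  fsmooth (prod_atlas Ab B) (U `*` @Cstar R `&` Psi @^-1` V)
    (fun y => f (Psi y) : R^o).
Proof.
move=> oV sf; split.
  by apply: open_preimage_in => //; have [] := sPsi.
exact: (@fsmooth_comp _ _ _ _ _ R^o _ _ _ _ _ (f : _ -> R^o) cP cN fN fin_dim_R
  oUC oV sPsi sf).
Qed.

Lemma section_fun_smooth_near b w (f : N -> R) : U b -> Cstar w ->
  smooth_near (Psi (b, w)) f -> smooth_near b (fun b' => f (Psi (b', w))).
Proof. by move=> Ub Cw; apply: (smooth_near_comp oU (section_smooth Cw)). Qed.

Definition cmul_by (w z : C2) : C2 := ofC (toC z * toC w).

Lemma cmul_by_linear w : linear (cmul_by w).
Proof.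
case: w => w1 w2 k [a b] [c e].
transitivity (((k * a + c) * w1 - (k * b + e) * w2,
  (k * a + c) * w2 + (k * b + e) * w1) : C2); first by [].
transitivity ((k * (a * w1 - b * w2) + (c * w1 - e * w2),
  k * (a * w2 + b * w1) + (c * w2 + e * w1)) : C2); last by [].
by congr (_, _); ring.
Qed.

(** In the fibre coordinate the orbit map of [x] is multiplication by [phi x], so a fibre velocity
    [q] at [phi x] is the image of the Lie algebra element [q / phi x]. *)
Lemma vertical_derivative x (f : N -> R) (q : C2) : U (p x) ->
  smooth_near x f ->
  'D_q (fun w : C2 => f (Psi (p x, w)) : R^o) (phi x) =
  fundamental_vfield act (toC q / toC (phi x)) x f.
Proof.
move=> Ux sf; have [V [oV Vx] sV] := sf.
have Cw := fibre_coord_Cstar Ux.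
rewrite (fundE bundle _ sf).
have [oO _] := orbit_fun_smooth bundle x oV sV.
have eo : forall w, (Cstar `&` (fun w => act (toC w) x) @^-1` V) w ->
    f (act (toC w) x) = ((fun w : C2 => f (Psi (p x, w))) \o cmul_by (phi x)) w.
  by move=> w [w0 _] /=; rewrite -[in LHS](PsiE Ux) act_Psi.
have O1 : (Cstar `&` (fun w => act (toC w) x) @^-1` V) ((1, 0) : C2).
  by split; [exact: Cstar10|rewrite /= toC10 (act1 bundle)].
rewrite (eq_in_derive (F := R^o) _ oO O1 eo).
have e1 : cmul_by (phi x) (1, 0) = phi x by rewrite /cmul_by toC10 mul1r toCK.
have cc := linear_fin_dim_continuous fC (cmul_by_linear (phi x)).
pose L : {linear C2 -> C2} := HB.pack (cmul_by (phi x))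
  (GRing.isLinear.Build _ _ _ _ _ (cmul_by_linear (phi x))).
have dL : differentiable (cmul_by (phi x)) ((1, 0) : C2).
  exact: (@linear_differentiable _ _ _ L).
have dg : differentiable (fun w : C2 => f (Psi (p x, w)) : R^o) (phi x).
  have s := smooth_map_pair cB cNb cB fNb fC (@open_Cstar R)
    (@smooth_map_cst _ _ _ _ _ B Ab Cstar (p x)) (@smooth_map_id_C2 R Cstar).
  have [oK sK] := Psi_fun_smooth oV sV.
  have := fsmooth_comp cB cP fP fin_dim_R (@open_Cstar R) oK s sK.
  move=> /fsmooth_id_atlas/(_ 1%N)[+ _]; apply; split => //.
  by split => //=; rewrite PsiE.
have dg' : differentiable (fun w : C2 => f (Psi (p x, w)) : R^o)
    (cmul_by (phi x) (1, 0)) by rewrite e1.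
rewrite (derive_comp _ dL dg') e1; congr ('D_ _ _ _).
rewrite (deriveE _ dL) (@diff_lin _ _ _ L _ cc).
rewrite -[L _]/(ofC (toC (ofC (toC q / toC (phi x))) * toC (phi x))) ofCK.
by rewrite divfK// toCK.
Qed.

(** Near [x] one has $f(y)=f(\Psi(p(y),\varphi(y)))$. Splitting the derivative over the two slots,
    the base slot gives the lift of $p_*v$ and the fibre slot a fundamental vector. *)
Lemma tangent_decomp x v : U (p x) -> tangent x v ->
  exists l, v = local_lift x (dmap p x v) + fundamental_vfield act l x.
Proof.
move=> Ux tv; have [c [u [Ac Dx ev]]] := tv.
have Cw := fibre_coord_Cstar Ux.
pose q := 'D_u (phi \o cfrom c) (cto c x).
exists (toC q / toC (phi x)); apply/funext => f; rewrite !fctE.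
have [sf|nf] := pselect (smooth_near x f); last first.
  rewrite (tangent_out tv nf) fund_out// (tangent_out _ nf) ?addr0//.
  exact: local_lift_tangent Ux (p_tangent tv).
have [V [oV Vx] sV] := sf.
have [oK sK] := Psi_fun_smooth oV sV.
have Wx : (U `*` @Cstar R `&` Psi @^-1` V) (p x, phi x).
  by split => //=; rewrite PsiE.
rewrite (@tangent_eq _ _ _ _ x v f (fun y => f (Psi (p y, phi y))) oUN Ux _ tv);
  last by move=> y Uy; rewrite PsiE.
rewrite (@tangent_pair _ _ _ _ _ _ _ Ab B _ p phi _ (fun y => f (Psi y)) x v
  cNb cB fNb fC oUN oK (smooth_map_sub (@subsetT _ _) p_smooth) fibre_coord_map
  sK Ux Wx tv).
congr (_ + _).
  rewrite (local_liftE _ Ux sf) /dmap asboolT//.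
  by apply: section_fun_smooth_near => //; rewrite PsiE.
rewrite -(vertical_derivative _ Ux sf) ev.
have sn : smooth_near x (fun y => f (Psi (p x, phi y))).
  have cst_p := @smooth_map_cst _ _ _ _ _ A Ab (p @^-1` U) (p x).
  have spair := @smooth_on_pair _ _ _ _ _ _ _ Ab B cNb cB fNb fC (p @^-1` U)
    (fun=> p x) phi _ (fun y => f (Psi y)) oUN oK cst_p fibre_coord_map sK.
  apply: smooth_on_near spair; last by split.
  have sp := smooth_map_pair cN cNb cB fNb fC oUN cst_p fibre_coord_map.
  by apply: open_preimage_in => //; exact: sp.1.
rewrite (chart_vecE _ _ sn).
have dphi : differentiable (phi \o cfrom c) (cto c x).
  by have [+ _] := fibre_coord_smooth Ac 1%N; apply; exists x.
have ephi : (phi \o cfrom c) (cto c x) = phi x.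
  by have [_ _ ctoK _ _] := cN.1 c Ac; rewrite /= ctoK.
have dg : differentiable (fun w : C2 => f (Psi (p x, w)) : R^o)
    ((phi \o cfrom c) (cto c x)).
  rewrite ephi.
  have s := smooth_map_pair cB cNb cB fNb fC (@open_Cstar R)
    (@smooth_map_cst _ _ _ _ _ B Ab Cstar (p x)) (@smooth_map_id_C2 R Cstar).
  have := fsmooth_comp cB cP fP fin_dim_R (@open_Cstar R) oK s sK.
  by move=> /fsmooth_id_atlas/(_ 1%N)[+ _]; apply.
have := derive_comp u dphi dg; rewrite ephi; exact.
Qed.

(** The lift applied to [f] is $H\circ\Phi$ with $H(b,w)=X_b(f\circ\Psi(\cdot,w))$. This $H$ is a
    derivative of $f\circ\Psi$ in the base direction of the product and is therefore smooth jointly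
    in $b$ and $w$. *)
Lemma local_lift_vfield (U' : set Nb) (X : vfld R Nb) : open U' -> U' `<=` U ->
  vfield_on U' X ->
  vfield_on (p @^-1` U') (fun x => local_lift x (X (p x))).
Proof.
move=> oU' U'U vX; split=> [x U'x|V f oV VU' sf].
  by apply: local_lift_tangent; [exact: U'U|exact: vX.1].
have [oK sK] := Psi_fun_smooth oV sf.
pose W := (U `*` @Cstar R `&` Psi @^-1` V) `&` (U' `*` [set: C2]).
have oW : open W by apply: openI => //; exact: open_setX oU' openT.
pose H (y : Nb * C2) : R := X y.1 (fun b' => f (Psi (b', y.2))).
have sH : fsmooth (prod_atlas Ab B) W (H : _ -> R^o).
  apply: fsmooth_local => -[b w] [[[/= Ub Cw] Vbw] [/= U'b _]].
  have [c Ac Db] := cNb.2 b; have [oD _ ctoK _ _] := cNb.1 c Ac.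
  pose c2 : chart (Nb * C2)%type _ := prod_chart c (Chart setT idfun idfun).
  have Ac2 : prod_atlas Ab B c2 by exists (c, Chart setT idfun idfun).
  have oDT : open (cdom c2) by exact: open_setX oD openT.
  have oWD : open (W `&` cdom c2) by exact: openI.
  exists (W `&` cdom c2); first by [].
  have scto : fsmooth (prod_atlas Ab B) (cdom c2) (cto c2).
    apply: (fsmooth_prod_cto cNb cB fNb fC Ac (erefl _)); first exact: fsmooth_cto.
    by apply/fsmooth_id_atlas => k; exact: (@Ck_lin_map _ _ _ _ _ idfun fC).
  have sa : fsmooth (prod_atlas Ab B) (W `&` cdom c2)
      (fun y => (vcomp c X y.1, 0) : 'rV[R]_(m + m) * C2).
    have sv := fsmooth_fst cNb cB fNb fC fNb (openI oD oU') (fsmooth_vcomp Ac oU' vX).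
    apply: (fsmooth_pair cP) => //; last exact: fsmooth_cst.
    by apply: fsmooth_sub sv => -[b' w'] [[_ [? _]] [? _]].
  have sKD := fsmooth_sub (@subIsetl _ _ (U' `*` [set: C2])) sK.
  have := fsmooth_derive cP fP Ac2 scto oWD (@subIsetr _ _ _)
    (fsmooth_sub (@subIsetl _ _ _) sKD) sa.
  apply: (fsmooth_eq cP oWD) => -[b' w'] [[[[/= Ub' Cw'] Vbw'] [/= U'b' _]] [/= Db' _]].
  rewrite /H /= [in RHS](vcompE Ac Db' (vX.1 _ U'b')).
  have sn : smooth_near b' (fun b'' => f (Psi (b'', w'))).
    by apply: section_fun_smooth_near => //; exists V.
  rewrite (chart_vecE _ _ sn) -(derive_slice_l
    ((fun y => f (Psi y) : R^o) \o cfrom c2)).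
  by [].
have sHP := fsmooth_comp cN cP fP fin_dim_R oUN oW sPhi sH.
have sub : V `<=` (p @^-1` U `&` Phi @^-1` W).
  move=> x Vx; have U'x := VU' x Vx; have Ux : U (p x) := U'U _ U'x.
  split => //=; rewrite PhiE//; split; split => //=.
    by split => //; exact: fibre_coord_Cstar.
  by rewrite PsiE.
apply: (smooth_on_eq oV _ (fsmooth_sub sub sHP)) => x Vx.
have Ux : U (p x) by apply: U'U; exact: VU'.
by rewrite local_liftE//; [rewrite /H PhiE|exists V].
Qed.

End Trivialization.

(** * Horizontal lifts and the descended connection *)

Section PushforwardAlgebra.
Context {R : realType} {d d' : nat} {M : manifold R d} {M' : manifold R d'}.
Variables (F : M -> M') (x : M).

Lemma dmapD (v w : tvec R M) : dmap F x (v + w) = dmap F x v + dmap F x w.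
Proof. by have := dmap_lin F x 1 v w; rewrite !scale1r. Qed.

Lemma dmapZ k (v : tvec R M) : dmap F x (k *: v) = k *: dmap F x v.
Proof.
by apply/funext => g; rewrite !fctE /dmap; case: asboolP; rewrite ?scaler0.
Qed.

Lemma dmapN (v : tvec R M) : dmap F x (- v) = - dmap F x v.
Proof. by rewrite -scaleN1r dmapZ scaleN1r. Qed.

Lemma dmapE (v : tvec R M) g : smooth_near (F x) g -> dmap F x v g = v (g \o F).
Proof. by move=> sg; rewrite /dmap asboolT. Qed.

End PushforwardAlgebra.

Section ConicalBundle.
Context {R : realType} {n m : nat}.
Context {N : manifold R (n + n)} {Nb : manifold R (m + m)}.
Context {J : endo R N} {D : conn R N} {xi : vfld R N} {Jb : endo R Nb}.
Context {p : N -> Nb} {act : R[i] -> N -> N}.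
Hypothesis conical : conical_special_complex J D xi.
Hypothesis proj : projective_special_complex J xi Jb p act.
Local Notation C2 := (R^o * R^o)%type.
Local Notation B := (id_atlas C2).
Local Notation A := (atlas N).
Local Notation Ab := (atlas Nb).
Local Notation JF := (fapp J).
Local Notation eta := (JF xi).
Implicit Types (x : N) (z : R[i]) (b : Nb).

Let JN : complex_manifold J. Proof. by case: conical => -[]. Qed.
Let JNb : complex_manifold Jb. Proof. by case: proj. Qed.
Let bundle : principal_Cstar_bundle p act. Proof. by case: proj. Qed.
Let vxi : vfield xi := vfield_xi conical.
Let veta : vfield eta := vfield_eta conical.

Lemma fund1 : fundamental_vfield act 1 = xi. Proof. by case: proj. Qed.
Lemma fundi : fundamental_vfield act (Complex 0 1) = eta.
Proof. by case: proj. Qed.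

Lemma dmap_p_J x v : tangent x v -> dmap p x (J x v) = Jb (p x) (dmap p x v).
Proof. by case: proj => _ + _ _ _; apply. Qed.

Lemma dmap_p_xi x : dmap p x (xi x) = 0.
Proof. by rewrite -fund1 dmap_p_fund. Qed.

Lemma dmap_p_eta x : dmap p x (eta x) = 0.
Proof. by rewrite -fundi dmap_p_fund. Qed.

Lemma trivialization b : exists U Phi Psi, [/\ open_nbhs b U,
   smooth_map A (prod_atlas Ab B) (p @^-1` U) Phi,
   smooth_map (prod_atlas Ab B) A (U `*` @Cstar R) Psi,
   (forall x, U (p x) ->
     [/\ (Phi x).1 = p x, Cstar (Phi x).2, Psi (Phi x) = x &
      forall z, z != 0 -> toC (Phi (act z x)).2 = z * toC (Phi x).2]) &
   (forall y, U y.1 -> Cstar y.2 -> p (Psi y) = y.1 /\ Phi (Psi y) = y)].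
Proof. by case: bundle => _ _ _ _; apply. Qed.

(** The section is chosen point by point, without continuity. It serves only to name a point in each
    fibre; smoothness of what is built from it comes from [descend_smooth]. *)
Lemma p_surj : exists s : Nb -> N, forall b, p (s b) = b.
Proof.
suff /choice[s ps] : forall b, exists x, p x = b by exists s.
move=> b; have [U [Phi [Psi [[oU Ub] sPhi sPsi hPhi hPsi]]]] := trivialization b.
by exists (Psi (b, (1, 0))); have [] := hPsi (b, (1, 0)) Ub Cstar10.
Qed.

(** The required group element is the quotient of the two fibre coordinates. *)
Lemma fibre_orbit x x' : p x = p x' -> exists2 z, z != 0 & x' = act z x.
Proof.
move=> pxx'; have [U [Phi [Psi [[oU Ux] sPhi sPsi hPhi hPsi]]]] := trivialization (p x).
have Ux' : U (p x') by rewrite -pxx'.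
have [_ C1 _ _] := hPhi _ Ux; have [_ C2' _ _] := hPhi _ Ux'.
have z0 : toC (Phi x').2 / toC (Phi x).2 != 0 by rewrite mulf_neq0// invr_eq0.
exists (toC (Phi x').2 / toC (Phi x).2) => //.
have e z : z != 0 -> act z x = Psi (p x, ofC (z * toC (Phi x).2)).
  by move=> ?; rewrite -{1}(PsiE hPhi Ux) (act_Psi bundle hPhi hPsi).
by rewrite e// divfK// toCK pxx' (PsiE hPhi Ux').
Qed.

(** In [tangent_decomp] the lifted part is the lift of 0, so only the fundamental vector remains,
    and it is a combination of those of 1 and $\sqrt{-1}$. *)
Lemma vertical_span x v : tangent x v -> dmap p x v = 0 ->
  exists a b : R, v = a *: xi x + b *: eta x.
Proof.
move=> tv pv; have [U [Phi [Psi [[oU Ux] sPhi sPsi hPhi hPsi]]]] := trivialization (p x).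
have [[a b] ->] := tangent_decomp bundle oU sPhi sPsi hPhi hPsi Ux tv.
exists a, b; rewrite pv (fund_lin bundle) fund1 fundi.
rewrite (_ : local_lift (p := p) Phi Psi x 0 = 0) ?add0r//.
by apply/funext => f; rewrite /local_lift /dmap; case: asboolP.
Qed.

(** Invariance of [h] allows the arbitrary section [s] to be replaced locally by the smooth one of
    fibre coordinate 1. *)
Lemma descend_smooth (s : Nb -> N) (V : set Nb) (h : N -> R) :
  (forall b, p (s b) = b) -> open V -> smooth_on (p @^-1` V) h ->
  (forall x z, V (p x) -> z != 0 -> h (act z x) = h x) ->
  smooth_on V (h \o s).
Proof.
move=> ps oV sh ih; apply: smooth_on_local => b Vb.
have [U [Phi [Psi [[oU Ub] sPhi sPsi hPhi hPsi]]]] := trivialization b.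
exists (U `&` V) => //; have oUV : open (U `&` V) by exact: openI.
have sPsi1 := section_smooth oU sPsi (@Cstar10 R).
have oVN := open_preimage_p bundle oV.
apply: (smooth_on_eq oUV _ (smooth_on_sub _ (smooth_on_comp oU sPsi1 oVN sh))).
- move=> b' [Ub' Vb'] /=.
  have [z z0 ->] : exists2 z, z != 0 & s b' = act z (Psi (b', (1, 0))).
    by apply: fibre_orbit; rewrite ps (p_section hPsi)//; exact: Cstar10.
  by rewrite ih// (p_section hPsi)//; exact: Cstar10.
- move=> b' [Ub' Vb']; split => //=.
  by rewrite (p_section hPsi)//; exact: Cstar10.
Qed.

(** * Fields commuting with the fundamental fields descend to the base *)

Section Invariant.
Variable Z : vfld R N.
Hypotheses (vZ : vfield Z) (xiZ : lie xi Z = 0) (etaZ : lie eta Z = 0).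

(** For a fundamental field $T$ commuting with [Z], $T(Z(g\circ p))=Z(T(g\circ p))=0$ because $T$
    kills functions pulled back from the base. [orbit_const] integrates this along the orbits in the
    saturated set over [V]. *)
Lemma invariant_const (V : set Nb) (g : Nb -> R) x z : open V -> smooth_on V g ->
  V (p x) -> z != 0 -> Z (act z x) (g \o p) = Z x (g \o p).
Proof.
move=> oV sg Vx z0; have oW := open_preimage_p bundle oV.
have sgp := smooth_on_p bundle oV sg.
have step l X y : fundamental_vfield act l = X -> vfield X -> lie X Z = 0 ->
    V (p y) -> fundamental_vfield act l y (fun y => Z y (g \o p)) = 0.
  move=> eX vX lX Vy; rewrite eX.
  have sn : smooth_near y (g \o p) by exists (p @^-1` V).
  have := lieE X Z sn; rewrite lX => /esym/subr0_eq ->.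
  rewrite (@tangent_eq _ _ _ (p @^-1` V) y _ _ (fun=> 0) oW Vy _ (vZ.1 y I)).
    exact: (tangent_cst _ (vZ.1 y I)).
  move=> y' Vy'; rewrite -eX.
  have := dmap_p_fund bundle l y' => /(congr1 (fun v => v g)).
  by rewrite /dmap asboolT//; exists V.
apply: (orbit_const bundle (W := p @^-1` V) (h := fun y => Z y (g \o p))) => //.
- by move=> y w w0 Vy; rewrite /= (p_act bundle).
- by apply: vZ.2.
- by move=> y; apply: step fund1 _ _.
- by move=> y; apply: step fundi _ _.
Qed.

Lemma invariant_projects x z : z != 0 ->
  dmap p (act z x) (Z (act z x)) = dmap p x (Z x).
Proof.
move=> z0; apply/funext => g; rewrite /dmap (p_act bundle)//.
by case: asboolP => // -[V [oV Vx] sg]; exact: (invariant_const oV).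
Qed.

Lemma invariant_descends (s : Nb -> N) : (forall b, p (s b) = b) ->
  vfield (fun b => dmap p (s b) (Z (s b))) /\
  projects_to p Z (fun b => dmap p (s b) (Z (s b))).
Proof.
move=> ps; split; last first.
  move=> x; have [|z z0 ->] := @fibre_orbit x (s (p x)); first by rewrite ps.
  by rewrite invariant_projects.
split=> [b _|V g oV _ sg].
  by rewrite -{1}(ps b); apply: (p_tangent bundle); exact: vZ.1.
have sZ : smooth_on (p @^-1` V) (fun x => Z x (g \o p)).
  have oW := open_preimage_p bundle oV.
  by apply: vZ.2 => //; exact: (smooth_on_p bundle oV sg).
have inv x z : V (p x) -> z != 0 -> Z (act z x) (g \o p) = Z x (g \o p).
  exact: (invariant_const oV).
apply: (smooth_on_eq oV _ (descend_smooth ps oV sZ inv)) => b Vb.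
by rewrite /dmap asboolT//; exists V; rewrite // ps.
Qed.

End Invariant.

(** * Horizontal lifts with respect to a connection form *)

Section HorizontalLift.
Variable alpha : form1 R N.
Hypothesis calpha : principal_connection_form10 J act alpha.

Lemma form_lin x k v w : tangent x v -> tangent x w ->
  alpha x (k *: v + w) = k * alpha x v + alpha x w.
Proof. by case: calpha => -[+ _] _ _; apply. Qed.

Lemma form0 x : alpha x 0 = 0.
Proof.
have t0 := @tangent0 _ _ N x.
by have := form_lin (-1) t0 t0; rewrite scaler0 addr0 mulN1r addNr.
Qed.

Lemma formZ x k v : tangent x v -> alpha x (k *: v) = k * alpha x v.
Proof.
move=> tv; rewrite -[k *: v]addr0 form_lin ?form0 ?addr0//.
exact: tangent0.
Qed.

Let hat_fund l x : hat J alpha x (fundamental_vfield act l x) = l.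
Proof. by case: calpha. Qed.

Lemma form_xi x : alpha x (xi x) = 1.
Proof. by have := hat_fund 1 x; rewrite fund1 => -[]. Qed.

Lemma form_eta x : alpha x (eta x) = 0.
Proof. by have := hat_fund (Complex 0 1) x; rewrite fundi => -[]. Qed.

Lemma J_eta x : J x (eta x) = - xi x.
Proof. by apply: (J_J JN); exact: vxi.1. Qed.

Lemma hat_eq0 x v : hat J alpha x v = 0 <-> alpha x v = 0 /\ alpha x (J x v) = 0.
Proof.
rewrite /hat; split=> [[e1 /eqP]|[-> ->]]; last by rewrite oppr0.
by rewrite oppr_eq0 => /eqP.
Qed.

Lemma form_act x z v : z != 0 -> tangent x v ->
  alpha (act z x) (dmap (act z) x v) = alpha x v.
Proof. by move=> z0 tv; case: calpha => _ _ /(_ z x v z0 tv)[]. Qed.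

(* [hat J alpha x w] is $\alpha(w) - \sqrt{-1}\,\alpha(Jw)$, whence the signs. *)
Definition horizontal_part x (w : tvec R N) : tvec R N :=
  w - alpha x w *: xi x + alpha x (J x w) *: eta x.

Lemma horizontal_partP x w : tangent x w ->
  [/\ tangent x (horizontal_part x w), hat J alpha x (horizontal_part x w) = 0 &
      dmap p x (horizontal_part x w) = dmap p x w].
Proof.
move=> tw; have [txi teta] := (vxi.1 x I, veta.1 x I).
have tJw := J_tangent JN tw.
have e : horizontal_part x w =
    (- alpha x w) *: xi x + (alpha x (J x w) *: eta x + w).
  by rewrite /horizontal_part scaleNr addrAC addrC [w + _]addrC.
have t2 : tangent x (alpha x (J x w) *: eta x + w) by exact: tangent_lin.
rewrite e; split; first exact: tangent_lin.
  apply/hat_eq0; split.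
    by rewrite !form_lin// form_xi form_eta; ring.
  have tNxi : tangent x (- xi x) by rewrite -scaleN1r; exact: tangentZ.
  have -> : J x ((- alpha x w) *: xi x + (alpha x (J x w) *: eta x + w)) =
      (- alpha x w) *: eta x + (alpha x (J x w) *: (- xi x) + J x w).
    by rewrite !(J_lin JN)// J_eta.
  rewrite !form_lin//; last exact: tangent_lin.
  by rewrite -(scaleN1r (xi x)) formZ// form_xi form_eta; ring.
by rewrite !dmap_lin dmap_p_xi dmap_p_eta !scaler0 !add0r.
Qed.

(** The difference of two candidates is $a\xi+b\eta$. Evaluating $\alpha$ gives $a=0$; evaluating
    $\alpha\circ J$ gives $b=0$, because $J\eta=-\xi$. *)
Lemma horizontal_unique x v w : tangent x v -> tangent x w ->
  hat J alpha x v = 0 -> hat J alpha x w = 0 -> dmap p x v = dmap p x w -> v = w.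
Proof.
move=> tv tw /hat_eq0[v0 Jv0] /hat_eq0[w0 Jw0] e.
have [txi teta] := (vxi.1 x I, veta.1 x I).
have [tJv tJw] := (J_tangent JN tv, J_tangent JN tw).
have tvw : tangent x (-1 *: w + v) by exact: tangent_lin.
have [|a [b ab]] := vertical_span tvw.
  by rewrite dmap_lin e scaleN1r addNr.
have := form_lin (-1) tw tv; rewrite ab form_lin ?formZ//; last exact: tangentZ.
rewrite form_xi form_eta v0 w0 !mulr0 !addr0 mulr1 => a0.
have := congr1 (J x) ab; rewrite !(J_lin JN)//; last exact: tangentZ.
rewrite (J_Z JN)// J_eta a0 scale0r add0r => eJ.
have := form_lin (-1) tJw tJv; rewrite eJ formZ; last first.
  by rewrite -scaleN1r; exact: tangentZ.
rewrite -scaleN1r formZ// form_xi Jv0 Jw0 mulr0 addr0 mulr1 => /eqP.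
rewrite mulrN1 oppr_eq0 => /eqP b0.
by move: ab; rewrite a0 b0 !scale0r addr0 scaleN1r addrC => /subr0_eq.
Qed.

(** The pointwise form of [hlift]. Its linearity, compatibility with $J$ and equivariance all follow
    from [hvecE]: it suffices to exhibit a horizontal vector with the right projection. *)
Definition hvec x (u : tvec R Nb) : tvec R N :=
  xget (0 : tvec R N)
    [set v | [/\ tangent x v, hat J alpha x v = 0 & dmap p x v = u]].

Lemma hvecE x v : tangent x v -> hat J alpha x v = 0 -> hvec x (dmap p x v) = v.
Proof.
move=> tv hv; rewrite /hvec; case: xgetP => [w _ [tw hw pw]|/(_ v)[]//].
exact: (horizontal_unique tw tv hw hv pw).
Qed.

Lemma hvec_partE x w : tangent x w -> hvec x (dmap p x w) = horizontal_part x w.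
Proof. by move=> tw; have [t h <-] := horizontal_partP tw; exact: hvecE. Qed.

Lemma tangent_lift x u : tangent (p x) u -> exists2 w, tangent x w & dmap p x w = u.
Proof.
move=> tu; have [U [Phi [Psi [[oU Ux] sPhi sPsi hPhi hPsi]]]] := trivialization (p x).
exists (local_lift (p := p) Phi Psi x u).
  exact: (local_lift_tangent oU sPsi hPhi).
exact: (dmap_p_local_lift bundle oU hPhi hPsi).
Qed.

Lemma hvecP x u : tangent (p x) u ->
  [/\ tangent x (hvec x u), hat J alpha x (hvec x u) = 0 &
      dmap p x (hvec x u) = u].
Proof.
move=> /tangent_lift[w tw <-]; rewrite hvec_partE//.
exact: horizontal_partP.
Qed.

Lemma hvec_lin x k u u' : tangent (p x) u -> tangent (p x) u' ->
  hvec x (k *: u + u') = k *: hvec x u + hvec x u'.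
Proof.
move=> /hvecP[t h e] /hvecP[t' h' e'].
have [[a0 Ja0] [a0' Ja0']] := ((hat_eq0 _ _).1 h, (hat_eq0 _ _).1 h').
rewrite -{1}e -{1}e' -dmap_lin; apply: hvecE; first exact: tangent_lin.
have [tJ tJ'] := (J_tangent JN t, J_tangent JN t').
apply/hat_eq0; rewrite (J_lin JN)// !form_lin//.
by rewrite a0 a0' Ja0 Ja0' mulr0 addr0.
Qed.

Lemma hvec_J x u : tangent (p x) u -> hvec x (Jb (p x) u) = J x (hvec x u).
Proof.
move=> /hvecP[t h e]; have [a0 Ja0] := (hat_eq0 _ _).1 h.
rewrite -{1}e -dmap_p_J// hvecE//; first exact: (J_tangent JN).
apply/hat_eq0; split=> //; rewrite (J_J JN)//.
by rewrite -(scaleN1r (hvec x u)) formZ// a0 mulr0.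
Qed.

Lemma hvec_act x z u : z != 0 -> tangent (p x) u ->
  hvec (act z x) u = dmap (act z) x (hvec x u).
Proof.
move=> z0 /hvecP[t h e]; rewrite -{1}e -(dmap_p_act bundle x (hvec x u) z0) hvecE//.
  exact: (dmap_tangent openT (act_smooth bundle z0)).
by case: calpha => _ _ ->.
Qed.

Local Notation lift := (hlift J p alpha).

Lemma hliftE (X : vfld R Nb) x : lift X x = hvec x (X (p x)).
Proof. by []. Qed.

(** Over a trivializing set the lift is the horizontal part of the smooth field [local_lift], since
    any vector with the right projection has the same horizontal part. *)
Lemma hlift_vfield_on (U : set Nb) (X : vfld R Nb) : open U -> vfield_on U X ->
  vfield_on (p @^-1` U) (lift X).
Proof.
move=> oU vX; apply: vfield_on_local => x Ux.
have [V [Phi [Psi [[oV Vx] sPhi sPsi hPhi hPsi]]]] := trivialization (p x).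
have oVU : open (V `&` U) by exact: openI.
have oW := open_preimage_p bundle oVU.
exists (p @^-1` (V `&` U)) => //.
have vW : vfield_on (p @^-1` (V `&` U))
    (fun x => local_lift (p := p) Phi Psi x (X (p x))).
  have vXV : vfield_on (V `&` U) X by apply: vfield_on_sub vX => b [].
  by apply: (local_lift_vfield bundle oV sPhi sPsi hPhi oVU _ vXV) => b [].
have vJW := vfield_on_fapp JN oW vW.
have [[_ sform] _ _] := calpha.
pose lw x := local_lift (p := p) Phi Psi x (X (p x)).
have vH : vfield_on (p @^-1` (V `&` U)) (fun x =>
    lw x + (fscale (fun y => -1 * alpha y (lw y)) xi x +
    fscale (fun y => alpha y (JF lw y)) eta x)).
  apply: vfield_on_add => //; apply: vfield_on_add; apply: vfield_on_fscale.
  - apply: smooth_on_mul => //; [exact: smooth_on_cst|exact: sform].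
  - exact: (vfield_on_sub (@subsetT _ _) vxi).
  - exact: sform.
  - exact: (vfield_on_sub (@subsetT _ _) veta).
apply: (vfield_on_eq oW _ vH) => y [Vy Uy].
have tX := vX.1 _ Uy.
rewrite hliftE -(dmap_p_local_lift bundle oV hPhi hPsi Vy tX).
rewrite hvec_partE; last exact: (local_lift_tangent oV sPsi hPhi).
by rewrite /horizontal_part /fscale mulN1r scaleNr addrA.
Qed.

Lemma hlift_vfield X : vfield X -> vfield (lift X).
Proof. exact: (hlift_vfield_on openT). Qed.

Lemma hlift_projects X : vfield X -> projects_to p (lift X) X.
Proof. by move=> vX x; have [] := hvecP (vX.1 (p x) I). Qed.

Lemma hlift_invariant X z x : vfield X -> z != 0 ->
  lift X (act z x) = dmap (act z) x (lift X x).
Proof.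
move=> vX z0; rewrite !hliftE (p_act bundle)//.
by apply: hvec_act => //; exact: vX.1.
Qed.

Lemma lie_xi_hlift X : vfield X -> lie xi (lift X) = 0.
Proof.
move=> vX; rewrite -fund1; apply: (invariant_lie bundle).
- exact: hlift_vfield.
- by rewrite fund1.
- by move=> z x z0; exact: hlift_invariant.
Qed.

Lemma lie_eta_hlift X : vfield X -> lie eta (lift X) = 0.
Proof.
move=> vX; rewrite -fundi; apply: (invariant_lie bundle).
- exact: hlift_vfield.
- by rewrite fundi.
- by move=> z x z0; exact: hlift_invariant.
Qed.

Lemma hliftD X Y : vfield X -> vfield Y -> lift (X + Y) = lift X + lift Y.
Proof.
move=> vX vY; apply/funext => x; have [tX tY] := (vX.1 (p x) I, vY.1 (p x) I).
have := hvec_lin 1 tX tY; rewrite !scale1r; exact.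
Qed.

Lemma hlift_fscale f X : vfield X -> lift (fscale f X) = fscale (f \o p) (lift X).
Proof.
move=> vX; apply/funext => x; have tX := vX.1 (p x) I.
have t0 := @tangent0 _ _ Nb (p x).
have h0 : hvec x 0 = 0.
  have := hvec_lin (-1) t0 t0; rewrite scaler0 addr0 scaleN1r addNr; exact.
by rewrite hliftE /fscale -[f _ *: _]addr0 hvec_lin// h0 addr0.
Qed.

Lemma hlift_J X : vfield X -> lift (fapp Jb X) = JF (lift X).
Proof. by move=> vX; apply/funext => x; apply: hvec_J; exact: vX.1. Qed.

(** * The connection on the base *)

Section DescendedConnection.
Variable s : Nb -> N.
Hypothesis ps : forall b, p (s b) = b.
Local Notation nab := (nabla' J D).
Implicit Types X Y : vfld R Nb.

(** Evaluation at [s b] gives a total function. On vector fields it does not depend on [s]: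
    [descended_projects] gives the projection at every point of the fibre, and the axioms of a
    connection are checked at [s b] alone. *)
Definition descended : conn R Nb :=
  fun X Y b => dmap p (s b) (nab (lift X) (lift Y) (s b)).

Let cnab : connection nab := nabla'_connection conical.

Lemma nabla'_lift_vfield X Y : vfield X -> vfield Y ->
  vfield (nab (lift X) (lift Y)).
Proof. by move=> vX vY; apply: (conn_vfield cnab); exact: hlift_vfield. Qed.

Let descends X Y (vX : vfield X) (vY : vfield Y) :=
  invariant_descends (nabla'_lift_vfield vX vY)
    (lie_xi_nabla' conical (hlift_vfield vX) (hlift_vfield vY)
      (lie_xi_hlift vX) (lie_xi_hlift vY))
    (lie_eta_nabla' conical (hlift_vfield vX) (hlift_vfield vY)
      (lie_eta_hlift vX) (lie_eta_hlift vY)) ps.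

Lemma descended_vfield X Y : vfield X -> vfield Y -> vfield (descended X Y).
Proof. by move=> vX vY; have [] := descends vX vY. Qed.

Lemma descended_projects X Y : vfield X -> vfield Y ->
  projects_to p (nab (lift X) (lift Y)) (descended X Y).
Proof. by move=> vX vY; have [] := descends vX vY. Qed.

Lemma smooth_on_setT_p (f : Nb -> R) : smooth_on setT f -> smooth_on setT (f \o p).
Proof. exact: (smooth_on_p bundle openT). Qed.

Lemma hlift_comp_p X f x : vfield X -> smooth_on setT f ->
  lift X x (f \o p) = X (p x) f.
Proof.
move=> vX sf; rewrite -(hlift_projects vX x) dmapE//.
by exists setT => //; split=> //; exact: openT.
Qed.

Lemma descended_connection : connection descended.
Proof.
have vl := hlift_vfield.
have [_ h2 h3 h4 h5] := cnab.
split.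
- exact: descended_vfield.
- move=> X Y Z vX vY vZ; apply/funext => b.
  rewrite /descended hliftD// h2; try exact: vl.
  exact: dmapD.
- move=> f X Y sf vX vY; apply/funext => b.
  rewrite /descended hlift_fscale// h3//; try by [exact: vl|exact: smooth_on_setT_p].
  by rewrite {1}/fscale dmapZ /= ps.
- move=> X Y Z vX vY vZ; apply/funext => b.
  rewrite /descended hliftD// h4; try exact: vl.
  exact: dmapD.
- move=> f X Y sf vX vY; apply/funext => b.
  rewrite /descended hlift_fscale// h5//; try by [exact: vl|exact: smooth_on_setT_p].
  rewrite (_ : (fscale _ (lift Y) + _) (s b) = lift X (s b) (f \o p) *: lift Y (s b)
     + (f \o p) (s b) *: nab (lift X) (lift Y) (s b))//.
  by rewrite dmapD !dmapZ hlift_comp_p// (hlift_projects vY) /= ps.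
Qed.

(** If [Y] and [Y'] project to [X1] and [X1'], then $Y'(g\circ p)=(X_1'g)\circ p$ near [x], so each
    second-order term of the bracket upstairs is the corresponding term downstairs. *)
Lemma lie_projects (Z Z' : vfld R N) X X' : vfield Z -> vfield Z' ->
  vfield X -> vfield X' -> projects_to p Z X -> projects_to p Z' X' ->
  projects_to p (lie Z Z') (lie X X').
Proof.
move=> vZ vZ' vX vX' pZ pZ' x; apply/funext => g.
have [sg|ng] := pselect (smooth_near (p x) g); last first.
  by rewrite /dmap /lie !asboolF.
rewrite dmapE// !lieE//; last exact: (smooth_near_p bundle).
have [V [oV Vx] sV] := sg; have oW := open_preimage_p bundle oV.
have step (Y Y' : vfld R N) (X1 X1' : vfld R Nb) : vfield Y -> vfield X1' ->
    projects_to p Y X1 -> projects_to p Y' X1' ->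
    Y x (fun y => Y' y (g \o p)) = X1 (p x) (fun b => X1' b g).
  move=> vY vX1' pY pY'.
  rewrite (@tangent_eq _ _ _ (p @^-1` V) x _ _ ((fun b => X1' b g) \o p) oW Vx _
    (vY.1 x I)); last first.
    by move=> y Vy /=; rewrite -pY' dmapE//; exists V.
  by rewrite -(pY x) dmapE//; exists V => //; apply: vX1'.2.
by rewrite (step Z Z' X X')// (step Z' Z X' X).
Qed.

Lemma descended_torsion_free : torsion_free descended.
Proof.
move=> X Y vX vY; apply/funext => b.
have [vlX vlY] := (hlift_vfield vX, hlift_vfield vY).
have := lie_projects vlX vlY vX vY (hlift_projects vX) (hlift_projects vY) (s b).
rewrite ps => <-; rewrite -(nabla'_torsion_free conical)//.
by apply/esym; rewrite [LHS]dmapD dmapN.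
Qed.

Lemma descended_complex X Y : vfield X -> vfield Y ->
  nabla_endo descended Jb X Y = 0.
Proof.
move=> vX vY; apply/funext => b.
have [vlX vlY] := (hlift_vfield vX, hlift_vfield vY).
have vn := nabla'_lift_vfield vX vY.
have := nabla'_complex conical vlX vlY => /subr0_eq e.
rewrite /nabla_endo (_ : (_ - _) b = descended X (fapp Jb Y) b -
  Jb b (descended X Y b))//.
rewrite /descended hlift_J// e -[b in Jb b _]ps -dmap_p_J; last exact: vn.1.
exact: subrr.
Qed.

Lemma descended_torsion_free_complex : torsion_free_complex Jb descended.
Proof.
split; [exact: descended_connection|exact: descended_torsion_free|].
exact: descended_complex.
Qed.

End DescendedConnection.

End HorizontalLift.

(** * Dependence on the connection form *)

Section ChangeOfForm.
Variables alpha beta : form1 R N.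
Hypothesis calpha : principal_connection_form10 J act alpha.
Hypothesis cbeta : principal_connection_form10 J act beta.
Variable s : Nb -> N.
Hypothesis ps : forall b, p (s b) = b.
Local Notation nab := (nabla' J D).
Local Notation la := (hlift J p alpha).
Local Notation lb := (hlift J p beta).
Implicit Types X Y : vfld R Nb.

(** The sign makes this form itself the witness for [cproj_related]: it is $-\theta$ in the notation
    of the overview. Since [beta] and the lift are both invariant, any other point of the fibre
    gives the same value, see [form_diffE]. *)
Definition form_diff : form1 R Nb := fun b u => - beta (s b) (hvec alpha (s b) u).

Lemma beta_lift_smooth (U : set Nb) X : open U -> vfield_on U X ->
  smooth_on (p @^-1` U) (fun x => beta x (la X x)).
Proof.
move=> oU vX; case: cbeta => -[_ sb] _ _; apply: sb.
  exact: (open_preimage_p bundle oU).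
exact: (hlift_vfield_on calpha oU vX).
Qed.

Lemma beta_lift_act x z u : z != 0 -> tangent (p x) u ->
  beta (act z x) (hvec alpha (act z x) u) = beta x (hvec alpha x u).
Proof.
move=> z0 tu; rewrite (hvec_act calpha)// (form_act cbeta)//.
by have [] := hvecP calpha tu.
Qed.

Lemma form_diffE x u : tangent (p x) u ->
  form_diff (p x) u = - beta x (hvec alpha x u).
Proof.
move=> tu; rewrite /form_diff; have [|z z0 ->] := @fibre_orbit x (s (p x)).
  by rewrite ps.
by rewrite beta_lift_act.
Qed.

Lemma form_diff_one_form : one_form form_diff.
Proof.
split=> [b u v k tu tv|U X oU vX].
  have ts w : tangent b w -> tangent (p (s b)) w by rewrite ps.
  rewrite /form_diff (hvec_lin calpha)//; try exact: ts.
  have [t1 _ _] := hvecP calpha (ts _ tu); have [t2 _ _] := hvecP calpha (ts _ tv).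
  by rewrite (form_lin cbeta)//; ring.
have inv x z : U (p x) -> z != 0 ->
    (beta (act z x) (la X (act z x)) = beta x (la X x)).
  move=> Ux z0; rewrite !hliftE (p_act bundle)// beta_lift_act//.
  exact: vX.1.
have := smooth_on_mul oU (smooth_on_cst U (-1))
  (descend_smooth ps oU (beta_lift_smooth oU vX) inv).
apply: smooth_on_eq => // b Ub /=.
by rewrite mulN1r /form_diff hliftE ps.
Qed.

Local Notation theta X := (feval form_diff X \o p).

Lemma hlift_change X : vfield X ->
  lb X = la X + fscale (theta X) xi - fscale (theta (fapp Jb X)) eta.
Proof.
move=> vX; apply/funext => x; have tX := vX.1 (p x) I.
have [t h e] := hvecP calpha tX.
rewrite hliftE -{1}e (hvec_partE cbeta)//.
rewrite (_ : (_ - _) x = la X x + theta X x *: xi x -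
  theta (fapp Jb X) x *: eta x)//.
rewrite /= /feval !form_diffE//; last exact: (J_tangent JNb).
rewrite /fapp (hvec_J calpha)// -hliftE /horizontal_part.
by rewrite !scaleNr opprK.
Qed.

Lemma theta_smooth X : vfield X -> smooth_on setT (theta X).
Proof.
move=> vX; apply: (smooth_on_setT_p); have [_ h] := form_diff_one_form.
by apply: h => //; exact: openT.
Qed.

Lemma descended_change : cproj_related Jb (descended beta s) (descended alpha s).
Proof.
exists form_diff; first exact: form_diff_one_form.
move=> X Y vX vY; apply/funext => b; pose x := s b.
have cn := nabla'_connection conical.
have vJ := vfield_fapp JNb.
have [vJX vJY] := (vJ _ vX, vJ _ vY).
have vla := hlift_vfield calpha; have vlb := hlift_vfield cbeta.
have vf f Z : smooth_on setT f -> vfield Z -> vfield (fscale f Z).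
  by move=> sf vZ; exact: vfield_on_fscale.
have [sX sY] := (theta_smooth vX, theta_smooth vY).
have [sJX sJY] := (theta_smooth vJX, theta_smooth vJY).
have [_ _ h3 _ h5] := cn.
(* The second argument is expanded first, with [lb X] left whole: $\nabla'_Z\xi=Z$ and
   $\nabla'_Z\eta=JZ$ hold for every field $Z$, and [lb X] projects to [X] just as [la X] does. The
   derivatives of the coefficients only multiply $\xi$ and $\eta$, which [p] kills. *)
have e1 : nab (lb X) (lb Y) = nab (lb X) (la Y)
    + (fscale (fun x => lb X x (theta Y)) xi + fscale (theta Y) (lb X))
    - (fscale (fun x => lb X x (theta (fapp Jb Y))) eta +
       fscale (theta (fapp Jb Y)) (JF (lb X))).
  rewrite (hlift_change vY).
  rewrite (connBr cn); [|exact: vlb| |exact: vf]; last first.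
    by apply: vfieldD; [exact: vla|exact: vf].
  rewrite (connDr cn); [|exact: vlb|exact: vla|exact: vf].
  rewrite !h5//; try exact: vlb.
  by rewrite (nabla'_xi conical) ?(nabla'_eta conical)//; exact: vlb.
(* In the first argument the coefficients come out undifferentiated. Here $\nabla'_\xi$ and
   $\nabla'_\eta$ are evaluated on [la Y], which needs [la Y] to commute with both fields. *)
have e2 : nab (lb X) (la Y) = nab (la X) (la Y) + fscale (theta X) (la Y)
    - fscale (theta (fapp Jb X)) (JF (la Y)).
  rewrite (hlift_change vX).
  have vN : vfield (- fscale (theta (fapp Jb X)) eta) by apply: vfieldN; exact: vf.
  have vXi : vfield (fscale (theta X) xi) by exact: vf.
  rewrite (connDl cn) ?(connDl cn)//; try by [exact: vla|apply: vfieldD => //; exact: vla].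
  rewrite (connNl cn); [|exact: vf|exact: vla].
  rewrite !h3//; try exact: vla.
  rewrite (xi_nabla' conical); [|exact: vla|exact: (lie_xi_hlift calpha)].
  by rewrite (eta_nabla' conical); [|exact: vla|exact: (lie_eta_hlift calpha)].
have pa Z : vfield Z -> dmap p x (la Z x) = Z b.
  by move=> vZ; rewrite (hlift_projects calpha vZ) ps.
have pb Z : vfield Z -> dmap p x (lb Z x) = Z b.
  by move=> vZ; rewrite (hlift_projects cbeta vZ) ps.
have pJ Z : vfield Z -> dmap p x (J x (Z x)) = Jb b (dmap p x (Z x)).
  by move=> vZ; rewrite dmap_p_J ?ps//; exact: vZ.1.
rewrite (_ : (_ - _) b = dmap p x (nab (la X) (la Y) x) + feval form_diff X b *: Y b
  + feval form_diff Y b *: X b - feval form_diff (fapp Jb X) b *: Jb b (Y b)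
  - feval form_diff (fapp Jb Y) b *: Jb b (X b))//.
rewrite {1}/descended -/x; move: e1; rewrite e2.
move: (nab (lb X) (lb Y)) (nab (la X) (la Y)) => nb na ->.
rewrite (_ : (_ - _) x =
  na x + theta X x *: la Y x - theta (fapp Jb X) x *: J x (la Y x)
  + (lb X x (theta Y) *: xi x + theta Y x *: lb X x)
  - (lb X x (theta (fapp Jb Y)) *: eta x +
     theta (fapp Jb Y) x *: J x (lb X x)))//.
rewrite !(dmapD, dmapN, dmapZ) dmap_p_xi dmap_p_eta !scaler0 !add0r.
rewrite (pJ (la Y) (vla _ vY)) (pJ (lb X) (vlb _ vX)).
rewrite !pa// !pb// /= ps.
by congr (_ - _); rewrite addrAC.
Qed.

End ChangeOfForm.

End ConicalBundle.

(** * Existence of a connection form *)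

(** The bump of a chart is extended by 0. The Hausdorff property makes the compact support closed in
    the whole manifold, so its complement is an open set on which the extension vanishes
    identically; this gives smoothness outside the chart. *)
Lemma manifold_bump (R : realType) d (M : manifold R d) (b : M) (O : set M) :
  open_nbhs b O ->
  exists (chi : M -> R) (W K : set M),
    [/\ smooth_on setT chi, open_nbhs b W & forall y, W y -> chi y = 1] /\
    [/\ closed K, K `<=` O & forall y, ~ K y -> chi y = 0].
Proof.
move=> [oO Ob]; have cM := covering_atlas M.
have [c Ac Db] := cM.2 b; have cc := cM.1 c Ac.
have [oD oI ctoK cto_c cfrom_c] := cc.
have [|psi [W0 [K0 [[spsi [oW0 W0b] psi1] [cK0 K0O psi0]]]]] :=
    @smooth_bump R d (cto c b) (cto c @` (cdom c `&` O)).
  by split; [exact: chart_image_open|exists b].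
pose K := cfrom c @` K0.
have KD : K `<=` cdom c `&` O.
  by move=> _ [u /K0O[y [Dy Oy] <-] <-]; rewrite ctoK.
have cK : closed K.
  apply: compact_closed; first exact: manifold_hausdorff.
  apply: continuous_compact cK0; apply: continuous_in_subspaceT => u.
  by rewrite inE => /K0O[y [Dy _] <-]; exact: cfrom_c.
pose chi (y : M) : R := if pselect (cdom c y) then psi (cto c y) else 0.
have chi_in y : cdom c y -> chi y = psi (cto c y).
  by rewrite /chi; case: pselect.
have chi_out y : ~ K y -> chi y = 0.
  rewrite /chi; case: pselect => // Dy nKy; apply: psi0 => K0y; apply: nKy.
  by exists (cto c y) => //; rewrite ctoK.
exists chi, (cdom c `&` cto c @^-1` W0), K; split; split=> //.
- apply: smooth_on_local => y _.
  have [Dy|nDy] := pselect (cdom c y).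
    exists (cdom c) => //.
    have s1 := @fsmooth_post _ _ _ _ cM _ _ (cdom c) setT (cto c) psi
      (fin_dim_rV d) fin_dim_R oD openT (fun _ _ => I) (fsmooth_cto Ac) spsi.
    by apply: smooth_on_eq oD _ s1 => z Dz; rewrite chi_in.
  exists (~` K) => //; first by move=> /KD[].
  apply: (smooth_on_eq (f := fun=> 0)); first exact: closed_openC.
    by move=> z nKz; rewrite chi_out.
  exact: smooth_on_cst.
- by split=> //; apply: open_preimage_in.
- by move=> y [Dy W0y]; rewrite chi_in// psi1.
- by move=> y /KD[].
Qed.

(** * The logarithm of the modulus *)

Section SquaredModulus.
Context {R : realType}.
Local Notation C2 := (R^o * R^o)%type.

Definition sqmod (w : C2) : R := w.1 * w.1 + w.2 * w.2.

Lemma sqmod_gt0 w : Cstar w -> 0 < sqmod w.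
Proof.
case: w => a b; rewrite /Cstar /sqmod /= /toC eq_complex /= => h.
by rewrite -!expr2 lt0r addr_ge0 ?sqr_ge0// andbT paddr_eq0 ?sqr_ge0// !sqrf_eq0.
Qed.

Lemma sqmodM (z w : R[i]) : sqmod (ofC (z * w)) = sqmod (ofC z) * sqmod (ofC w).
Proof. by case: z => a b; case: w => c e; rewrite /sqmod /=; ring. Qed.

Lemma sqmod_cexp (a b : R) : sqmod (ofC (cexp (Complex a b))) = expR (a + a).
Proof.
rewrite /sqmod /= expRD -[RHS]mulr1 -(cos2Dsin2 b); ring.
Qed.

(** This is $\log|w|$, written through the squared modulus to avoid the square root. It is a
    homomorphism to the additive reals, so its differential in the fibre coordinate is invariant
    under the action. *)
Definition log_mod (w : C2) : R := 2^-1 * ln (sqmod w).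

Lemma log_modM z w : z != 0 -> Cstar w ->
  log_mod (ofC (z * toC w)) = log_mod w + log_mod (ofC z).
Proof.
move=> z0 Cw; rewrite /log_mod sqmodM toCK lnM ?posrE.
- by rewrite mulrDr addrC.
- exact/sqmod_gt0/Cstar_ofC.
- exact: sqmod_gt0.
Qed.

Lemma log_mod_cexp (a b : R) : log_mod (ofC (cexp (Complex a b))) = a.
Proof. by rewrite /log_mod sqmod_cexp expRK; field. Qed.

Lemma log_mod_smooth : smooth (@Cstar R) (log_mod : C2 -> R^o).
Proof.
move=> k; have fC := @fin_dim_C2 R; have oC := @open_Cstar R.
have c1 : Ck k Cstar (fun w : C2 => w.1 : R^o).
  by apply: Ck_lin_map => // a x y.
have c2 : Ck k Cstar (fun w : C2 => w.2 : R^o).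
  by apply: Ck_lin_map => // a x y.
have cs : Ck k Cstar (sqmod : C2 -> R^o).
  by apply: Ck_add => //; exact: Ck_mul.
apply: Ck_mul => //; first exact: Ck_cst.
exact: (@Ck_comp_real _ k _ _ Cstar [set t : R^o | 0 < t] sqmod (@ln R)
  fin_dim_R oC (@open_gt R 0) sqmod_gt0 cs (Ck_ln k)).
Qed.

End SquaredModulus.

(** * Local connection forms and their gluing *)

Section FormExistence.
Context {R : realType} {n m : nat}.
Context {N : manifold R (n + n)} {Nb : manifold R (m + m)}.
Context {J : endo R N} {D : conn R N} {xi : vfld R N} {Jb : endo R Nb}.
Context {p : N -> Nb} {act : R[i] -> N -> N}.
Hypothesis conical : conical_special_complex J D xi.
Hypothesis proj : projective_special_complex J xi Jb p act.
Local Notation C2 := (R^o * R^o)%type.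
Local Notation B := (id_atlas C2).
Local Notation A := (atlas N).
Local Notation Ab := (atlas Nb).
Local Notation JF := (fapp J).
Local Notation eta := (JF xi).
Implicit Types (x : N) (z : R[i]) (b : Nb).

Let JN : complex_manifold J. Proof. by case: conical => -[]. Qed.
Let bundle : principal_Cstar_bundle p act. Proof. by case: proj. Qed.
Let vxi : vfield xi := vfield_xi conical.
Let veta : vfield eta := vfield_eta conical.

(* Such [gamma] behaves like [chi \o p] times a connection form; unlike
   connection forms, these can be cut off and added. *)
Definition scaled_form (chi : Nb -> R) (gamma : form1 R N) : Prop :=
  [/\ smooth_on setT chi, one_form gamma,
      (forall x, gamma x (xi x) = chi (p x) /\ gamma x (eta x) = 0),
      (forall x v z, z != 0 -> tangent x v ->
        gamma (act z x) (dmap (act z) x v) = gamma x v) &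
      (forall x v z, z != 0 -> tangent x v ->
        gamma (act z x) (J (act z x) (dmap (act z) x v)) = gamma x (J x v))].

(** Normalization on $\xi$ and $\eta$ determines the complex form on all fundamental vectors:
    $J(a\xi+b\eta)=a\eta-b\xi$, whence $\gamma-\sqrt{-1}\,\gamma\circ J$ takes the value
    $a+\sqrt{-1}\,b$. *)
Lemma scaled_form1 gamma :
  scaled_form (fun=> 1) gamma -> principal_connection_form10 J act gamma.
Proof.
move=> [_ og gv g1 g2]; split=> // [[a b] x|z x v z0 tv]; last first.
  by rewrite /hat g1// g2.
have [txi teta] := (vxi.1 x I, veta.1 x I); have [e1 e2] := gv x.
have t0 := @tangent0 _ _ N x.
have gl := og.1 x.
have tNxi : tangent x (- xi x) by rewrite -scaleN1r; exact: tangentZ.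
have g0 : gamma x 0 = 0.
  by have := gl _ _ (-1) t0 t0; rewrite scaler0 addr0 mulN1r addNr.
have gb : gamma x (b *: eta x) = 0.
  by rewrite -[b *: _]addr0 gl// e2 mulr0 add0r.
rewrite (fund_lin bundle) (fund1 proj) (fundi proj) /hat.
have -> : J x (a *: xi x + b *: eta x) = a *: eta x + b *: (- xi x).
  rewrite (J_lin JN)//; last exact: tangentZ.
  by rewrite (J_Z JN)// (J_J JN).
rewrite !gl//; try exact: tangentZ.
rewrite gb e1 e2 mulr1 addr0 mulr0 add0r.
have -> : b *: (- xi x) = (- b) *: xi x + 0 by rewrite addr0 scalerN scaleNr.
by rewrite gl// e1 g0 mulr1 addr0 opprK.
Qed.

Lemma scaled_form0 : scaled_form (fun=> 0) (fun _ _ => 0).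
Proof.
split=> //; first exact: smooth_on_cst.
split=> [x v w k _ _|U X _ _]; first by rewrite mulr0 addr0.
exact: smooth_on_cst.
Qed.

Lemma scaled_form_add chi gamma chi' gamma' c : scaled_form chi gamma ->
  scaled_form chi' gamma' -> smooth_on setT c ->
  scaled_form (fun b => chi b + c b * chi' b)
    (fun x v => gamma x v + c (p x) * gamma' x v).
Proof.
move=> [sc [ol os] gv g1 g2] [sc' [ol' os'] gv' g1' g2'] s_c.
have oT := @openT Nb; have oTN := @openT N; split.
- by apply: smooth_on_add => //; exact: smooth_on_mul.
- split=> [x v w k tv tw|U X oU vX].
    by rewrite ol// ol'//; ring.
  apply: smooth_on_add => //; first exact: os.
  apply: smooth_on_mul => //; last exact: os'.
  by apply: smooth_on_sub (smooth_on_p bundle oT s_c).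
- by move=> x; have [-> ->] := gv x; have [-> ->] := gv' x; rewrite mulr0 addr0.
- by move=> x v z z0 tv; rewrite (p_act bundle)// g1// g1'.
- by move=> x v z z0 tv; rewrite (p_act bundle)// g2// g2'.
Qed.

(* Tested on invariant fields, the infinitesimal identities $L_\xi J = 0$ and
   $L_{J\xi} J = 0$ become invariance of [J] along the orbits. *)
Lemma invariant_extension x v : tangent x v -> exists V : vfld R N,
  [/\ vfield V, V x = v &
      forall z y, z != 0 -> V (act z y) = dmap (act z) y (V y)].
Proof.
move=> tv; have [U [Phi [Psi [[oU Ux] sPhi sPsi hPhi hPsi]]]] :=
  trivialization proj (p x).
have [[l1 l2] ev] := tangent_decomp bundle oU sPhi sPsi hPhi hPsi Ux tv.
have tpv := p_tangent bundle tv.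
have cNb := covering_atlas Nb.
have [c Ac Dx] := cNb.2 (p x); have [oD _ _ _ _] := cNb.1 c Ac.
have [u eu] := tangent_chartP Ac Dx tpv.
have oUD : open (U `&` cdom c) by exact: openI.
have [|chi [W [K [[schi [oW Wx] chi1] [cK KU chi0]]]]] :=
  @manifold_bump _ _ Nb (p x) (U `&` cdom c); first by split.
pose X b := chart_vec c b u.
pose lw y := local_lift (p := p) Phi Psi y (X (p y)).
have vlw : vfield_on (p @^-1` (U `&` cdom c)) lw.
  apply: (local_lift_vfield bundle oU sPhi sPsi hPhi oUD (@subIsetl _ _ _)).
  apply: (vfield_on_chart (c := c) (a := fun=> u) Ac oUD (@subIsetr _ _ _)) => //.
  exact: fsmooth_cst.
have schip := smooth_on_p bundle (@openT Nb) schi.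
have vL : vfield (fscale (chi \o p) lw).
  apply: vfield_on_local => y _.
  have [Uy|nUy] := pselect ((U `&` cdom c) (p y)).
    exists (p @^-1` (U `&` cdom c)).
      by split=> //; exact: (open_preimage_p bundle).
    by apply: vfield_on_fscale => //; exact: smooth_on_sub schip.
  have oKc : open (p @^-1` (~` K)).
    by apply: (open_preimage_p bundle); exact: closed_openC.
  exists (p @^-1` (~` K)); first by split=> // /KU.
  apply: (vfield_on_eq oKc _ (vfield_on0 _)) => y' nK.
  by rewrite /fscale /= chi0// scale0r.
(* The base part of [v] is extended with constant coordinates in a chart, lifted locally and cut off
   by a function of the base, so that invariance survives. The vertical part is extended by the same
   constant combination of $\xi$ and $\eta$, which are invariant because the group is abelian. *)
exists (fun y => fscale (chi \o p) lw y + (fscale (fun=> l1) xi y +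
  fscale (fun=> l2) eta y)); split.
- apply: vfield_on_add => //; apply: vfield_on_add;
    by apply: vfield_on_fscale => //; exact: smooth_on_cst.
- rewrite ev (fund_lin bundle) (fund1 proj) (fundi proj) eu /fscale /=.
  by rewrite chi1// scale1r.
- move=> z y z0; rewrite /fscale /= !dmapD !dmapZ (p_act bundle)//.
  rewrite -(fundi proj) -(fund1 proj) !(dmap_act_fund bundle)//; congr (_ + _).
  have [Ky|nKy] := pselect (K (p y)); last by rewrite chi0// !scale0r.
  have [Uy Dy] := KU _ Ky; congr (_ *: _).
  rewrite /lw (p_act bundle)//.
  by apply: (local_lift_act bundle oU hPhi hPsi) => //; exact: tangent_chart_vec.
Qed.

(** The form is $\chi\cdot d\log|w|$ for the fibre coordinate $w$. Under the action $\log|w|$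
    changes by an additive constant, which gives the invariance of its differential. *)
Lemma local_form b : exists chi gamma W,
  [/\ scaled_form chi gamma, open_nbhs b W & forall y, W y -> chi y = 1].
Proof.
have [U [Phi [Psi [[oU Ub] sPhi sPsi hPhi hPsi]]]] := trivialization proj b.
have [|chi [W [K [[schi oWb chi1] [cK KU chi0]]]]] :=
  @manifold_bump _ _ Nb b U; first by split.
have oW := open_preimage_p bundle oU.
pose phi := fibre_coord Phi.
pose ell x := log_mod (phi x).
have s_ell : smooth_on (p @^-1` U) ell.
  exact: (@fsmooth_post _ _ _ _ (covering_atlas N) C2 R^o (p @^-1` U) Cstar phi
    (log_mod : _ -> R^o) (@fin_dim_C2 R) fin_dim_R oW (@open_Cstar R)
    (fun x Ux => fibre_coord_Cstar hPhi Ux) (fibre_coord_smooth bundle oU sPhi)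
    (@log_mod_smooth R)).
have ell_near x : U (p x) -> smooth_near x ell by exists (p @^-1` U).
have ell_act x z : U (p x) -> z != 0 -> ell (act z x) = ell x + log_mod (ofC z).
  move=> Ux z0; rewrite /ell /phi (fibre_coord_act hPhi)// log_modM//.
  exact: (fibre_coord_Cstar hPhi).
(* Along the orbit $\log|e^{tl}w|=\log|w|+t\,\mathrm{Re}\,l$. The values on $\xi$ and $\eta$ are
   thus 1 and 0, and these derivatives are constant. *)
have fund_ell l x : U (p x) -> fundamental_vfield act l x ell = complex.Re l.
  case: l => a c Ux; rewrite /fundamental_vfield asboolT; last exact: ell_near.
  rewrite (_ : (fun t => _) = (fun t : R => ell x + t * a : R^o)); last first.
    apply/funext => t; rewrite ell_act ?cexp_neq0//.
    rewrite (_ : Complex t 0 * _ = Complex (t * a) (t * c)) ?log_mod_cexp//.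
    by apply/eqP; rewrite eq_complex /= !mul0r subr0 addr0 !eqxx.
  rewrite derive1E.
  have := @is_deriveD R R^o R^o (cst (ell x)) (id \* cst a)%R 0 1 0 a _ _.
  move=> h; have [] := h; last by move=> _; rewrite add0r; exact.
  have := @is_deriveM R R^o id (cst a) 0 1 1 0 _ _.
  by move=> /(_ _ _)/is_derive_eq; apply; rewrite scaler0 add0r -[_ *: _]/(_ * _) mulr1.
(* Outside $p^{-1}(U)$ the function [ell] has no meaning, but [chi] vanishes off the closed set [K]
   contained in [U], so each clause is checked separately over [U] and over the complement of
   [K]. *)
exists chi, (fun x v => chi (p x) * v ell), W; split=> //; split=> //.
- split=> [x v w k _ _|V X oV vX]; first by rewrite -[(k *: v + w) ell]/(k * v ell + w ell); ring.
  have schip := smooth_on_p bundle (@openT Nb) schi.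
  apply: smooth_on_local => x Vx.
  have [Ux|nUx] := pselect (U (p x)).
    have oVU : open (V `&` p @^-1` U) by exact: openI.
    exists (V `&` p @^-1` U) => //; apply: smooth_on_mul => //.
      exact: smooth_on_sub schip.
    by apply: vX.2 => //; apply: smooth_on_sub s_ell => y [].
  have oKc : open (p @^-1` (~` K)).
    by apply: (open_preimage_p bundle); exact: closed_openC.
  exists (p @^-1` (~` K)); first by move=> /KU.
  apply: (smooth_on_eq oKc _ (smooth_on_cst _ 0)) => y nK.
  by rewrite chi0// mul0r.
- move=> x; have [Kx|nKx] := pselect (K (p x)); last by rewrite chi0// !mul0r.
  by rewrite -(fundi proj) -(fund1 proj) !fund_ell ?mulr1 ?mulr0//; exact: KU.
- move=> x v z z0 tv; rewrite (p_act bundle)//.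
  have [Kx|nKx] := pselect (K (p x)); last by rewrite chi0// !mul0r.
  have Ux := KU _ Kx; congr (_ * _).
  rewrite dmapE; last by apply: ell_near; rewrite (p_act bundle).
  rewrite (@tangent_eq _ _ _ (p @^-1` U) x v _ (fun y => ell y + log_mod (ofC z))
    oW Ux _ tv); last by move=> y Uy /=; exact: ell_act.
  rewrite (tangent_add tv (ell_near _ Ux) (smooth_near_cst _ _)).
  by rewrite (tangent_cst _ tv) addr0.
- move=> x v z z0 tv; rewrite (p_act bundle)//.
  have [Kx|nKx] := pselect (K (p x)); last by rewrite chi0// !mul0r.
  have Ux := KU _ Kx; congr (_ * _).
  (* Invariance of $\gamma\circ J$: with [V] an invariant extension of [v] and $T$ fundamental,
     $[T,JV]=0$ gives $T(JV\,\ell)=JV(T\ell)=0$, as $T\ell$ is constant. Hence $JV\,\ell$ is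
     constant on orbits. *)
  have [V [vV Vx iV]] := invariant_extension tv.
  have lV l X : fundamental_vfield act l = X -> vfield X -> lie X V = 0.
    by move=> eX vX; rewrite -eX; apply: (invariant_lie bundle) => //; rewrite eX.
  have vJV := vfield_fapp JN vV.
  have l1 := lie_xi_J conical vV (lV _ _ (fund1 proj) vxi).
  have l2 := lie_eta_J conical vV (lV _ _ (fundi proj) veta).
  have step l X y : fundamental_vfield act l = X -> lie X (JF V) = 0 ->
      U (p y) -> fundamental_vfield act l y (fun y => (JF V) y ell) = 0.
    move=> eX lX Uy; rewrite eX.
    have := lieE X (JF V) (ell_near y Uy); rewrite lX => /esym/subr0_eq ->.
    rewrite (@tangent_eq _ _ _ (p @^-1` U) y _ _ (fun=> complex.Re l) oW Uy _
      (vJV.1 y I)); first exact: (tangent_cst _ (vJV.1 y I)).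
    by move=> y' Uy'; rewrite -eX fund_ell.
  rewrite -Vx -iV//.
  apply: (orbit_const bundle (W := p @^-1` U) (h := fun y => (JF V) y ell)) => //.
  + by move=> y w w0 Uy; rewrite /= (p_act bundle).
  + by apply: vJV.2.
  + by move=> y; apply: step (fund1 proj) l1.
  + by move=> y; apply: step (fundi proj) l2.
Qed.

(* Second countability gives countably many [chi k] whose plateaus
   [{chi k = 1}] cover; the recursion [sigma (k+1) = sigma k + (1 - sigma k) chi k]
   stabilizes at 1 on each plateau, so no local finiteness is needed. *)
Lemma connection_form_exists : exists alpha : form1 R N,
  principal_connection_form10 J act alpha.
Proof.
have [Bs /countable_injP[f finj] [Bopen Bnbhs]] := @manifold_second_countable _ _ Nb.
(* The countable basis is indexed by natural numbers through the injection [f]; a number that codes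
   no basic set gets the empty set. *)
pose e k : set Nb := xget set0 [set O | Bs O /\ f O = k].
have eP O : Bs O -> e (f O) = O.
  move=> BO; rewrite /e; case: xgetP => [Q _ [BQ fQ]|/(_ O)[]//].
  by apply: finj => //; rewrite inE.
(* A basic set on which some scaled form has weight 1 receives such a form; any other index receives
   the zero form, which leaves the later sums unchanged. *)
have /choice[datum datumP] : forall k, exists cg : (Nb -> R) * form1 R N,
    scaled_form cg.1 cg.2 /\
    ((exists chi gamma, scaled_form chi gamma /\ forall y, e k y -> chi y = 1) ->
      forall y, e k y -> cg.1 y = 1).
  move=> k; have [[chi [gamma [sf h]]]|nex] := pselect (exists chi gamma,
      scaled_form chi gamma /\ forall y, e k y -> chi y = 1).
    by exists (chi, gamma).
  by exists (fun=> 0, fun _ _ => 0); split=> //; exact: scaled_form0.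
pose chi k := (datum k).1; pose gamma k := (datum k).2.
have plateau b : exists k, [/\ open (e k), e k b & forall y, e k y -> chi k y = 1].
  have [chi' [gamma' [W [sf [oW Wb] W1]]]] := local_form b.
  have [Q [BQ Qb] QW] : filter_from [set U | Bs U /\ U b] id W.
    by apply: Bnbhs; exact: open_nbhs_nbhs.
  exists (f Q); rewrite eP//; split=> //; first exact: Bopen.
  move=> y Qy; apply: (datumP (f Q)).2; rewrite eP//.
  by exists chi', gamma'; split=> // y' /QW; exact: W1.
pose fix S k : (Nb -> R) * form1 R N := if k is k'.+1 then
  (fun b => (S k').1 b + (1 - (S k').1 b) * chi k' b,
   fun x v => (S k').2 x v + (1 - (S k').1 (p x)) * gamma k' x v)
  else (fun=> 0, fun _ _ => 0).
have SP k : scaled_form (S k).1 (S k).2.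
  elim: k => [|k IH]; first exact: scaled_form0.
  apply: scaled_form_add => //; first exact: (datumP k).1.
  have [sS _ _ _ _] := IH; have oT := @openT Nb.
  apply: smooth_on_add => //; first exact: smooth_on_cst.
  apply: (smooth_on_eq oT _ (smooth_on_mul oT (smooth_on_cst setT (-1)) sS)).
  by move=> y _; rewrite mulN1r.
have S1 k j b : chi k b = 1 -> (k < j)%N -> (S j).1 b = 1.
  move=> ck; elim: j => // j IH; rewrite ltnS leq_eqVlt => /orP[/eqP<-|/IH e1] /=.
    by rewrite ck mulr1 addrC subrK.
  by rewrite e1 subrr mul0r addr0.
(* Stage [k.+1] is the first one to contain [chi k]. From there on the total weight is 1 at such a
   point, so every further increment carries the factor 0. *)
have Sstab k j x : chi k (p x) = 1 -> (k < j)%N -> (S j).2 x = (S k.+1).2 x.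
  move=> ck; elim: j => // j IH; rewrite ltnS leq_eqVlt => /orP[/eqP<-//|kj].
  rewrite -(IH kj) /=; apply/funext => v.
  by rewrite (S1 k j)// subrr mul0r addr0.
have Seq k k' x : chi k (p x) = 1 -> chi k' (p x) = 1 ->
    (S k.+1).2 x = (S k'.+1).2 x.
  move=> ck ck'; rewrite -(Sstab k (maxn k k').+1)// -?(Sstab k' (maxn k k').+1)//.
    by rewrite ltnS leq_maxr.
  by rewrite ltnS leq_maxl.
have /choice[K KP] := plateau.
(* The stopping index depends on the base point in an uncontrolled way. By [Seq] any index whose
   plateau contains the point gives the same form, so on the open set [e k] the form [alpha] is the
   single smooth stage [S k.+1]. *)
pose alpha : form1 R N := fun x => (S (K (p x)).+1).2 x.
exists alpha; apply: scaled_form1; split.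
- exact: smooth_on_cst.
- split=> [x v w k tv tw|U X oU vX].
    by have [_ [+ _] _ _ _] := SP (K (p x)).+1; apply.
  apply: smooth_on_local => x Ux; have [oe ex e1] := KP (p x).
  set k := K (p x) in oe ex e1.
  have oV : open (U `&` p @^-1` (e k)).
    by apply: openI => //; exact: (open_preimage_p bundle).
  exists (U `&` p @^-1` (e k)) => //.
  have [_ [_ +] _ _ _] := SP k.+1 => /(_ _ X oV (vfield_on_sub (@subIsetl _ _ _) vX)).
  apply: smooth_on_eq => // y [Uy ey]; rewrite /alpha.
  have [_ eyy ey1] := KP (p y).
  by rewrite (Seq k (K (p y)))//; [exact: e1|exact: ey1].
- move=> x; have [_ ex e1] := KP (p x); have [_ _ + _ _] := SP (K (p x)).+1.
  move=> /(_ x)[g1 g2]; split=> //; rewrite /alpha g1.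
  by apply: (S1 (K (p x))) => //; exact: e1.
- move=> x v z z0 tv; rewrite /alpha (p_act bundle)//.
  by have [_ _ _ + _] := SP (K (p x)).+1; apply.
- move=> x v z z0 tv; rewrite /alpha (p_act bundle)//.
  by have [_ _ _ _] := SP (K (p x)).+1; apply.
Qed.

End FormExistence.

(** * C-projective classes *)

Section CProjective.
Context {R : realType} {d : nat} {M : manifold R d} {J : endo R M}.
Implicit Types (D : conn R M) (theta : form1 R M).

Lemma one_form_lin theta theta' (k : R) : one_form theta -> one_form theta' ->
  one_form (fun x v => k * theta x v + theta' x v).
Proof.
move=> [ol os] [ol' os']; split=> [x v w c tv tw|U X oU vX].
  by rewrite ol// ol'//; ring.
apply: smooth_on_add => //; last exact: os'.
by apply: smooth_on_mul => //; [exact: smooth_on_cst|exact: os].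
Qed.

Lemma one_form0 : one_form (fun (_ : M) (_ : tvec R M) => 0 : R).
Proof.
split=> [x v w k _ _|U X _ _]; first by rewrite mulr0 addr0.
exact: smooth_on_cst.
Qed.

(** Connections that coincide on vector fields can still be distinct raw functions; the form
    $\theta=0$ relates them, and so their classes are equal. *)
Lemma cproj_related_agree D1 D2 :
  (forall X Y, vfield X -> vfield Y -> D1 X Y = D2 X Y) -> cproj_related J D1 D2.
Proof.
move=> e; exists (fun _ _ => 0); first exact: one_form0.
move=> X Y vX vY; rewrite e//; apply/funext => x; apply/funext => f.
by rewrite /fscale /feval !fctE -![_ *: _]/(_ * _); ring.
Qed.

Lemma cproj_related_sym D1 D2 : cproj_related J D1 D2 -> cproj_related J D2 D1.
Proof.
move=> [theta ot e]; exists (fun x v => -1 * theta x v + 0).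
  exact: one_form_lin one_form0.
move=> X Y vX vY; rewrite e//; apply/funext => x; apply/funext => f.
by rewrite /fscale /feval !fctE -![_ *: _]/(_ * _); ring.
Qed.

Lemma cproj_related_trans D1 D2 D3 : cproj_related J D1 D2 ->
  cproj_related J D2 D3 -> cproj_related J D1 D3.
Proof.
move=> [theta ot e] [theta' ot' e'].
exists (fun x v => 1 * theta x v + theta' x v); first exact: one_form_lin.
move=> X Y vX vY; rewrite e// e'//; apply/funext => x; apply/funext => f.
by rewrite /fscale /feval !fctE -![_ *: _]/(_ * _); ring.
Qed.

Lemma cproj_class_eq D1 D2 : cproj_related J D1 D2 ->
  cproj_class J D1 = cproj_class J D2.
Proof.
move=> r; apply/seteqP; split=> D' [tD' r']; split=> //.
  exact: cproj_related_trans r' r.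
exact: cproj_related_trans r' (cproj_related_sym r).
Qed.

End CProjective.

Theorem proposition7p3 (R : realType) (n m : nat)
    (N : manifold R (n + n)) (J : endo R N) (D : conn R N) (xi : vfld R N)
    (Nb : manifold R (m + m)) (Jb : endo R Nb)
    (p : N -> Nb) (act : R[i]%C -> N -> N) :
  conical_special_complex J D xi ->
  projective_special_complex J xi Jb p act ->
  exists! C : set (conn R Nb),
    cproj_structure Jb C /\
    forall alpha : form1 R N, principal_connection_form10 J act alpha ->
      (forall X : vfld R Nb, vfield X ->
         vfield (hlift J p alpha X) /\
         projects_to p (hlift J p alpha X) X) /\
      exists Db : conn R Nb,
        [/\ forall X Y : vfld R Nb, vfield X -> vfield Y ->
              projects_to p
                (nabla' J D (hlift J p alpha X) (hlift J p alpha Y)) (Db X Y),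
            torsion_free_complex Jb Db &
            cproj_class Jb Db = C].
Proof.
move=> conical proj.
have [alpha0 c0] := connection_form_exists conical proj.
have [s ps] := p_surj proj.
pose desc alpha : conn R Nb := descended (J := J) (D := D) (p := p) alpha s.
exists (cproj_class Jb (desc alpha0)); split.
  split.
    exists (desc alpha0) => //.
    exact: (descended_torsion_free_complex conical proj c0 ps).
  move=> alpha calpha; split=> [X vX|].
    split; first exact: (hlift_vfield conical proj calpha vX).
    exact: (hlift_projects conical proj calpha vX).
  exists (desc alpha); split.
  - exact: (descended_projects conical proj calpha ps).
  - exact: (descended_torsion_free_complex conical proj calpha ps).
  - exact/cproj_class_eq/(descended_change conical proj c0 calpha ps).
(* Uniqueness: a competing class is tested on the one form [alpha0]. Its connection [Db] has the
   same projections as [desc alpha0], and every point of the base is some [p (s b)], so the two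
   agree on vector fields. *)
move=> C [_ /(_ alpha0 c0)[_ [Db [pDb _ <-]]]].
apply/cproj_class_eq/cproj_related_agree => X Y vX vY; apply/funext => b.
rewrite -(ps b) -(pDb X Y vX vY).
exact: esym (descended_projects conical proj c0 ps vX vY (s b)).
Qed.
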